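(* Let $\mathcal{H}^{(3)}$ be the semi-infinite matrix with entries, for $m,n\in\mathbb{N}_0$, $$\mathcal{H}^{(3)}_{m,n}=(-1)^{m(m-1)/2+n(n-1)/2}\,\frac{1}{\sqrt{m!\,n!}}\;\Gamma\!\left(\frac{m+n+1}{2}\right)$$ if $m+n$ is even, and $\mathcal{H}^{(3)}_{m,n}=0$ if $m+n$ is odd. Then $\mathcal{H}^{(3)}$ determines a unique self-adjoint operator $H^{(3)}$ on $\ell^2(\mathbb{N}_0)$, which is unitarily equivalent, via the unitary mapping $U:\ell^2(\mathbb{N}_0)\to L^2(\mathbb{R},d\mu)$ determined by $Ue_n=\hat P_n$ for all $n\in\mathbb{N}_0$ (where $\{\hat P_n\mid n\in\mathbb{N}_0\}$ is an orthonormal basis of $L^2(\mathbb{R},d\mu)$), to the operator $T_h$ of multiplication by $h$ on $L^2(\mathbb{R},d\mu)$, i.e. $UH^{(3)}U^{-1}=T_h$. Here $\mu$ is absolutely continuous, supported on $\mathbb{R}$, with density $$\frac{d\mu}{dx}(x)=\frac{1}{\sqrt{\pi}}e^{-x^{2}},\qquad h(x)=\sqrt{2\pi}\,e^{-x^{2}},\qquad \hat P_n(x)=\frac{1}{\sqrt{2^{n}n!}}H_n(x),$$ for $x\in\mathbb{R}$, where $H_n$ are the Hermite polynomials. Consequently, $H^{(3)}$ is a bounded operator with $$\operatorname{spec}(H^{(3)})=\operatorname{spec}_{\mathrm{ac}}(H^{(3)})=[0,\sqrt{2\pi}]\quad\text{and}\quad\|H^{(3)}\|=\sqrt{2\pi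}.$$
   Context: $\mathbb{N}_0=\{0,1,2,\dots\}$; $\{e_n\mid n\in\mathbb{N}_0\}$ is the standard basis of $\ell^2(\mathbb{N}_0)$. Hermite polynomials: $H_n(x)=(2x)^n\,{}_2F_0\!\left(-\tfrac n2,-\tfrac{n-1}{2};-\,\big|\,-\tfrac1{x^2}\right)=n!\sum_{j=0}^{\lfloor n/2\rfloor}\frac{(-1)^j(2x)^{n-2j}}{j!\,(n-2j)!}$. A real symmetric semi-infinite matrix $\mathcal{A}$ whose columns belong to $\ell^2(\mathbb{N}_0)$ is said to determine a unique self-adjoint operator $A$ on $\ell^2(\mathbb{N}_0)$ if $A_{\min}=A_{\max}=:A$. Here $A_{\min}$ is the closure of the operator $x\mapsto\mathcal{A}x$ (formal matrix product) with domain $\operatorname{span}\{e_n\mid n\in\mathbb{N}_0\}$, and $A_{\max}x=\mathcal{A}x$ with domain $\{x\in\ell^2(\mathbb{N}_0)\mid\mathcal{A}x\in\ell^2(\mathbb{N}_0)\}$. $T_h$ is the multiplication operator $T_h\psi=h\psi$ with domain $\{\psi\in L^2(\mathbb{R},d\mu)\mid h\psi\in L^2(\mathbb{R},d\mu)\}$. $\operatorname{spec}$ and $\operatorname{spec}_{\mathrm{ac}}$ denote the spectrum and the absolutely continuous spectrum. *)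

(* Defs.v *)
From HB Require Import structures.
From mathcomp Require Import all_boot all_order all_algebra.
From mathcomp Require Import complex ring lra.
From mathcomp Require Import all_classical all_reals all_analysis.
From mathcomp Require Import measurable_realfun.
Set Implicit Arguments.
Unset Strict Implicit.
Unset Printing Implicit Defensive.
Import Order.TTheory GRing.Theory Num.Theory numFieldNormedType.Exports.
Local Open Scope classical_set_scope.
Local Open Scope complex_scope.
Local Open Scope ring_scope.

(* R[i] carries no topology by default; this gives it the one of its modulus. *)
HB.instance Definition _ (R : realType) := NormedModule.copy R[i] R[i]^o.

(* Complex inner product spaces, the inner product being linear in its first
   argument. Norms take values in R[i]; in ring_scope, z^* is Num.conj. *)
HB.mixin Record NormedModule_isPreHilbert (R : realType) V
    & NormedModule R[i] V := {
  inner : V -> V -> R[i];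
  inner_linearl : forall (a : R[i]) (x y z : V),
    inner (a *: x + y) z = a * inner x z + inner y z;
  inner_conj : forall x y : V, inner y x = (inner x y)^*;
  sqr_norm_inner : forall x : V, `|x| ^+ 2 = inner x x
}.

#[short(type="preHilbertType")]
HB.structure Definition PreHilbert (R : realType) :=
  { V of NormedModule R[i] V & NormedModule_isPreHilbert R V }.

HB.factory Record Lmodule_isPreHilbert (R : realType) V
    & GRing.Lmodule R[i] V := {
  inner : V -> V -> R[i];
  inner_linearl : forall (a : R[i]) (x y z : V),
    inner (a *: x + y) z = a * inner x z + inner y z;
  inner_conj : forall x y : V, inner y x = (inner x y)^*;
  inner_ge0 : forall x : V, 0 <= inner x x;
  inner_eq0 : forall x : V, inner x x = 0 -> x = 0
}.

HB.builders Context R V & Lmodule_isPreHilbert R V.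

Let innerDl x y z : inner (x + y) z = inner x z + inner y z.
Proof. by rewrite -[x]scale1r inner_linearl mul1r scale1r. Qed.
Let inner0l z : inner 0 z = 0.
Proof. by apply: (addIr (inner 0 z)); rewrite -innerDl !add0r. Qed.
Let innerZl a x z : inner (a *: x) z = a * inner x z.
Proof. by rewrite -[a *: x]addr0 inner_linearl inner0l addr0. Qed.
Let innerDr x y z : inner z (x + y) = inner z x + inner z y.
Proof. by rewrite inner_conj innerDl rmorphD /= -!inner_conj. Qed.
Let innerZr a x z : inner z (a *: x) = a^* * inner z x.
Proof. by rewrite inner_conj innerZl rmorphM /= -inner_conj. Qed.

Let cs x y : `|inner x y| ^+ 2 <= inner x x * inner y y.
Proof.
have [y0|y0] := eqVneq (inner y y) 0.
  by rewrite (inner_eq0 y0) (inner_conj 0 x) !inner0l rmorph0 normr0 expr0n mulr0.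
have yp : 0 < inner y y by rewrite lt_def y0 inner_ge0.
pose t := inner x y / inner y y.
have tj : t^* = inner y x / inner y y.
  by rewrite rmorphM /= fmorphV /= -inner_conj -inner_conj.
have := inner_ge0 (x + (- t) *: y).
rewrite innerDl !innerDr !innerZl !innerZr rmorphN /= tj.
have -> : inner x x + - (inner y x / inner y y) * inner x y +
   (- t * inner y x + - t * (- (inner y x / inner y y) * inner y y)) =
   inner x x - `|inner x y| ^+ 2 / inner y y.
  rewrite normCK -inner_conj /t; field.
  exact: y0.
by rewrite subr_ge0 ler_pdivrMr.
Qed.

Let nrm x : R[i] := sqrtc (inner x x).
Let nrm_sqr x : nrm x ^+ 2 = inner x x. Proof. exact: sqr_sqrtc. Qed.
Let nrm_ge0 x : 0 <= nrm x. Proof. by rewrite sqrtc_ge0 inner_ge0. Qed.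

Let nrmD x y : nrm (x + y) <= nrm x + nrm y.
Proof.
rewrite -(@ler_pXn2r _ 2) ?nnegrE ?addr_ge0 ?nrm_ge0//.
rewrite sqrrD !nrm_sqr innerDl !innerDr [X in _ + (X + _)]inner_conj.
have : inner x y + (inner x y)^* <= (nrm x * nrm y) *+ 2.
  rewrite (addcJ (inner x y) : _ + _^* = _) -[leRHS]mulr_natl ler_pM2l//.
  apply: (@le_trans _ _ `|inner x y|).
    apply: le_trans (normc_ge_Re _).
    by rewrite lecR ler_norm.
  rewrite -(@ler_pXn2r _ 2) ?nnegrE ?mulr_ge0 ?nrm_ge0//.
  by rewrite exprMn !nrm_sqr cs.
by move=> h; rewrite addrA -(addrA (inner x x)) lerD2r lerD2l.
Qed.

Let nrmZ (l : R[i]) x : nrm (l *: x) = `|l| * nrm x.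
Proof.
apply/eqP; rewrite -(@eqrXn2 _ 2) ?mulr_ge0 ?nrm_ge0//.
by rewrite exprMn !nrm_sqr innerZl innerZr normCK mulrA.
Qed.

Let nrm_eq0 x : nrm x = 0 -> x = 0.
Proof. by move=> h; apply: inner_eq0; rewrite -nrm_sqr h expr0n. Qed.

HB.instance Definition _ := Lmodule_isNormed.Build R[i] V nrmD nrmZ nrm_eq0.
HB.instance Definition _ := NormedModule_isPreHilbert.Build R V
  inner_linearl inner_conj nrm_sqr.
HB.end.

Section square_summable.
Context {R : realType}.
Implicit Types z w : R[i].

Definition abs2 z : R := complex.Re z ^+ 2 + complex.Im z ^+ 2.

Lemma abs2E z : (abs2 z)%:C = z * z^*.
Proof. by rewrite /abs2 add_Re2_Im2 normCK. Qed.

Lemma abs2_ge0 z : 0 <= abs2 z.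
Proof. by rewrite addr_ge0 ?sqr_ge0. Qed.

Lemma abs2_eq0 z : abs2 z = 0 -> z = 0.
Proof.
move=> h; apply/eqP; rewrite -[_ == 0]orbb -mulf_eq0.
case: z h => a b /= /eqP; rewrite /abs2 /= paddr_eq0 ?sqr_ge0// !sqrf_eq0.
by move=> /andP[/eqP-> /eqP->]; rewrite mul0r.
Qed.

Lemma abs2D a z w :
  abs2 (a * z + w) <= 2 * abs2 a * abs2 z + 2 * abs2 w.
Proof.
rewrite -subr_ge0 (_ : _ - _ = abs2 (a * z - w)) ?abs2_ge0//.
by case: a z w => a b [c d] [e f]; rewrite /abs2 /=; ring.
Qed.

Lemma Re_mulJ_le z w : `|complex.Re (z * w^*)| <= abs2 z + abs2 w.
Proof.
case: z w => a b [c d]; rewrite /abs2 /= ler_norml.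
have := sqr_ge0 (a + c); have := sqr_ge0 (a - c).
have := sqr_ge0 (b + d); have := sqr_ge0 (b - d).
have := sqr_ge0 a; have := sqr_ge0 b; have := sqr_ge0 c; have := sqr_ge0 d.
by rewrite !expr2 => *; apply/andP; split; lra.
Qed.

Lemma Im_mulJ_le z w : `|complex.Im (z * w^*)| <= abs2 z + abs2 w.
Proof.
case: z w => a b [c d]; rewrite /abs2 /= ler_norml.
have := sqr_ge0 (a + d); have := sqr_ge0 (a - d).
have := sqr_ge0 (b + c); have := sqr_ge0 (b - c).
have := sqr_ge0 a; have := sqr_ge0 b; have := sqr_ge0 c; have := sqr_ge0 d.
by rewrite !expr2 => *; apply/andP; split; lra.
Qed.

Definition square_summable (x : nat -> R[i]) : Prop :=
  cvgn (series (fun n => abs2 (x n))).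

Definition l2seq : {pred (nat -> R[i])} := [pred x | `[< square_summable x >]].

Lemma l2seq_submod : submod_closed l2seq.
Proof.
split=> [|a x y /asboolP sx /asboolP sy]; apply/asboolP.
  rewrite /square_summable (_ : series _ = cst 0); first exact: is_cvg_cst.
  apply/funext => n; rewrite /series /= big1 // => i _.
  by rewrite /abs2 /= expr0n /= addr0.
apply: (@series_le_cvg _ _
   (fun n => 2 * abs2 a * abs2 (x n) + 2 * abs2 (y n))).
- by move=> n; exact: abs2_ge0.
- by move=> n; rewrite addr_ge0 ?mulr_ge0 ?abs2_ge0.
- by move=> n; exact: abs2D.
- have -> : series (fun n => 2 * abs2 a * abs2 (x n) + 2 * abs2 (y n)) =
    (fun n => 2 * abs2 a * series (fun n => abs2 (x n)) n +
              2 * series (fun n => abs2 (y n)) n).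
    by apply/funext => n; rewrite /series /= big_split /= -!mulr_sumr.
  by apply: is_cvgD; apply: is_cvgM => //; exact: is_cvg_cst.
Qed.

HB.instance Definition _ := GRing.isSubmodClosed.Build R[i] (nat -> R[i]) l2seq
  l2seq_submod.

End square_summable.

Section complex_limits.
Context {R : realType}.

Lemma cvg_real_complex (u : nat -> R) (l : R) :
  u @ \oo --> l -> (fun n => (u n)%:C) @ \oo --> l%:C.
Proof.
move=> /cvgrPdist_lt ul; apply/cvgrPdist_lt => -[e e'].
rewrite ltcE /= => /andP[/eqP -> e0].
near=> n.
rewrite -[_%:C - _%:C]rmorphB normc_def /= expr0n addr0 sqrtr_sqr ltcR.
by near: n; exact: ul.
Unshelve. all: by end_near. Qed.

Lemma cvg_complex (u : nat -> R[i]) (a b : R) :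
  (fun n => complex.Re (u n)) @ \oo --> a ->
  (fun n => complex.Im (u n)) @ \oo --> b -> u @ \oo --> (a +i* b : R[i]).
Proof.
move=> /cvg_real_complex ua /cvg_real_complex ub.
rewrite (complexE (a +i* b)) /=.
rewrite (_ : u = fun n => (complex.Re (u n))%:C + 'i%C * (complex.Im (u n))%:C).
  have ic : (fun=> 'i%C : R[i]) @ \oo --> ('i%C : R[i]) by exact: cvg_cst.
  exact: (cvgD ua (cvgM ic ub)).
by apply/funext => n; exact: complexE.
Qed.

Lemma cvg_conj (u : nat -> R[i]) (l : R[i]) :
  u @ \oo --> l -> (fun n => (u n)^*) @ \oo --> l^*.
Proof.
move=> /cvgrPdist_lt ul; apply/cvgrPdist_lt => e e0.
near=> n; rewrite -rmorphB /= norm_conjC.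
by near: n; exact: ul.
Unshelve. all: by end_near. Qed.

End complex_limits.

(* The complex Hilbert space of square-summable sequences. *)
Record l2 (R : realType) := MkL2 { l2val :> nat -> R[i] ; _ : l2val \in l2seq }.

Section l2_space.
Context {R : realType}.

HB.instance Definition _ := [isSub for @l2val R].
HB.instance Definition _ := [Choice of l2 R by <:].
HB.instance Definition _ := [SubChoice_isSubLmodule of l2 R by <:].

Lemma l2P (x : l2 R) : square_summable x.
Proof. by have /asboolP := valP x. Qed.

Lemma is_cvg_l2_inner (x y : l2 R) :
  cvgn (series (fun n => x n * (y n)^*)).
Proof.
have cvg_dom (f : nat -> R) :
    (forall n, `|f n| <= abs2 (x n) + abs2 (y n)) -> cvgn (series f).
  move=> fxy; apply: normed_cvg.
  apply: (@series_le_cvg _ _ (fun n => abs2 (x n) + abs2 (y n))) => //.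
  - by move=> n; exact: normr_ge0.
  - by move=> n; rewrite addr_ge0 ?abs2_ge0.
  - rewrite (_ : series _ =
      series (fun n => abs2 (x n)) \+ series (fun n => abs2 (y n))).
      by apply: is_cvgD; exact: l2P.
    by apply/funext => n; rewrite /series /= big_split.
have /cvg_dom/cvg_ex[a cre] := fun n => Re_mulJ_le (x n) (y n).
have /cvg_dom/cvg_ex[b cim] := fun n => Im_mulJ_le (x n) (y n).
apply/cvg_ex; exists (a +i* b : R[i]); apply: cvg_complex.
- rewrite (_ : (fun n => _) = series (fun n => complex.Re (x n * (y n)^*))) //.
  by apply/funext => n; rewrite /series /= (raddf_sum (@complex.Re R : Rcomplex R -> R)).
- rewrite (_ : (fun n => _) = series (fun n => complex.Im (x n * (y n)^*))) //.
  by apply/funext => n; rewrite /series /= (raddf_sum (@complex.Im R : Rcomplex R -> R)).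
Qed.

Definition l2_inner (x y : l2 R) : R[i] :=
  limn (series (fun n => x n * (y n)^*)).

Lemma l2_inner_linearl (a : R[i]) (x y z : l2 R) :
  l2_inner (a *: x + y) z = a * l2_inner x z + l2_inner y z.
Proof.
apply/cvg_lim => //.
rewrite (_ : series _ = fun n => a * series (fun n => x n * (z n)^*) n +
                       series (fun n => y n * (z n)^*) n).
  apply: cvgD; last exact: is_cvg_l2_inner.
  by apply: cvgM; [exact: cvg_cst|exact: is_cvg_l2_inner].
apply/funext => n; rewrite /series /= mulr_sumr -big_split /=.
by apply: eq_bigr => i _; rewrite mulrDl mulrA.
Qed.

Lemma l2_inner_conj (x y : l2 R) : l2_inner y x = (l2_inner x y)^*.
Proof.
apply/cvg_lim => //.
rewrite (_ : series _ = fun n => (series (fun n => x n * (y n)^*) n)^*).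
  by apply: cvg_conj; exact: is_cvg_l2_inner.
apply/funext => n; rewrite /series /= rmorph_sum /=.
by apply: eq_bigr => i _; rewrite rmorphM /= conjCK mulrC.
Qed.

Lemma l2_inner_self (x : l2 R) :
  l2_inner x x = (limn (series (fun n => abs2 (x n))))%:C.
Proof.
apply/cvg_lim => //.
rewrite (_ : series _ = fun n => (series (fun n => abs2 (x n)) n)%:C).
  by apply: cvg_real_complex; exact: l2P.
apply/funext => n; rewrite /series /= rmorph_sum /=.
by apply: eq_bigr => i _; rewrite abs2E.
Qed.

Let nd_abs2 (x : l2 R) : nondecreasing_seq (series (fun n => abs2 (x n))).
Proof.
apply/nondecreasing_seqP => n; rewrite /series /= big_nat_recr //=.
by rewrite lerDl abs2_ge0.
Qed.

Lemma l2_inner_ge0 (x : l2 R) : 0 <= l2_inner x x.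
Proof.
rewrite l2_inner_self ler0c.
have := nondecreasing_cvgn_le (nd_abs2 x) (@l2P x) 0%N.
by rewrite /series /= big_geq.
Qed.

Lemma l2_inner_eq0 (x : l2 R) : l2_inner x x = 0 -> x = 0.
Proof.
rewrite l2_inner_self => -[lim0]; apply/val_inj/funext => n /=.
apply/abs2_eq0/eqP; rewrite eq_le abs2_ge0 andbT -lim0.
have := nondecreasing_cvgn_le (nd_abs2 x) (@l2P x) n.+1.
apply: le_trans; rewrite /series /= big_nat_recr //= lerDr.
by apply: sumr_ge0 => i _; exact: abs2_ge0.
Qed.

HB.instance Definition _ := Lmodule_isPreHilbert.Build R (l2 R)
  l2_inner_linearl l2_inner_conj l2_inner_ge0 l2_inner_eq0.

Lemma l2_basis_subproof (n : nat) :
  (fun m => (m == n)%:R : R[i]) \in @l2seq R.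
Proof.
apply/asboolP; apply: (@is_cvg_near_cst _ R^o 1).
near=> m; have nm : (n < m)%N by near: m; exact: nbhs_infty_gt.
rewrite /series /= (bigD1_seq n) ?mem_index_iota ?iota_uniq //=.
rewrite eqxx big1 ?addr0 => [|i /negPf ->].
  by rewrite /abs2 /= expr1n expr0n addr0.
by rewrite /abs2 /= expr0n addr0.
Unshelve. all: by end_near. Qed.

Definition l2_basis (n : nat) : l2 R := MkL2 (l2_basis_subproof n).

End l2_space.

Section square_integrable.
Context d {T : measurableType d} {R : realType}.
Variable mu : {measure set T -> \bar R}.
Implicit Types f g : T -> R[i].

Definition measurable_complex f : Prop :=
  measurable_fun setT (fun t => complex.Re (f t)) /\
  measurable_fun setT (fun t => complex.Im (f t)).

Definition square_integrable f : Prop :=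
  measurable_complex f /\ (\int[mu]_t (abs2 (f t))%:E < +oo)%E.

Lemma measurable_abs2 f : measurable_complex f ->
  measurable_fun setT (fun t => abs2 (f t)).
Proof.
by move=> [mre mim]; apply: measurable_funD; apply: measurable_funX.
Qed.

Lemma measurable_complexM f g : measurable_complex f -> measurable_complex g ->
  measurable_complex (fun t => f t * g t).
Proof.
move=> [fr fi] [gr gi]; split.
- rewrite (_ : (fun t => _) = (fun t => complex.Re (f t) * complex.Re (g t)
      - complex.Im (f t) * complex.Im (g t))).
    by apply: measurable_funB; apply: measurable_funM.
  by apply/funext => t; case: (f t) (g t) => a b [].
- rewrite (_ : (fun t => _) = (fun t => complex.Re (f t) * complex.Im (g t)
      + complex.Im (f t) * complex.Re (g t))).
    by apply: measurable_funD; apply: measurable_funM.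
  by apply/funext => t; case: (f t) (g t) => a b [].
Qed.

Lemma measurable_complexD f g : measurable_complex f -> measurable_complex g ->
  measurable_complex (fun t => f t + g t).
Proof.
move=> [fr fi] [gr gi]; split.
- rewrite (_ : (fun t => _) =
      (fun t => complex.Re (f t) + complex.Re (g t))).
    exact: measurable_funD.
  by apply/funext => t; case: (f t) (g t) => a b [].
- rewrite (_ : (fun t => _) =
      (fun t => complex.Im (f t) + complex.Im (g t))).
    exact: measurable_funD.
  by apply/funext => t; case: (f t) (g t) => a b [].
Qed.

Lemma measurable_complexJ f : measurable_complex f ->
  measurable_complex (fun t => (f t)^*).
Proof.
move=> [fr fi]; split.
- rewrite (_ : (fun t => _) = (fun t => complex.Re (f t))) //.
  by apply/funext => t; case: (f t).
- rewrite (_ : (fun t => _) = (fun t => - complex.Im (f t))).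
    exact: measurableT_comp.
  by apply/funext => t; case: (f t).
Qed.

Lemma measurable_complex_cst (a : R[i]) : measurable_complex (fun=> a).
Proof. by split; exact: measurable_cst. Qed.

Lemma integrable_abs2 f : square_integrable f ->
  mu.-integrable setT (fun t => (abs2 (f t))%:E).
Proof.
move=> [mf sf]; apply/integrableP; split.
  by apply/measurable_EFinP; exact: measurable_abs2.
under eq_integral do rewrite gee0_abs ?lee_fin ?abs2_ge0//.
exact: sf.
Qed.

Lemma integrable_mulJ f g : square_integrable f -> square_integrable g ->
  mu.-integrable setT (fun t => (complex.Re (f t * (g t)^*))%:E) /\
  mu.-integrable setT (fun t => (complex.Im (f t * (g t)^*))%:E).
Proof.
move=> sf sg.
have ifg : mu.-integrable setT
    ((fun t => (abs2 (f t))%:E) \+ (fun t => (abs2 (g t))%:E))%E.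
  by apply: integrableD => //; exact: integrable_abs2.
have [mre mim] := measurable_complexM sf.1 (measurable_complexJ sg.1).
split; apply: le_integrable ifg => //; try exact/measurable_EFinP.
- move=> t _ /=; rewrite lee_fin [leRHS]ger0_norm; last exact: (addr_ge0 (abs2_ge0 _) (abs2_ge0 _)).
  exact: Re_mulJ_le.
- move=> t _ /=; rewrite lee_fin [leRHS]ger0_norm; last exact: (addr_ge0 (abs2_ge0 _) (abs2_ge0 _)).
  exact: Im_mulJ_le.
Qed.

Definition L2fun : {pred (T -> R[i])} := [pred f | `[< square_integrable f >]].

Lemma L2fun_submod : submod_closed L2fun.
Proof.
split=> [|a f g /asboolP sf /asboolP sg]; apply/asboolP.
  split; first exact: measurable_complex_cst.
  rewrite (_ : (fun t => _) = cst 0%E) ?integral0//.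
  by apply/funext => t; rewrite /abs2 /= expr0n /= addr0.
have mfg : measurable_complex (a *: f + g).
  apply: measurable_complexD sg.1.
  exact: (measurable_complexM (measurable_complex_cst a) sf.1).
split => //.
have ifg : mu.-integrable setT
   ((fun t => (2 * abs2 a)%:E * (abs2 (f t))%:E) \+
    (fun t => 2%:E * (abs2 (g t))%:E))%E.
  by apply: integrableD => //; apply: integrableZl => //; exact: integrable_abs2.
have /integrableP[_] : mu.-integrable setT
    (fun t => (abs2 ((a *: f + g) t))%:E).
  apply: le_integrable ifg => //.
    by apply/measurable_EFinP; exact: measurable_abs2.
  move=> t _ /=; rewrite lee_fin !ger0_norm ?abs2_ge0 ?addr_ge0 ?mulr_ge0 ?abs2_ge0//.
  exact: abs2D.
by under eq_integral do rewrite gee0_abs ?lee_fin ?abs2_ge0//.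
Qed.

HB.instance Definition _ := GRing.isSubmodClosed.Build R[i] (T -> R[i]) L2fun
  L2fun_submod.

Record L2pre := MkL2pre { L2pre_val :> T -> R[i] ; _ : L2pre_val \in L2fun }.

HB.instance Definition _ := [isSub for L2pre_val].
HB.instance Definition _ := [Choice of L2pre by <:].
HB.instance Definition _ := [SubChoice_isSubLmodule of L2pre by <:].

Lemma L2preP (f : L2pre) : square_integrable f.
Proof. by have /asboolP := valP f. Qed.

Definition L2_eq (f g : L2pre) : bool :=
  `[< (f : T -> R[i]) = g %[ae mu] >].

Let L2_eq_refl : reflexive L2_eq.
Proof. by move=> f; apply/asboolP/ae_eq_refl. Qed.
Let L2_eq_sym : symmetric L2_eq.
Proof. by move=> f g; apply/idP/idP => /asboolP h; apply/asboolP/ae_eq_sym. Qed.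
Let L2_eq_trans : transitive L2_eq.
Proof.
by move=> f g h /asboolP gf /asboolP fh; apply/asboolP/(ae_eq_trans gf fh).
Qed.

Canonical L2_eq_canonical :=
  EquivRel L2_eq L2_eq_refl L2_eq_sym L2_eq_trans.

Local Open Scope quotient_scope.

(* Complex-valued square-integrable functions modulo equality mu-almost
   everywhere. An element is read as a function through L2_to_fun, a chosen
   representative, hence only meaningful up to mu-null sets. *)
Definition L2 : Type := {eq_quot L2_eq}.
HB.instance Definition _ := Choice.on L2.
HB.instance Definition _ := EqQuotient.on L2.

Definition L2_to_fun (u : L2) : T -> R[i] := repr u.
Coercion L2_to_fun : L2 >-> Funclass.

Lemma L2_eqP (f g : L2pre) :
  \pi_L2 f = \pi_L2 g <-> (f : T -> R[i]) = g %[ae mu].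
Proof.
by split=> [/eqP|h]; [rewrite eqmodE => /asboolP|apply/eqP; rewrite eqmodE; apply/asboolP].
Qed.

Lemma L2_repr (f : L2pre) : (repr (\pi_L2 f) : T -> R[i]) = f %[ae mu].
Proof. by apply/L2_eqP; rewrite reprK. Qed.

Definition L2_add (u v : L2) : L2 := \pi_L2 (repr u + repr v).
Definition L2_opp (u : L2) : L2 := \pi_L2 (- repr u).
Definition L2_scale (a : R[i]) (u : L2) : L2 := \pi_L2 (a *: repr u).

Let addE (f g : L2pre) : L2_add (\pi_L2 f) (\pi_L2 g) = \pi_L2 (f + g).
Proof.
apply/L2_eqP; have := L2_repr f; have := L2_repr g.
by apply: filterS2 => t /= hg hf _; rewrite !fctE hf ?hg.
Qed.
Let oppE (f : L2pre) : L2_opp (\pi_L2 f) = \pi_L2 (- f).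
Proof.
apply/L2_eqP; have := L2_repr f.
by apply: filterS => t /= hf _; rewrite !fctE hf.
Qed.
Let scaleE (a : R[i]) (f : L2pre) : L2_scale a (\pi_L2 f) = \pi_L2 (a *: f).
Proof.
apply/L2_eqP; have := L2_repr f.
by apply: filterS => t /= hf _; rewrite !fctE hf.
Qed.

Let addA : associative L2_add.
Proof. by elim/quotW => f; elim/quotW => g; elim/quotW => h;
rewrite (addE g h) (addE f g) 2!addE addrA. Qed.
Let addC : commutative L2_add.
Proof. by elim/quotW => f; elim/quotW => g; rewrite !addE addrC. Qed.
Let add0 : left_id (\pi_L2 0) L2_add.
Proof. by elim/quotW => f; rewrite addE add0r. Qed.
Let addN : left_inverse (\pi_L2 0) L2_opp L2_add.
Proof. by elim/quotW => f; rewrite (oppE f) addE addNr. Qed.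

HB.instance Definition _ := GRing.isZmodule.Build L2 addA addC add0 addN.

Let scaleA (a b : R[i]) (v : L2) : L2_scale a (L2_scale b v) = L2_scale (a * b) v.
Proof. by elim/quotW: v => f; rewrite (scaleE b f) 2!scaleE scalerA. Qed.
Let scale1 : left_id 1 L2_scale.
Proof. by elim/quotW => f; rewrite scaleE scale1r. Qed.
Let scaleDr : right_distributive L2_scale +%R.
Proof.
move=> a; elim/quotW => f; elim/quotW => g.
rewrite -[_ + _]/(L2_add _ _) -[RHS]/(L2_add _ _).
by rewrite (addE f g) (scaleE a f) (scaleE a g) scaleE addE scalerDr.
Qed.
Let scaleDl (v : L2) : {morph L2_scale^~ v : a b / a + b}.
Proof.
move=> a b; elim/quotW: v => f.
rewrite -[RHS]/(L2_add _ _) (scaleE a f) (scaleE b f).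
by rewrite scaleE addE scalerDl.
Qed.

HB.instance Definition _ := GRing.Zmodule_isLmodule.Build R[i] L2
  scaleA scale1 scaleDr scaleDl.

Lemma L2_linearE (a : R[i]) (u v : L2) :
  L2_to_fun (a *: u + v) = (fun t => a * u t + v t) %[ae mu].
Proof.
have -> : a *: u + v = \pi_L2 (a *: repr u + repr v).
  elim/quotW: u => f; elim/quotW: v => g.
  rewrite -[LHS]/(L2_add (L2_scale _ _) _).
  rewrite (scaleE a f) addE; apply/L2_eqP; have := L2_repr f; have := L2_repr g.
  by apply: filterS2 => t /= hg hf _; rewrite !fctE hf ?hg.
exact: L2_repr.
Qed.

Definition L2_inner (u v : L2) : R[i] :=
  (\int[mu]_t complex.Re (u t * (v t)^*)) +i*
  (\int[mu]_t complex.Im (u t * (v t)^*)).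

Let eq_Rint (f g : T -> R) : measurable_fun setT f -> measurable_fun setT g ->
  f = g %[ae mu] -> \int[mu]_t f t = \int[mu]_t g t.
Proof.
move=> mf mg fg; rewrite /Rintegral; congr fine; apply: ae_eq_integral => //.
- exact/measurable_EFinP.
- exact/measurable_EFinP.
- by apply: filterS fg => t /= h _; rewrite h.
Qed.

Let mprod (u v : L2) : measurable_complex (fun t => u t * (v t)^*).
Proof.
apply: measurable_complexM; first exact: (L2preP (repr u)).1.
by apply: measurable_complexJ; exact: (L2preP (repr v)).1.
Qed.

Let iprod (u v : L2) := integrable_mulJ (L2preP (repr u)) (L2preP (repr v)).

Lemma L2_inner_linearl (a : R[i]) (x y z : L2) :
  L2_inner (a *: x + y) z = a * L2_inner x z + L2_inner y z.
Proof.
have [ixr ixi] := iprod x z; have [iyr iyi] := iprod y z.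
have mlin : measurable_complex
    (fun t => a * (x t * (z t)^*) + y t * (z t)^*).
  apply: measurable_complexD (mprod y z).
  exact: (measurable_complexM (measurable_complex_cst a) (mprod x z)).
have axy : (fun t => L2_to_fun (a *: x + y) t * (z t)^*) =
    (fun t => a * (x t * (z t)^*) + y t * (z t)^*) %[ae mu].
  by apply: filterS (L2_linearE a x y) => t /= h _; rewrite h// mulrDl mulrA.
rewrite /L2_inner.
rewrite (@eq_Rint _ (fun t => complex.Re (a * (x t * (z t)^*) + y t * (z t)^*))).
- rewrite (@eq_Rint (fun t => complex.Im (L2_to_fun (a *: x + y) t * (z t)^*))
     (fun t => complex.Im (a * (x t * (z t)^*) + y t * (z t)^*))).
  + case: a {axy mlin} => a b.
    have ReE t : complex.Re ((a +i* b) * (x t * (z t)^*) + y t * (z t)^*) =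
        a * complex.Re (x t * (z t)^*) + (- b) * complex.Im (x t * (z t)^*) +
        complex.Re (y t * (z t)^*).
      by case: (x t * _) => ? ?; case: (y t * _) => ? ? /=; rewrite mulNr.
    have ImE t : complex.Im ((a +i* b) * (x t * (z t)^*) + y t * (z t)^*) =
        a * complex.Im (x t * (z t)^*) + b * complex.Re (x t * (z t)^*) +
        complex.Im (y t * (z t)^*).
      by case: (x t * _) => ? ?; case: (y t * _) => ? ?.
    have iZ (c : R) (f : T -> R) : mu.-integrable setT (EFin \o f) ->
        mu.-integrable setT (EFin \o (fun t => c * f t)).
      by move=> fi; rewrite (_ : _ \o _ = (fun t => c%:E * (f t)%:E)%E) //;
        exact: integrableZl.
    have iD (f g : T -> R) : mu.-integrable setT (EFin \o f) ->
        mu.-integrable setT (EFin \o g) ->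
        mu.-integrable setT (EFin \o (fun t => f t + g t)).
      by move=> fi gi; rewrite (_ : _ \o _ = ((EFin \o f) \+ (EFin \o g))%E) //;
        exact: integrableD.
        rewrite (eq_Rintegral _ (fun t _ => ReE t)).
    rewrite (eq_Rintegral _ (fun t _ => ImE t)).
    rewrite !RintegralD ?RintegralZl//; try by [exact: iZ|apply: iD; exact: iZ].
    by apply/eqP; rewrite eq_complex /= mulNr !eqxx.
  + exact: (mprod _ z).2.
  + exact: mlin.2.
  + by apply: filterS axy => t /= h _; rewrite h.
- exact: (mprod _ z).1.
- exact: mlin.1.
- by apply: filterS axy => t /= h _; rewrite h.
Qed.

Lemma L2_inner_conj (x y : L2) : L2_inner y x = (L2_inner x y)^*.
Proof.
have h t : y t * (x t)^* = (x t * (y t)^*)^*.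
  by rewrite rmorphM /= conjCK mulrC.
apply/eqP; rewrite eq_complex; apply/andP; split; apply/eqP => /=.
  by apply: eq_Rintegral => t _; rewrite h; case: (_ * _^*).
rewrite -mulN1r -RintegralZl//; last exact: (iprod x y).2.
by apply: eq_Rintegral => t _; rewrite h mulN1r; case: (_ * _^*).
Qed.

Lemma L2_inner_self (x : L2) :
  L2_inner x x = (\int[mu]_t abs2 (x t))%:C.
Proof.
congr (_ +i* _).
  by apply: eq_Rintegral => t _; rewrite -abs2E.
under eq_Rintegral do rewrite -abs2E.
by rewrite /Rintegral /= integral0.
Qed.

Lemma L2_inner_ge0 (x : L2) : 0 <= L2_inner x x.
Proof.
by rewrite L2_inner_self ler0c; apply: Rintegral_ge0 => t _; exact: abs2_ge0.
Qed.

Lemma L2_inner_eq0 (x : L2) : L2_inner x x = 0 -> x = 0.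
Proof.
rewrite L2_inner_self => -[i0].
have /integrable_fin_num fx := integrable_abs2 (L2preP (repr x)).
have mx : measurable_fun setT (fun t => (abs2 (x t))%:E).
  by apply/measurable_EFinP/measurable_abs2; exact: (L2preP (repr x)).1.
have ix : (\int[mu]_t `|(abs2 (x t))%:E| = 0)%E.
  under eq_integral do rewrite gee0_abs ?lee_fin ?abs2_ge0//.
  by rewrite -[LHS]fineK ?fx// [fine _]i0.
have h := (ae_eq_integral_abs mu measurableT mx).1 ix.
have x0 : L2_to_fun x = (0 : L2pre) %[ae mu].
  apply: filterS h => t /= h _; apply: abs2_eq0.
  by have [] := h I.
by rewrite -[x]reprK -[0]/(\pi_L2 0); apply/L2_eqP.
Qed.

HB.instance Definition _ := Lmodule_isPreHilbert.Build R L2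
  L2_inner_linearl L2_inner_conj L2_inner_ge0 L2_inner_eq0.

End square_integrable.

(* A possibly unbounded operator on V is represented by its graph, a subset of
   V * V, so that equality of sets is equality of operators, domains included,
   and closing an operator is closing its graph in the product topology. *)
Section operators.
Context {R : realType} {V : preHilbertType R}.
Implicit Types (A : set (V * V)) (K : set V).

Definition op_domain A : set V := [set x | exists y, A (x, y)].

Definition lin_span (e : nat -> V) : set V :=
  [set x | exists N (c : nat -> R[i]), x = \sum_(n < N) c n *: e n].

Definition orthonormal_basis (e : nat -> V) : Prop :=
  (forall m n, inner (e m) (e n) = (m == n)%:R) /\
  closure (lin_span e) = [set: V].

Definition op_adjoint A : set (V * V) :=
  [set q | forall p, A p -> inner p.2 q.1 = inner p.1 q.2].

Definition self_adjoint A : Prop :=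
  closure (op_domain A) = [set: V] /\ op_adjoint A = A.

(* Spectrum of the part of A in the subspace K, i.e. of the operator whose graph
   is A intersected with K * K, acting in K: the complement of the set of l for
   which A - l has a bounded inverse S defined on the whole of K. *)
Definition spectrum_on K A : set R[i] :=
  [set l | ~ exists S : V -> V,
    [/\ forall y, K y -> K (S y) /\ A (S y, y + l *: S y),
        forall p, A p -> K p.1 -> K p.2 -> S (p.2 - l *: p.1) = p.1 &
        exists M : R, forall y, K y -> `|S y| <= M%:C * `|y| ]].

Definition spectrum A : set R[i] := spectrum_on [set: V] A.

Definition orthogonal_projection (P : V -> V) : Prop :=
  [/\ linear P, forall x, P (P x) = P x &
      forall x y, inner (P x) y = inner x (P y)].

(* Additivity is in the strong operator topology. Only the values of E on Borel
   sets are constrained, here and below. *)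
Definition projection_valued_measure (E : set R -> V -> V) : Prop :=
  [/\ forall B, measurable B -> orthogonal_projection (E B),
      forall x, E [set: R] x = x &
      forall (F : nat -> set R) (x : V),
        (forall k, measurable (F k)) -> trivIset [set: nat] F ->
        series (fun k => E (F k) x) @ \oo --> E (\bigcup_k F k) x ].

(* The finite measure B |-> <E(B) x, x>. *)
Definition spectral_measure (E : set R -> V -> V) (x : V) :
    set (measurableTypeR R) -> \bar R :=
  fun B => (complex.Re (inner (E B x) x))%:E.

(* E is the projection-valued measure of A, A = \int t dE(t): the domain of A
   consists of the x such that t is square-integrable for <E(.) x, x>, and
   <A x, x> = \int t d<E(t) x, x> on it (which determines A by polarization). *)
Definition spectral_resolution A (E : set R -> V -> V) : Prop :=
  [/\ projection_valued_measure E,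
      op_domain A =
        [set x | (\int[spectral_measure E x]_t ((t : R) ^+ 2)%:E < +oo)%E] &
      forall p, A p -> inner p.2 p.1 =
        (fine (\int[spectral_measure E p.1]_t (t : R)%:E)%E)%:C ].

(* The absolutely continuous subspace of a self-adjoint A: the vectors whose
   spectral measure is absolutely continuous w.r.t. the Lebesgue measure.
   A self-adjoint operator has exactly one projection-valued measure. *)
Definition ac_subspace A : set V :=
  [set x | exists E, spectral_resolution A E /\
    spectral_measure E x `<< lebesgue_measure].

(* The spectrum of the part of A in its absolutely continuous subspace. *)
Definition spectrum_ac A : set R[i] := spectrum_on (ac_subspace A) A.

Definition bounded_operator A : Prop :=
  op_domain A = [set: V] /\
  exists M : R, forall p, A p -> `|p.2| <= M%:C * `|p.1|.

Definition op_norm A : \bar R :=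
  ereal_sup [set (complex.Re `|p.2|)%:E | p in A `&` [set p | `|p.1| <= 1]].

End operators.

Section unitary_maps.
Context {R : realType} {V W : preHilbertType R}.

Definition unitary (U : V -> W) : Prop :=
  [/\ linear U, forall x y, inner (U x) (U y) = inner x y &
      forall z, exists x, U x = z].

(* The graph of U A U^-1, for bijective U. *)
Definition op_conj (U : V -> W) (A : set (V * V)) : set (W * W) :=
  [set (U p.1, U p.2) | p in A].

End unitary_maps.

Section matrix_operators.
Context {R : realType}.
Implicit Types (M : nat -> nat -> R) (A : set (l2 R * l2 R)).

(* Pairs (x, y) of square-summable sequences such that y is the formal matrix
   product M x, all the series involved being convergent. *)
Definition matrix_op_max M : set (l2 R * l2 R) :=
  [set p : l2 R * l2 R | forall m,
    series (fun n => (M m n)%:C * p.1 n) @ \oo --> (p.2 m : R[i])].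

(* Closure of the restriction to finitely supported sequences; when the columns
   of M are square summable, M x is in l2 for each of these. *)
Definition matrix_op_min M : set (l2 R * l2 R) :=
  closure [set p | lin_span l2_basis p.1 /\ matrix_op_max M p].

Definition determines_operator M A : Prop :=
  [/\ forall m n, M m n = M n m,
      forall n, square_summable (fun m => (M m n)%:C),
      matrix_op_min M = A & matrix_op_max M = A].

End matrix_operators.

(* The graph of psi |-> h psi on its maximal domain: that h psi is in L^2 is
   expressed by the existence of the class p.2. *)
Definition mult_op d (T : measurableType d) (R : realType)
    (mu : {measure set T -> \bar R}) (h : T -> R) : set (L2 mu * L2 mu) :=
  [set p : L2 mu * L2 mu | L2_to_fun p.2 = (fun t => (h t)%:C * p.1 t) %[ae mu]].
Arguments mult_op {d T R} mu h.

Section hermite_data.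
Context {R : realType}.

Definition Gamma (x : R) : R :=
  \int[lebesgue_measure]_(t in `]0, +oo[) (t `^ (x - 1) * expR (- t)).

Definition H3 (m n : nat) : R :=
  if odd (m + n) then 0 else
  (-1) ^+ ((m * m.-1)./2 + (n * n.-1)./2) *
  (Num.sqrt (m`! * n`!)%:R)^-1 * Gamma ((m + n + 1)%:R / 2).

Definition hermite (n : nat) (x : R) : R :=
  n`!%:R * \sum_(j < n./2.+1)
    (-1) ^+ j * (2 * x) ^+ (n - 2 * j) / (j`! * (n - 2 * j)`!)%:R.

Definition hermite_hat (n : nat) (x : R) : R :=
  (Num.sqrt (2 ^ n * n`!)%:R)^-1 * hermite n x.

Definition mult_fun (x : R) : R := Num.sqrt (2 * pi) * expR (- x ^+ 2).

Definition hermite_density (x : R) : R := (Num.sqrt pi)^-1 * expR (- x ^+ 2).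

Definition hermite_measure (A : set (measurableTypeR R)) : \bar R :=
  (\int[lebesgue_measure]_(x in A) (hermite_density x)%:E)%E.

Lemma hermite_density_ge0 x : 0 <= hermite_density x.
Proof. by rewrite mulr_ge0 ?invr_ge0 ?sqrtr_ge0 ?expR_ge0. Qed.

Lemma measurable_hermite_density : measurable_fun setT hermite_density.
Proof.
apply: measurable_funM => //; apply: measurableT_comp => //.
by apply: measurableT_comp => //; exact: measurable_funX.
Qed.

Let hermite_measure0 : hermite_measure set0 = 0%E.
Proof. by rewrite /hermite_measure integral_set0. Qed.

Let hermite_measure_ge0 A : (0 <= hermite_measure A)%E.
Proof. by apply: integral_ge0 => x _; rewrite lee_fin hermite_density_ge0. Qed.

Let hermite_measure_sigma_additive : semi_sigma_additive hermite_measure.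
Proof.
move=> /= F mF tF mUF; rewrite /hermite_measure ge0_integral_bigcup//=.
- apply: is_cvg_ereal_nneg_natsum_cond => n _ _.
  exact: hermite_measure_ge0.
- apply/measurable_EFinP/measurable_funTS; exact: measurable_hermite_density.
- by move=> x _; rewrite lee_fin hermite_density_ge0.
Qed.

HB.instance Definition _ := isMeasure.Build _ _ _ hermite_measure
  hermite_measure0 hermite_measure_ge0 hermite_measure_sigma_additive.

End hermite_data.
Arguments hermite_measure : clear implicits.

(* Main.v *)
Require Import Defs.
From HB Require Import structures.
From mathcomp Require Import all_boot all_order all_algebra.
From mathcomp Require Import complex ring lra.
From mathcomp Require Import all_classical all_reals all_analysis.
From mathcomp Require Import measurable_realfun.
Set Implicit Arguments.
Unset Strict Implicit.
Unset Printing Implicit Defensive.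
Import Order.TTheory GRing.Theory Num.Theory numFieldNormedType.Exports.
Local Open Scope classical_set_scope.
Local Open Scope complex_scope.
Local Open Scope ring_scope.

(** The matrix is the matrix, in the basis of normalized Hermite polynomials, of
   multiplication by the bounded function h = sqrt(2 pi) e^(-x^2) on L^2(mu).
   Once this is known and the basis is known to be complete, every assertion is
   read off from a multiplication operator.

   Entries. Let E_b(p) be the integral of p e^(-b x^2) against mu. Integration by
   parts gives E_b(p') = 2(b+1) E_b(x p) (gauss_int_deriv), so the rules
   H_(n+1) = 2x H_n - H_n' and H_n' = 2n H_(n-1) give a recursion for
   E_b(H_m H_n). For b = 0 it yields orthogonality. For b = 1 it reads
   E_1(H_m H_(n+1)) = m E_1(H_(m-1) H_n) - n E_1(H_m H_(n-1)) and is solved by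
   signed double factorials (hermite_gauss_entry); Gamma at the half-integers is a
   double factorial too (Gamma_half_odd), and H3E compares the two.

   Completeness. Call a bounded function a multiplier when multiplication by it
   preserves the L^2-closure of the polynomials. Any polynomial times e^(-x^2/4) is
   one, since the exponential series of e^(-x^2/4) converges under the domination of
   e^(x^2/4), whose square is mu-integrable. Multipliers are stable under sums,
   products and bounded pointwise limits. The iterates of s |-> (3s - s^3)/2
   converge to the sign on [-1, 1]; applied to a multiple of (x - r) e^(-x^2/4)
   they show that the sign of x - r is a multiplier, hence so are the indicators
   of half-lines, then of Borel sets, so that simple functions and finally all of
   L^2 lie in the closure of the polynomials (poly_dense).

   The operator. By completeness of L^2 (L2_fast_complete) the coefficients in the
   Hermite basis form a unitary map onto l^2, with inverse U (exists_unitary). Let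
   A be multiplication by h carried over to l^2 by U; it is bounded and symmetric.
   The m-th coordinate of A x is the inner product of x with A e_m, that is, the
   formal matrix product: the maximal operator is A. Since A is bounded and the
   finitely supported sequences are dense, the minimal operator is A as well
   (hermite_op_determined).

   Spectrum and norm. For t in [0, sqrt(2 pi)] the indicators of the sets
   |h - t| < s are approximate eigenvectors for t (mult_vec_approx); for any other
   l the function |h - l| is bounded below and multiplication by 1/(h - l) is a
   bounded inverse (hermite_op_spectrum). The upper end t = sqrt(2 pi) gives the
   norm (op_norm_graph).

   Absolute continuity. The spectral projection of a Borel set B is multiplication
   by the indicator of the preimage of B under h, and the spectral measure of x is
   the image under h of |U x|^2 mu. Away from the origin h is locally expanding, so
   that preimages of Lebesgue-null sets are null (mult_fun_preimage_null). Hence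
   every spectral measure is absolutely continuous (hermite_ac_subspace), and the
   absolutely continuous spectrum is the whole spectrum. *)

(** * Integration against a density *)

Section density.
Local Open Scope ereal_scope.
Context d (T : measurableType d) (R : realType).
Import HBNNSimple.

(** True for indicators by hypothesis, hence for simple functions, hence for f by
   monotone convergence along an increasing sequence of simple functions. *)
Lemma ge0_integral_density (m nu : {measure set T -> \bar R}) (g : T -> R)
    (f : T -> \bar R) :
  measurable_fun setT g -> (forall x, (0 <= g x)%R) ->
  (forall A, measurable A -> nu A = \int[m]_(x in A) (g x)%:E) ->
  measurable_fun setT f -> (forall x, 0 <= f x) ->
  \int[nu]_x f x = \int[m]_x (f x * (g x)%:E).
Proof.
move=> mg g0 nuE mf f0.
have mgE : measurable_fun setT (EFin \o g) by exact/measurable_EFinP.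
pose h := nnsfun_approx measurableT mf.
have hf x : (EFin \o h n) x @[n --> \oo] --> f x by exact: cvg_nnsfun_approx.
have ndh x a b : (a <= b)%N -> (h a x <= h b x)%R.
  by move=> ab; exact/lefP/nd_nnsfun_approx.
have mh n : measurable_fun setT (EFin \o h n).
  by apply/measurable_EFinP; exact/measurable_funP.
have -> : \int[nu]_x f x = limn (fun n => \int[nu]_x (EFin \o h n) x).
  rewrite -monotone_convergence//.
  - by apply: eq_integral => x _; apply/esym/cvg_lim.
  - by move=> n x _; rewrite lee_fin.
  - by move=> x _ a b ab; rewrite lee_fin ndh.
have -> : \int[m]_x (f x * (g x)%:E) =
    limn (fun n => \int[m]_x ((EFin \o h n) x * (g x)%:E)).
  rewrite -monotone_convergence//.
  - by apply: eq_integral => x _; apply/esym/cvg_lim => //; exact: cvgeZr.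
  - by move=> n; exact: emeasurable_funM.
  - by move=> n x _; rewrite mule_ge0 ?lee_fin.
  - by move=> x _ a b ab; rewrite lee_wpmul2r ?lee_fin ?ndh.
congr (limn _); apply/funext => n.
transitivity (\int[nu]_x
   (\sum_(y \in range (h n)) (y * \1_(h n @^-1` [set y]) x)%:E)).
  by apply: eq_integral => t tE; rewrite /= fimfunE -fsumEFin.
have mind r : measurable_fun setT (fun x => (r * \1_(h n @^-1` [set r]) x)%:E).
  by apply/measurable_EFinP; exact: measurable_funM.
rewrite ge0_integral_fsum//; last by move=> y x _; exact: nnfun_muleindic_ge0.
transitivity (\int[m]_x (\sum_(y \in range (h n))
    (y * \1_(h n @^-1` [set y]) x)%:E * (g x)%:E)); last first.
  apply: eq_integral => x _.
  rewrite -ge0_mule_fsuml => [|y]; last exact: nnfun_muleindic_ge0.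
  by rewrite fsumEFin // -(fimfunE _ x).
rewrite ge0_integral_fsum//; last 2 first.
  - by move=> y; exact: emeasurable_funM.
  - by move=> y x _; apply: mule_ge0; [exact: nnfun_muleindic_ge0|rewrite lee_fin].
apply: eq_fsbigr => r rhn.
have r0 : (0 <= r)%R by move: rhn; rewrite inE => -[t _ <-].
under eq_integral do rewrite EFinM.
rewrite integralZl_indic_nnsfun // integral_indic// setIT nuE//.
under [RHS]eq_integral do rewrite EFinM -muleA.
rewrite ge0_integralZl//.
- congr (_ * _); rewrite [LHS]integral_mkcond; apply: eq_integral => x _.
  by rewrite epatch_indic /= muleC.
- by apply: emeasurable_funM => //; exact/measurable_EFinP.
- by move=> t _; rewrite mule_ge0 ?lee_fin.
Qed.

Lemma integral_density (m nu : {measure set T -> \bar R}) (g : T -> R)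
    (f : T -> \bar R) :
  measurable_fun setT g -> (forall x, (0 <= g x)%R) ->
  (forall A, measurable A -> nu A = \int[m]_(x in A) (g x)%:E) ->
  measurable_fun setT f ->
  \int[nu]_x f x = \int[m]_x (f x * (g x)%:E).
Proof.
move=> mg g0 nuE mf; rewrite integralE [RHS]integralE.
rewrite !(ge0_integral_density mg g0 nuE)//;
  [|exact: measurable_funeneg|exact: measurable_funepos].
congr (_ - _); apply: eq_integral => x _.
  by rewrite !funeposE maxe_pMl ?mul0e ?lee_fin.
by rewrite !funenegE maxe_pMl ?mul0e ?lee_fin// mulNe.
Qed.

(** The integral is defined from simple functions, whose level sets are measurable.
   Spectral measures are bare set functions with prescribed values on Borel sets;
   this replaces them by genuine measures. *)
Lemma eq_integral_set_function (m1 m2 : set T -> \bar R) (f : T -> \bar R) :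
  (forall A, measurable A -> m1 A = m2 A) ->
  \int[m1]_x f x = \int[m2]_x f x.
Proof.
move=> m12.
have sE (h : {nnsfun T >-> R}) : sintegral m1 h = sintegral m2 h.
  by rewrite /sintegral; apply: eq_fsbigr => r _; rewrite m12.
rewrite /integral; congr (ereal_sup _ - ereal_sup _); apply: eq_imagel => h _; exact: sE.
Qed.

End density.

Section pushforward_density.
Local Open Scope ereal_scope.
Context d d' (T : measurableType d) (Y : measurableType d') (R : realType).
Variables (m : {measure set T -> \bar R}) (g : T -> R) (h : T -> Y).
Hypotheses (mg : measurable_fun setT g) (g0 : forall x, (0 <= g x)%R)
  (mh : measurable_fun setT h).

Let push (B : set Y) : \bar R := \int[m]_(x in h @^-1` B) (g x)%:E.

Let mpre (B : set Y) : measurable B -> measurable (h @^-1` B).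
Proof. by move=> mB; rewrite -[_ @^-1` _]setTI; exact: mh. Qed.

Let push0 : push set0 = 0.
Proof. by rewrite /push preimage_set0 integral_set0. Qed.

Let push_ge0 B : 0 <= push B.
Proof. by apply: integral_ge0 => x _; rewrite lee_fin. Qed.

Let push_sigma_additive : semi_sigma_additive push.
Proof.
move=> F mF tF mUF; rewrite /push preimage_bigcup ge0_integral_bigcup//=.
- by apply: is_cvg_ereal_nneg_natsum_cond => n _ _; exact: push_ge0.
- by move=> n; exact: mpre.
- exact/measurable_EFinP/measurable_funTS.
- by move=> x _; rewrite lee_fin.
- apply/trivIsetP => i j _ _ ij; rewrite -preimage_setI.
  by move/trivIsetP : tF => /(_ _ _ I I ij) ->; rewrite preimage_set0.
Qed.

Let push_measure : {measure set Y -> \bar R} :=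
  HB.pack push (isMeasure.Build d' Y R push push0 push_ge0 push_sigma_additive).

Let ge0_integral_push (f : Y -> \bar R) : measurable_fun setT f ->
  (forall y, 0 <= f y) -> \int[push]_y f y = \int[m]_x (f (h x) * (g x)%:E).
Proof.
move=> mf f0.
(* push is the image under h of the measure with density g *)
pose dens (A : set T) := \int[m]_(x in A) (g x)%:E.
have dens0 : dens set0 = 0 by rewrite /dens integral_set0.
have dens_ge0 A : 0 <= dens A by apply: integral_ge0 => x _; rewrite lee_fin.
have dens_sa : semi_sigma_additive dens.
  move=> F mF tF mUF; rewrite /dens ge0_integral_bigcup//=.
  - by apply: is_cvg_ereal_nneg_natsum_cond => n _ _; exact: dens_ge0.
  - exact/measurable_EFinP/measurable_funTS.
  - by move=> x _; rewrite lee_fin.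
pose dm : {measure set T -> \bar R} :=
  HB.pack dens (isMeasure.Build d T R dens dens0 dens_ge0 dens_sa).
rewrite -[LHS]/(\int[pushforward dm h]_y f y) ge0_integral_pushforward//.
rewrite preimage_setT (@ge0_integral_density _ _ _ m dm g)//.
  exact: measurableT_comp.
by move=> x; exact: f0.
Qed.

Lemma integral_pushforward_density (nu : set Y -> \bar R) (f : Y -> \bar R) :
  (forall B, measurable B -> nu B = \int[m]_(x in h @^-1` B) (g x)%:E) ->
  measurable_fun setT f ->
  \int[nu]_y f y = \int[m]_x (f (h x) * (g x)%:E).
Proof.
move=> nuE mf; rewrite (eq_integral_set_function f nuE).
rewrite -[LHS]/(\int[push_measure]_y f y) integralE [RHS]integralE.
rewrite -![integral push_measure _ _]/(integral push _ _).
rewrite !ge0_integral_push//; [|exact: measurable_funeneg|exact: measurable_funepos].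
congr (_ - _); apply: eq_integral => x _.
  by rewrite !funeposE maxe_pMl ?mul0e ?lee_fin.
by rewrite !funenegE maxe_pMl ?mul0e ?lee_fin// mulNe.
Qed.

End pushforward_density.

(** * Gaussian integrals of polynomials *)

Section gaussian_integrals.
Context {R : realType}.
Implicit Types (p : {poly R}) (a b x : R).
Local Notation leb := (@lebesgue_measure R).
Local Notation mu := (hermite_measure R).

Lemma integral_hermite_measure (f : R -> \bar R) :
  measurable_fun setT f -> (forall x, (0 <= f x)%E) ->
  (\int[mu]_x f x = \int[leb]_x (f x * (hermite_density x)%:E))%E.
Proof.
move=> mf f0; apply: ge0_integral_density => //.
- exact: measurable_hermite_density.
- exact: hermite_density_ge0.
Qed.

Lemma measurable_gauss a : measurable_fun setT (fun x => expR (- a * x ^+ 2)).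
Proof. by apply: measurableT_comp => //; apply: measurable_funM.
Qed.

Lemma measurable_horner p : measurable_fun setT (fun x => p.[x]).
Proof. by apply: continuous_measurable_fun; exact: continuous_horner. Qed.

Lemma integrable_gauss a : 0 < a ->
  leb.-integrable setT (fun x => (expR (- a * x ^+ 2))%:E).
Proof.
move=> a0; pose s := Num.sqrt ((2 * a)^-1).
have s0 : s != 0 by rewrite gt_eqF// sqrtr_gt0 invr_gt0 mulr_gt0.
have := @integrable_normal_pdf R 0 s.
move=> /(integrableZl measurableT (normal_peak s)^-1%R); apply: eq_integrable => //.
move=> x _ /=; rewrite normal_pdfE// -EFinM mulKf ?gt_eqF ?normal_peak_gt0//.
rewrite /normal_fun subr0 sqr_sqrtr ?invr_ge0 ?mulr_ge0 ?ltW//.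
congr (expR _)%:E; rewrite -mulr_natr; field.
by rewrite gt_eqF.
Qed.

(** Induction on p: one half of the exponent absorbs the quotient by X, the other
   half the factor x. *)
Lemma horner_le_gauss p e : 0 < e ->
  exists2 C, 0 < C & forall x, `|p.[x]| <= C * expR (e * x ^+ 2).
Proof.
elim/poly_ind: p e => [|p c ih] e e0.
  by exists 1 => // x; rewrite horner0 normr0 mul1r expR_ge0.
have e20 : 0 < e / 2 by rewrite divr_gt0.
have [C C0 hC] := ih _ e20.
exists (C * (1 + 2 / e) + `|c|); first by rewrite ltr_pwDl ?mulr_gt0 ?addr_gt0 ?divr_gt0.
move=> x; rewrite hornerMXaddC (le_trans (ler_normD _ _))// mulrDl lerD//; last first.
  by rewrite ler_peMr// -expR0 ler_expR mulr_ge0 ?sqr_ge0// ltW.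
have -> : e * x ^+ 2 = e / 2 * x ^+ 2 + e / 2 * x ^+ 2 by field.
rewrite normrM expRD mulrACA ler_pM// ?normr_ge0//.
have x1 : `|x| <= 1 + x ^+ 2.
  have := sqr_ge0 (`|x| - 1); have := normr_ge0 x.
  rewrite -[x ^+ 2]real_normK ?num_real//; set y := `|x|; move=> y0 y1; nra.
apply: (le_trans x1).
have h1 : 1 + e / 2 * x ^+ 2 <= expR (e / 2 * x ^+ 2) by exact: expR_ge1Dx.
have h2 : 1 + x ^+ 2 <= (1 + 2 / e) * (1 + e / 2 * x ^+ 2).
  have -> : (1 + 2 / e) * (1 + e / 2 * x ^+ 2) =
    1 + x ^+ 2 + 2 / e + e / 2 * x ^+ 2 by field; rewrite gt_eqF.
  have e2 : 0 <= 2 / e by rewrite ltW ?divr_gt0.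
  have ex : 0 <= e / 2 * x ^+ 2 by rewrite mulr_ge0 ?sqr_ge0 ?(ltW e20).
  by rewrite -addrA lerDl addr_ge0.
by apply: (le_trans h2); rewrite ler_pM2l// ltr_pwDl// ltW// divr_gt0.
Qed.

(** Half of the Gaussian beats the polynomial; the other half is left for
   integrability and for decay at infinity. *)
Lemma horner_gauss_bound p a : 0 < a -> exists2 C, 0 < C &
  forall x, `|p.[x] * expR (- a * x ^+ 2)| <= C * expR (- (a / 2) * x ^+ 2).
Proof.
move=> a0; have [C C0 hC] := @horner_le_gauss p (a / 2) ltac:(by rewrite divr_gt0).
exists C => // x; rewrite normrM [`|expR _|]ger0_norm ?expR_ge0//.
apply: (@le_trans _ _ (C * expR (a / 2 * x ^+ 2) * expR (- a * x ^+ 2))).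
  by rewrite ler_wpM2r ?expR_ge0.
rewrite -mulrA -expRD (_ : a / 2 * x ^+ 2 + _ = - (a / 2) * x ^+ 2)//.
by field.
Qed.

Lemma integrable_horner_gauss p a : 0 < a ->
  leb.-integrable setT (fun x => (p.[x] * expR (- a * x ^+ 2))%:E).
Proof.
move=> a0; have [C C0 hC] := horner_gauss_bound p a0.
have := @integrable_gauss (a / 2) ltac:(by rewrite divr_gt0).
move=> /(integrableZl measurableT C); apply: le_integrable => //.
  apply/measurable_EFinP; apply: measurable_funM; first exact: measurable_horner.
  exact: measurable_gauss.
move=> x _ /=; rewrite lee_fin (le_trans (hC x))//.
exact: ler_norm.
Qed.

Lemma Rintegral_hermite_measure (f : R -> R) : measurable_fun setT f ->
  \int[mu]_x f x = \int[leb]_x (f x * hermite_density x).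
Proof.
move=> mf; rewrite /Rintegral.
rewrite (@integral_density _ _ _ leb mu hermite_density)//.
- exact: measurable_hermite_density.
- exact: hermite_density_ge0.
- exact/measurable_EFinP.
Qed.

Lemma is_derive_horner_gauss p a x :
  is_derive x 1 (fun x => p.[x] * expR (- a * x ^+ 2))
    ((p^`() - (2 * a) *: ('X * p)).[x] * expR (- a * x ^+ 2)).
Proof.
have hp : is_derive x 1 (horner p) (p^`().[x]).
  by split; [exact: derivable_horner|rewrite -derive1E -derivE].
have hg : is_derive x 1 (fun x => expR (- a * x ^+ 2))
    (- (2 * a * x) * expR (- a * x ^+ 2)).
  have h1 : is_derive x 1 (fun x : R => - a * x ^+ 2) (- (2 * a * x)).
    have := @is_deriveZ R _ _ _ (- a) x 1 _ (@is_deriveX R _ _ 2 x 1 1 (is_derive_id x 1)).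
    by move=> H; apply: (is_derive_eq H); rewrite /GRing.scale /= expr1; ring.
  have := is_derive1_comp (is_derive_expR _) h1.
  by move=> H; apply: (is_derive_eq H); rewrite mulrC.
move: (is_deriveM hp hg) => H; apply: (is_derive_eq H).
by rewrite /GRing.scale /= !hornerE /=; ring.
Qed.

Lemma continuous_horner_gauss p a : continuous (fun x => p.[x] * expR (- a * x ^+ 2)).
Proof.
move=> x; apply/differentiable_continuous/derivable1_diffP.
by have [] := is_derive_horner_gauss p a x.
Qed.

(** With s = 1 and s = -1 these are the boundary terms of an integration by parts
   against a Gaussian. *)
Lemma cvg_horner_gauss p a (s : R) : 0 < a -> s ^+ 2 = 1 ->
  (fun n : nat => p.[s * n.+1%:R] * expR (- a * (s * n.+1%:R) ^+ 2)) @ \oo --> (0 : R).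
Proof.
move=> a0 s1; have [C C0 hC] := horner_gauss_bound p a0.
apply/norm_cvg0P.
apply: (@squeeze_cvgr _ _ _ _ (fun=> 0) (fun n => C * (2 / a) * harmonic n)).
- apply: nearW => n; rewrite normr_ge0 /= (le_trans (hC _))//.
  rewrite -mulrA ler_pM2l// exprMn s1 mul1r mulNr expRN /harmonic /=.
  have -> : 2 / a * n.+1%:R^-1 = (a / 2 * n.+1%:R)^-1 by rewrite invfM invf_div.
  rewrite lef_pV2 ?posrE ?expR_gt0 ?mulr_gt0 ?divr_gt0//.
  apply: le_trans (expR_ge1Dx _); apply: (@le_trans _ _ (a / 2 * n.+1%:R ^+ 2)).
    rewrite ler_pM2l ?divr_gt0// ler_peMr// ler1n//.
  by rewrite lerDr.
- exact: cvg_cst.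
- by rewrite -[X in _ --> X](mulr0 (C * (2 / a))); apply: cvgM;
    [exact: cvg_cst|exact: cvg_harmonic].
Qed.

(** The integrand is the derivative of p e^(-a x^2). Its integral over
   [-(n+1), n+1] is a difference of boundary terms, which tends to 0, and by
   dominated convergence it also tends to the integral over the line. *)
Lemma Rintegral_derive_horner_gauss p a : 0 < a ->
  \int[leb]_x ((p^`() - (2 * a) *: ('X * p)).[x] * expR (- a * x ^+ 2)) = 0.
Proof.
move=> a0; set q := _ - _; pose F x := p.[x] * expR (- a * x ^+ 2).
pose f x := q.[x] * expR (- a * x ^+ 2).
have dF x : is_derive x 1 F (f x) by exact: is_derive_horner_gauss.
have cF : continuous F by exact: continuous_horner_gauss.
have itf n : \int[leb]_(x in `[- n.+1%:R, n.+1%:R]) (f x) = F n.+1%:R - F (- n.+1%:R).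
  rewrite /Rintegral (@continuous_FTC2 _ f F)//=.
  - by rewrite (@lt_trans _ _ 0)// ?oppr_lt0.
  - exact/continuous_subspaceT/continuous_horner_gauss.
  - split; first by move=> x _; have [] := dF x.
      by apply: cvg_at_right_filter; exact: cF.
    by apply: cvg_at_left_filter; exact: cF.
  - by move=> x _; rewrite derive1E; have [_ ->] := dF x.
have mf : measurable_fun setT f.
  by apply: continuous_measurable_fun; exact: continuous_horner_gauss.
have int_f : leb.-integrable setT (EFin \o f) by exact: integrable_horner_gauss.
pose fn n := (EFin \o f) \_ `[- n.+1%:R, n.+1%:R].
have mfn n : measurable_fun setT (fn n).
  apply/(measurable_restrictT _ _).1 => //; apply/measurable_EFinP.
  exact: measurable_funTS.
have fnf x : fn n x @[n --> \oo] --> (f x)%:E.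
  apply: cvg_near_cst; near=> n; rewrite /fn patchE mem_set//= in_itv /= -ler_norml.
  rewrite (@le_trans _ _ n%:R) ?ler_nat//; near: n; exact: nbhs_infty_ger.
have fnb x n : (`|fn n x| <= `|(f x)%:E|)%E.
  by rewrite /fn patchE; case: ifP => // _; rewrite abse0.
have [_ _ cvi] := @dominated_convergence _ _ _ leb setT measurableT fn (EFin \o f)
  (abse \o EFin \o f) mfn ltac:(exact/measurable_EFinP) ltac:(exact: (aeW leb (fun x _ => fnf x)))
  (integrable_abse int_f) ltac:(exact: (aeW leb (fun x n _ => fnb x n))).
have cv0 : (fun n => F n.+1%:R - F (- n.+1%:R)) @ \oo --> (0 : R).
  rewrite -[X in _ --> X](subrr 0); apply: cvgB.
    have := @cvg_horner_gauss p a 1 a0; rewrite expr1n => /(_ erefl).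
    by under eq_fun do rewrite mul1r.
  have := @cvg_horner_gauss p a (-1) a0; rewrite sqrrN expr1n => /(_ erefl).
  by under eq_fun do rewrite mulN1r.
suff H : (fun n => F n.+1%:R - F (- n.+1%:R)) @ \oo --> \int[leb]_x f x.
  by rewrite -[LHS](cvg_lim _ H)//; apply/cvg_lim.
have -> : (fun n => F n.+1%:R - F (- n.+1%:R)) = fine \o (fun n => (\int[leb]_x fn n x)%E).
  by apply/funext => n; rewrite -itf /Rintegral /= [in LHS]integral_mkcond.
apply: fine_cvg; rewrite /Rintegral fineK//.
exact: integrable_fin_num.
Unshelve. all: by end_near. Qed.

End gaussian_integrals.

(** * Hermite polynomials *)

Section hermite_polynomials.
Context {R : realType}.
Implicit Types (p q : {poly R}) (b x : R) (m n : nat).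

(** The three-term recursion reaches two steps back, hence the pair of consecutive
   polynomials. *)
Fixpoint hermite_poly_pair n : {poly R} * {poly R} :=
  if n is k.+1 then
    let: (p, q) := hermite_poly_pair k in (q, 2 *: ('X * q) - (2 * k.+1%:R) *: p)
  else (1, 2 *: 'X).

Definition hermite_poly n : {poly R} := (hermite_poly_pair n).1.
Local Notation HP := hermite_poly.

Lemma hermite_poly0 : HP 0 = 1. Proof. by []. Qed.
Lemma hermite_poly1 : HP 1 = 2 *: 'X. Proof. by []. Qed.
Lemma hermite_polySS n :
  HP n.+2 = 2 *: ('X * HP n.+1) - (2 * n.+1%:R) *: HP n.
Proof. by rewrite /hermite_poly /=; case: hermite_poly_pair. Qed.

(** Differentiating the three-term recursion at n.+2 uses the rule at n and n.+1:
   the induction carries two consecutive indices. *)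
Lemma deriv_hermite_poly n : (HP n)^`() = (2 * n%:R) *: HP n.-1.
Proof.
suff: (HP n)^`() = (2 * n%:R) *: HP n.-1 /\ (HP n.+1)^`() = (2 * n.+1%:R) *: HP n.
  by case.
elim: n => [|n [ih1 ih2]].
  by rewrite hermite_poly1 hermite_poly0 derivZ derivX -[1]/(1%:P) derivC mulr0 scale0r mulr1.
split => //; rewrite hermite_polySS derivB !derivZ derivM derivX mul1r ih1 ih2.
rewrite -scalerAr; case: n {ih1 ih2} => [|n] /=;
  rewrite ?hermite_poly0 ?hermite_poly1 ?(hermite_polySS n) -!mul_polyC !polyCM !rmorph_nat.
  by ring.
by rewrite -!(natr1 n.+2) -!(natr1 n.+1); ring.
Qed.

(** The term of lower degree in the recursion is the derivative. In this form the
   recursion combines with integration by parts. *)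
Lemma hermite_polyS n : HP n.+1 = 2 *: ('X * HP n) - (HP n)^`().
Proof.
rewrite deriv_hermite_poly; case: n => [|n]; last exact: hermite_polySS.
by rewrite mulr0 scale0r subr0 hermite_poly0 mulr1.
Qed.

(** Summands of hermite over n factorial, extended by 0 beyond n/2 so that sums for
   different n can be taken over the same range. *)
Let hcoef (y : R) n j : R := if (2 * j <= n)%N then
  (-1) ^+ j * y ^+ (n - 2 * j) / (j`! * (n - 2 * j)`!)%:R else 0.

(** The three-term recursion, summand by summand. *)
Let hcoefSS y n j : n.+2%:R * hcoef y n.+2 j.+1 =
  y * hcoef y n.+1 j.+1 - 2 * hcoef y n j.
Proof.
rewrite /hcoef !mulnS !add2n !ltnS.
have [jn|nj] := leqP (2 * j) n; last first.
  by rewrite leqNgt (ltn_trans nj)//= !mulr0 subr0.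
have [k ->] : exists k, (n = 2 * j + k)%N by exists (n - 2 * j)%N; rewrite subnKC.
move=> {jn}; rewrite !subSS addKn -addnS; case: k => [|k].
  rewrite addn0 ltnn addn1 !fact0 expr0 factS !natrM -!natr1 natrM exprS; field.
  by rewrite natr1 !pnatr_eq0 -?lt0n ?fact_gt0 ?ltn0Sn.
rewrite -[X in (X < _)%N]addn0 ltn_add2l /= [X in (X - _.+1)%N]addnS subSS addKn !factS !natrM.
rewrite -!natr1 !natrD -(natr1 k.+1) -(natr1 k) !exprS; field.
by rewrite !natr1 !pnatr_eq0 -?lt0n ?fact_gt0 ?ltn0Sn.
Qed.

Let hermite_sum n N x : (n < N)%N ->
  hermite n x = n`!%:R * \sum_(j < N) hcoef (2 * x) n j.
Proof.
move=> nN; rewrite /hermite; congr (_ * _).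
rewrite (big_ord_widen N (fun j : nat => (-1) ^+ j * (2 * x) ^+ (n - 2 * j) /
  (j`! * (n - 2 * j)`!)%:R)); last first.
  by rewrite (leq_ltn_trans _ nN)// -{2}(odd_double_half n) -addnn addnA leq_addl.
rewrite big_mkcond; apply: eq_bigr => j _; rewrite /hcoef.
by rewrite ltnS geq_half_double mul2n.
Qed.

Lemma hermiteE n x : hermite n x = (HP n).[x].
Proof.
suff: hermite n x = (HP n).[x] /\ hermite n.+1 x = (HP n.+1).[x] by case.
elim: n => [|n [ih1 ih2]].
  rewrite /hermite hermite_poly0 hermite_poly1 !big_ord_recl !big_ord0 /=.
  by rewrite !hornerE /= ?subn0 ?expr0 ?expr1 ?fact0 ?divr1 ?invr1.
split => //; rewrite hermite_polySS !hornerE -ih1 -ih2.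
rewrite (@hermite_sum n.+2 n.+3)// (@hermite_sum n.+1 n.+3)// (@hermite_sum n n.+2)//.
rewrite (factS n.+1) natrM mulrAC mulr_sumr big_ord_recl /=.
under eq_bigr do rewrite hcoefSS.
rewrite sumrB -!mulr_sumr [in RHS]big_ord_recl /=.
have -> : n.+2%:R * hcoef (2 * x) n.+2 0 = 2 * x * hcoef (2 * x) n.+1 0.
  rewrite /hcoef muln0 /= !subn0 !fact0 !mul1n factS natrM exprS.
  have f0 : n.+1`!%:R != 0 :> R by rewrite pnatr_eq0 -lt0n fact_gt0.
  have n0 : n.+2%:R != 0 :> R by rewrite pnatr_eq0.
  by move: (n.+2%:R) n.+1`!%:R n0 f0 => u v u0 v0; field; rewrite u0 v0.
rewrite (factS n) natrM; ring.
Qed.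

End hermite_polynomials.

(** * Gaussian integrals of products of Hermite polynomials *)

Section hermite_functional.
Context {R : realType}.
Implicit Types (p q : {poly R}) (b x : R) (m n k : nat).
Local Notation HP := hermite_poly.

(** The orthogonality of the Hermite polynomials concerns b = 0, the matrix of
   multiplication by e^(-x^2) concerns b = 1; one recursion serves both. *)
Definition gauss_int b p : R :=
  \int[hermite_measure R]_x (p.[x] * expR (- b * x ^+ 2)).
Local Notation E := gauss_int.
Local Notation mu := (hermite_measure R).
Local Notation leb := (@lebesgue_measure R).

Lemma hermite_densityE b p x :
  p.[x] * expR (- b * x ^+ 2) * hermite_density x =
  (Num.sqrt pi)^-1 * (p.[x] * expR (- (b + 1) * x ^+ 2)).
Proof.
rewrite /hermite_density (_ : - (b + 1) * x ^+ 2 = - b * x ^+ 2 + - x ^+ 2); last by ring.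
by rewrite expRD; ring.
Qed.

Lemma measurable_horner_gauss b p :
  measurable_fun setT (fun x => p.[x] * expR (- b * x ^+ 2)).
Proof.
by apply: measurable_funM; [exact: measurable_horner|exact: measurable_gauss].
Qed.

Lemma integrable_hermite_gauss b p : -1 < b ->
  mu.-integrable setT (fun x => (p.[x] * expR (- b * x ^+ 2))%:E).
Proof.
move=> b1; have mf := measurable_horner_gauss b p.
apply/integrableP; split; first exact/measurable_EFinP.
rewrite integral_hermite_measure//; last first.
  by apply: measurableT_comp => //; exact/measurable_EFinP.
have /integrableP[_] := integrableZl measurableT (Num.sqrt pi)^-1
  (@integrable_horner_gauss R p (b + 1) ltac:(by rewrite -ltrBlDr sub0r)).
apply: le_lt_trans; rewrite le_eqVlt; apply/orP; left; apply/eqP.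
apply: eq_integral => x _; rewrite /= -?EFinM -hermite_densityE /=; congr EFin.
by rewrite [in RHS]normrM [X in _ = _ * X]ger0_norm// hermite_density_ge0.
Qed.

Lemma gauss_intE b p : -1 < b -> E b p =
  (Num.sqrt pi)^-1 * \int[leb]_x (p.[x] * expR (- (b + 1) * x ^+ 2)).
Proof.
move=> b1; rewrite /E Rintegral_hermite_measure; last exact: measurable_horner_gauss.
under eq_Rintegral do rewrite hermite_densityE.
rewrite RintegralZl//; apply: integrable_horner_gauss.
by rewrite -ltrBlDr sub0r.
Qed.

Lemma gauss_intD b p q : -1 < b -> E b (p + q) = E b p + E b q.
Proof.
move=> b1; rewrite /E -RintegralD//; try exact: integrable_hermite_gauss.
by apply: eq_Rintegral => x _; rewrite hornerD mulrDl.
Qed.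

Lemma gauss_intZ b c p : -1 < b -> E b (c *: p) = c * E b p.
Proof.
move=> b1; rewrite /E -RintegralZl; [|exact: measurableT|exact: integrable_hermite_gauss].
by apply: eq_Rintegral => x _; rewrite hornerZ -mulrA.
Qed.

Lemma gauss_intB b p q : -1 < b -> E b (p - q) = E b p - E b q.
Proof. by move=> b1; rewrite gauss_intD// -scaleN1r gauss_intZ// mulN1r. Qed.

(** Integration by parts: e^(-(b+1)x^2) has logarithmic derivative -2(b+1)x. *)
Lemma gauss_int_deriv b p : -1 < b -> E b p^`() = 2 * (b + 1) * E b ('X * p).
Proof.
move=> b1; rewrite -gauss_intZ//; apply/eqP; rewrite -subr_eq0 -gauss_intB//.
rewrite gauss_intE// Rintegral_derive_horner_gauss ?mulr0//.
by rewrite -ltrBlDr sub0r.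
Qed.

(** The Gaussian is, up to normalization, the normal density of variance
   1/(2(b+1)), whose integral is 1. *)
Lemma gauss_int1 b : -1 < b -> E b 1 = (Num.sqrt (b + 1))^-1.
Proof.
move=> b1; have b0 : 0 < b + 1 by rewrite -ltrBlDr sub0r.
rewrite gauss_intE//; pose s := Num.sqrt ((2 * (b + 1))^-1).
have s0 : s != 0 by rewrite gt_eqF// sqrtr_gt0 invr_gt0 mulr_gt0.
have s2 : s ^+ 2 = (2 * (b + 1))^-1 by rewrite sqr_sqrtr// invr_ge0 mulr_ge0// ltW.
have -> : \int[leb]_x ((1 : {poly R}).[x] * expR (- (b + 1) * x ^+ 2)) =
    (normal_peak s)^-1 * \int[leb]_x normal_pdf 0 s x.
  rewrite -RintegralZl//; last exact: integrable_normal_pdf.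
  apply: eq_Rintegral => x _; rewrite normal_pdfE// hornerE mul1r.
  rewrite mulKf ?gt_eqF ?normal_peak_gt0// /normal_fun subr0 s2.
  by congr expR; rewrite -mulr_natr; field; rewrite gt_eqF.
rewrite /Rintegral integral_normal_pdf mulr1 /normal_peak invrK s2.
have -> : (2 * (b + 1))^-1 * pi *+ 2 = pi / (b + 1).
  by rewrite -mulr_natr; field; rewrite gt_eqF.
have p0 : Num.sqrt pi != 0 :> R by rewrite gt_eqF// sqrtr_gt0 pi_gt0.
by rewrite sqrtrM ?pi_ge0// sqrtrV ?(ltW b0)// mulKf.
Qed.

(** In H_(n+1) = 2x H_n - H_n' the product 2x H_m H_n is integrated by parts. *)
Lemma gauss_int_hermiteS b m n : -1 < b ->
  E b (HP m * HP n.+1) =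
  (b + 1)^-1 * E b ((HP m)^`() * HP n + HP m * (HP n)^`()) - E b (HP m * (HP n)^`()).
Proof.
move=> b1; have b0 : b + 1 != 0 by rewrite gt_eqF// -ltrBlDr sub0r.
rewrite -derivM gauss_int_deriv// hermite_polyS mulrBr gauss_intB//; congr (_ - _).
by rewrite -scalerAr mulrCA gauss_intZ//; field.
Qed.

(** For b = 0 the two occurrences of H_n' cancel in the recursion, which becomes
   E(H_k H_(l+1)) = 2k E(H_(k-1) H_l) and lowers both indices. *)
Lemma hermite_orthogonal m n :
  E 0 (HP m * HP n) = if m == n then (2 ^ n * n`!)%:R else 0.
Proof.
have step k l : E 0 (HP k * HP l.+1) = 2 * k%:R * E 0 (HP k.-1 * HP l).
  rewrite gauss_int_hermiteS ?oppr_lt0// add0r invr1 mul1r gauss_intD ?oppr_lt0// addrK.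
  by rewrite deriv_hermite_poly -scalerAl gauss_intZ ?oppr_lt0.
elim: n m => [|n ih] [|m].
- by rewrite hermite_poly0 mulr1 gauss_int1 ?oppr_lt0// add0r sqrtr1 invr1.
- by rewrite mulrC step mulr0 mul0r.
- by rewrite step mulr0 mul0r.
rewrite step ih eqSS /=; case: eqP => [->|_]; last by rewrite mulr0.
by rewrite factS expnS !natrM; ring.
Qed.

(** This is (2k-1)!! / sqrt 2. *)
Let K k : R := (Num.sqrt 2)^-1 * \prod_(i < k) (2 * i + 1)%:R.

Let KS k : K k.+1 = (2 * k + 1)%:R * K k.
Proof. by rewrite /K big_ord_recr /= mulrA mulrC. Qed.

(** For b = 1 the recursion is
   E(H_k H_(l+1)) = k E(H_(k-1) H_l) - l E(H_k H_(l-1)).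
   The two values on the right belong to the same total degree k + l - 1 and have
   opposite signs, so that the right-hand side is k + l times one of them.
   Induction on the total degree. *)
Lemma hermite_gauss_entry m n : E 1 (HP m * HP n) =
  if odd (m + n) then 0 else (-1) ^+ ((m + n)./2 + n) * K (m + n)./2.
Proof.
have b1 : -1 < 1 :> R by rewrite (@lt_trans _ _ 0)// oppr_lt0.
have step k l : E 1 (HP k * HP l.+1) =
    k%:R * E 1 (HP k.-1 * HP l) - l%:R * E 1 (HP k * HP l.-1).
  rewrite gauss_int_hermiteS// !deriv_hermite_poly gauss_intD//.
  by rewrite -!scalerAl -!scalerAr !gauss_intZ//; field.
have [N] := ubnP (m + n); elim: N m n => // N ih m n; rewrite ltnS => mnN.
(* for n = 0 < m the roles of m and n are exchanged; the parity of the exponent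
   does not change because m is even *)
wlog n0 : m n mnN / (0 < n)%N => [hw|].
  case: n mnN => [|n] mnN; last exact: hw.
  case: m mnN => [|m] mnN.
    rewrite hermite_poly0 mulr1 gauss_int1// /K big_ord0 mulr1 mul1r.
    by rewrite (_ : 1 + 1 = 2).
  rewrite mulrC hw ?addn0//; last by rewrite add0n -(addn0 m.+1).
  rewrite add0n; case: ifP => // om; congr (_ * _).
  by rewrite -[LHS]signr_odd -[RHS]signr_odd oddD om addbF.
case: n n0 mnN => // n _ mnN; rewrite step addnS /= uphalf_half.
have smaller k l : (k + l).+1 = (m + n)%N -> E 1 (HP k * HP l) =
    if odd (m + n) then (-1) ^+ ((m + n)./2 + l) * K (m + n)./2 else 0.
  move=> kl; rewrite ih; last first.
    by rewrite (leq_trans _ mnN)// addnS ltnS -kl.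
  by rewrite -kl /= uphalf_half; case: odd.
have -> : m%:R * E 1 (HP m.-1 * HP n) = m%:R *
    if odd (m + n) then (-1) ^+ ((m + n)./2 + n) * K (m + n)./2 else 0.
  by case: m mnN smaller => [|m] mnN smaller; [rewrite !mul0r|rewrite smaller].
have -> : n%:R * E 1 (HP m * HP n.-1) = - n%:R *
    if odd (m + n) then (-1) ^+ ((m + n)./2 + n) * K (m + n)./2 else 0.
  case: n mnN smaller => [|n] mnN smaller; first by rewrite oppr0 !mul0r.
  rewrite smaller ?addnS//=; case: odd; rewrite ?mulr0//.
  by rewrite ?addnS exprS mulN1r !(mulNr, mulrN) opprK.
have mnE := odd_double_half (m + n).
case: odd mnE => mnE; last by rewrite !mulr0 subrr.
rewrite /= add1n KS addnS addSn !exprS !mulN1r opprK mulNr opprK -mulrDl -natrD.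
have -> : (m + n)%:R = (2 * (m + n)./2 + 1)%:R :> R.
  by congr (_%:R); rewrite -{1}mnE addnC mul2n.
by rewrite mulrCA.
Qed.

End hermite_functional.

(** * The entries of the matrix *)

Section gamma_values.
Context {R : realType}.
Implicit Types (x : R) (k m n : nat).
Local Notation leb := (@lebesgue_measure R).
Local Notation E := gauss_int.

Lemma gauss_moment_even k :
  E 0 ('X^(2 * k)) = (\prod_(i < k) (2 * i + 1)%:R) / 2 ^+ k :> R.
Proof.
have b0 : -1 < 0 :> R by rewrite oppr_lt0.
elim: k => [|k ih].
  by rewrite muln0 expr0 gauss_int1// add0r sqrtr1 invr1 big_ord0 mulr1.
have := @gauss_int_deriv R 0 'X^((2 * k).+1) b0.
rewrite derivXn /= -scaler_nat gauss_intZ// ih -exprS add0r mulr1 -[((2 * k).+2)%N]add2n -mulnS.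
move=> h; apply: (@mulfI _ 2); rewrite ?pnatr_eq0//.
by rewrite -h big_ord_recr /= exprS -addn1; field; rewrite expf_neq0 ?pnatr_eq0.
Qed.

(** The substitution t = x^2 has a square root as its inverse, which is not
   differentiable at 0. It is carried out on half-lines away from 0, and this
   lemma passes to the limit. *)
Lemma ge0_integral_itv0y_cvg (s : R^nat) (f : R -> \bar R) :
  (forall n, 0 < s n) -> {homo s : m n / (m <= n)%N >-> n <= m} -> s @ \oo --> 0 ->
  measurable_fun setT f -> (forall x, 0 < x -> (0 <= f x)%E) ->
  (\int[leb]_(x in `[s n, +oo[) f x)%E @[n --> \oo] --> (\int[leb]_(x in `]0%R, +oo[) f x)%E.
Proof.
move=> s0 nis cs mf f0.
have -> : `]0%R, +oo[%classic = \bigcup_n `[s n, +oo[%classic.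
  apply/seteqP; split => x /=.
    rewrite in_itv /= andbT => x0.
    have : \forall n \near \oo, s n < x by exact: cvgr_lt cs _ x0.
    by move=> [n _ hn]; exists n => //=; rewrite in_itv /= andbT ltW// hn/=.
  move=> [n _] /=; rewrite !in_itv /= !andbT; exact: lt_le_trans.
apply: ge0_nondecreasing_set_cvg_integral => //.
- move=> m n mn; apply/subsetPset => x /=; rewrite !in_itv /= !andbT.
  by apply: le_trans; exact: nis.
- by move=> n; exact: measurable_funTS.
- move=> n x /=; rewrite in_itv /= andbT => xs; apply: f0; exact: lt_le_trans xs.
Qed.

(** Substitution t = x^2 in the integral of Gamma turns t^(k - 1/2) e^(-t) dt into
   2 x^(2k) e^(-x^2) dx on the positive half-line; the factor 2 is recovered from
   the symmetry of the integrand on the right. *)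
Lemma Gamma_half_odd k :
  Gamma ((2 * k + 1)%:R / 2) = Num.sqrt pi * E 0 ('X^(2 * k)) :> R.
Proof.
have p0 : Num.sqrt pi != 0 :> R by rewrite gt_eqF// sqrtr_gt0 pi_gt0.
rewrite gauss_intE ?oppr_lt0// mulVKf// /Gamma; congr fine.
pose G x := ('X^(2 * k) : {poly R}).[x] * expR (- (0 + 1) * x ^+ 2).
pose g x := x `^ ((2 * k + 1)%:R / 2 - 1) * expR (- x).
have G0 x : 0 <= G x by rewrite /G hornerXn mulr_ge0 ?expR_ge0// exprM exprn_ge0// sqr_ge0.
have cG : continuous G by exact: continuous_horner_gauss.
rewrite -[RHS]/(\int[leb]_x (G x)%:E)%E ge0_symfun_integralT//; last first.
  by move=> x; rewrite /G /= !hornerXn sqrrN !exprM sqrrN.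
rewrite -set_itvcy -integral_itv_obnd_cbnd; last first.
  by apply/measurable_EFinP/measurable_funTS; exact: continuous_measurable_fun.
rewrite -[LHS]/(\int[leb]_(x in `]0%R, +oo[) (g x)%:E)%E.
(* half-lines from s n correspond to half-lines from r n = sqrt (s n) *)
pose s n : R := (n.+1%:R ^+ 2)^-1; pose r n : R := n.+1%:R^-1.
have rs n : Num.sqrt (s n) = r n by rewrite /s -exprVn sqrtr_sqr ger0_norm.
have r0 n : 0 < r n by rewrite invr_gt0.
have s0 n : 0 < s n by rewrite invr_gt0 exprn_gt0.
have ri : {homo r : m n / (m <= n)%N >-> n <= m}.
  by move=> m n mn; rewrite lef_pV2 ?posrE// ler_nat ltnS.
have si : {homo s : m n / (m <= n)%N >-> n <= m}.
  by move=> m n mn; rewrite lef_pV2 ?posrE ?exprn_gt0// ler_pXn2r ?nnegrE// ler_nat ltnS.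
have r_0 : r @ \oo --> 0 by exact: cvg_harmonic.
have s_0 : s @ \oo --> 0.
  rewrite -(mulr0 (0 : R)) (_ : s = fun n => r n * r n); first exact: cvgM.
  by apply/funext => n; rewrite /s -exprVn expr2.
have mg : measurable_fun setT g.
  apply: measurable_funM => //.
  by apply: measurableT_comp.
have g0 x : 0 <= g x by rewrite mulr_ge0 ?powR_ge0 ?expR_ge0.
pose q : R -> R := Num.sqrt; pose dq := (q^`())%classic.
have dqE (t : R) : 0 < t -> dq t = (2 * Num.sqrt t)^-1.
  by move=> t0; rewrite /dq derive1E; exact: derive_sqrt.
have cdq (t : R) : 0 < t -> dq x @[x --> t] --> dq t.
  move=> t0; rewrite dqE//; have : (fun x : R => (2 * Num.sqrt x)^-1) x @[x --> t] -->
      (2 * Num.sqrt t)^-1.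
    apply: cvgV; first by rewrite mulf_neq0// gt_eqF// sqrtr_gt0.
    by apply: cvgM; [exact: cvg_cst|exact: sqrt_continuous].
  apply: cvg_trans; apply: near_eq_cvg; near=> x; rewrite dqE//.
  by near: x; exact: lt_nbhsr.
have qy : q x @[x --> +oo] --> +oo.
  apply/cvgryPge => A; near=> x; rewrite /q (@le_trans _ _ `|A|) ?ler_norm//.
  rewrite -sqrtr_sqr ler_wsqrtr//; near: x; exact: nbhs_pinfty_ge.
have sub n : (\int[leb]_(x in `[s n, +oo[) (g x)%:E =
    2%:E * \int[leb]_(x in `[r n, +oo[) (G x)%:E)%E.
  rewrite -rs (@increasing_ge0_integration_by_substitutiony R q G (s n))//.
  - transitivity (2%:E * \int[leb]_(x in `[s n, +oo[) (g x / 2)%:E)%E.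
      rewrite -ge0_integralZl//; last first.
      + by move=> x _; rewrite lee_fin divr_ge0.
      + by apply/measurable_EFinP/measurable_funTS/measurable_funM.
      by apply: eq_integral => x _; rewrite -EFinM mulrC divfK.
    congr (_ * _)%E; apply: eq_integral => x; rewrite inE /= in_itv /= andbT => xs.
    have x0 : 0 < x by exact: lt_le_trans xs.
    have sx0 : Num.sqrt x != 0 by rewrite gt_eqF ?sqrtr_gt0.
    congr EFin; rewrite fctE /= -/dq dqE// /G /g hornerXn exprM.
    rewrite sqr_sqrtr ?ltW// (_ : _ / 2 - 1 = k%:R + - 2^-1); last first.
      by rewrite natrD natrM; field.
    rewrite powRD; last by rewrite (gt_eqF x0) implybT.
    rewrite powRN powR12_sqrt ?ltW// powR_mulrn ?ltW// add0r mulN1r; field.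
    by rewrite sx0.
  - move=> x y; rewrite !in_itv /= !andbT => xs ys xy.
    by rewrite ltr_sqrt// (lt_trans _ xy)//; exact: lt_le_trans xs.
  - move=> x; rewrite in_itv /= andbT => xs; apply: cdq; exact: lt_trans xs.
  - by apply/cvg_ex; exists (dq (s n)); apply: cvg_at_right_filter; exact: cdq.
  - apply/cvg_ex; exists 0.
    have : (fun x : R => (2 * q x)^-1) x @[x --> +oo] --> (0 : R).
      apply/gtr0_cvgV0.
        by near=> x; rewrite mulr_gt0// sqrtr_gt0.
      exact: (gt0_cvgMry _ qy).
    apply: cvg_trans; apply: near_eq_cvg; near=> x; rewrite -/dq dqE//.
  - split.
      move=> x; rewrite in_itv /= andbT => xs.
      by have [] := is_derive1_sqrt (lt_trans (s0 n) xs).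
    by apply: cvg_at_right_filter; exact: sqrt_continuous.
  - exact: continuous_subspaceT.
have c1 := @ge0_integral_itv0y_cvg s (EFin \o g) s0 si s_0
  ltac:(exact/measurable_EFinP) (fun x _ => ltac:(by rewrite lee_fin)).
have c2 := @ge0_integral_itv0y_cvg r (EFin \o G) r0 ri r_0
  ltac:(by apply/measurable_EFinP; exact: continuous_measurable_fun)
  (fun x _ => ltac:(by rewrite lee_fin)).
rewrite -[LHS](cvg_lim _ c1)//; apply/cvg_lim => //.
by under eq_fun do rewrite /= sub; apply: cvgeZl.
Unshelve. all: by end_near. Qed.

End gamma_values.

(** Brings the sign (-1)^(m(m-1)/2) of the matrix to the form produced by the
   recursion for the Gaussian integrals: the parity of a triangular number has
   period 4. *)
Lemma odd_bin2 m : odd (m * m.-1)./2 = odd m./2.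
Proof.
rewrite -[m in LHS]odd_double_half; set a := m./2; case: (odd m) => /=.
  by rewrite ?add1n /= -doubleMr doubleK mulSn oddD -doubleMl odd_double addbF.
rewrite ?add0n; case: a => [|a] //.
by rewrite -doubleMl doubleK oddM doubleS /= odd_double /= andbT.
Qed.

Section hermite_matrix.
Context {R : realType}.
Implicit Types (x : R) (m n : nat).
Local Notation HP := hermite_poly.
Local Notation E := gauss_int.
Local Notation mu := (hermite_measure R).

Definition hermite_norm n : R := (Num.sqrt (2 ^ n * n`!)%:R)^-1.

Lemma hermite_hatE n x : hermite_hat n x = (hermite_norm n *: HP n).[x].
Proof. by rewrite /hermite_hat hermiteE hornerZ. Qed.

Lemma hermite_hat_orthonormal m n :
  \int[mu]_x (hermite_hat m x * hermite_hat n x) = (m == n)%:R.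
Proof.
have b0 : -1 < 0 :> R by rewrite oppr_lt0.
transitivity (E 0 ((hermite_norm m * hermite_norm n) *: (HP m * HP n))).
  apply: eq_Rintegral => x _.
  by rewrite !hermite_hatE !hornerZ hornerM oppr0 mul0r expR0 mulr1 mulrACA.
rewrite gauss_intZ// hermite_orthogonal; case: eqP => [->|_]; last by rewrite mulr0.
rewrite /hermite_norm -invfM -expr2 sqr_sqrtr ?ler0n// mulVf//.
Qed.

(** With s = (m + n)/2, both sides are (2s-1)!! up to elementary factors: Gamma
   provides (2s-1)!! 2^-s sqrt pi, the integral (2s-1)!! / sqrt 2. The factor 2^-s
   comes from the two norms, and sqrt (2 pi) is what turns 1/sqrt 2 into sqrt pi. *)
Lemma H3E m n :
  H3 m n = \int[mu]_x (mult_fun x * hermite_hat m x * hermite_hat n x).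
Proof.
have b1 : -1 < 1 :> R by rewrite (@lt_trans _ _ 0)// oppr_lt0.
transitivity (E 1 ((Num.sqrt (2 * pi) * hermite_norm m * hermite_norm n) *:
    (HP m * HP n))); last first.
  apply: eq_Rintegral => x _.
  rewrite !hermite_hatE !hornerZ hornerM /mult_fun mulN1r; ring.
rewrite gauss_intZ// hermite_gauss_entry /H3.
case: ifP => [_|/negbT emn]; first by rewrite mulr0.
set s := (m + n)./2.
have smn : (m + n = 2 * s)%N.
  by rewrite mul2n -[LHS]odd_double_half (negbTE emn).
rewrite smn Gamma_half_odd gauss_moment_even.
have : hermite_norm m * hermite_norm n = (2 ^+ s)^-1 * (Num.sqrt (m`! * n`!)%:R)^-1.
  rewrite /hermite_norm -!invfM -sqrtrM ?ler0n// -natrM mulnACA -expnD smn; congr (_^-1).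
  by rewrite natrM sqrtrM ?ler0n// mulnC expnM natrX sqrtr_sqr ger0_norm ?ler0n// natrX.
rewrite -(mulrA (Num.sqrt (2 * pi))) => ->.
have -> : (-1) ^+ ((m * m.-1)./2 + (n * n.-1)./2) = (-1) ^+ (s + n) :> R.
  rewrite -[LHS]signr_odd -[RHS]signr_odd !oddD !odd_bin2; congr ((-1) ^+ nat_of_bool _).
  have om : odd m = odd n by apply/eqP; rewrite -negb_add -oddD.
  have : (m + n)%N = ((odd n + m./2 + n./2).*2)%N.
    by rewrite -{1}(odd_double_half m) -{1}(odd_double_half n) om !doubleD addnACA addnn addnA.
  rewrite /s => ->; rewrite doubleK !oddD oddb.
  by case: (odd n); case: odd; case: odd.
rewrite sqrtrM//; field.
have f0 : Num.sqrt (m`! * n`!)%:R != 0 :> R.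
  by rewrite sqrtr_eq0 -ltNge ltr0n muln_gt0 !fact_gt0.
by rewrite f0 expf_neq0 ?pnatr_eq0// sqrtr_eq0 -ltNge ltr0n.
Qed.
End hermite_matrix.

(** * Density of the polynomials *)

Section polynomial_density.
Context {R : realType}.
Implicit Types (p q : {poly R}) (f g h phi : R -> R).
Local Notation mu := (hermite_measure R).

Definition sqdist f g := (\int[mu]_x ((f x - g x) ^+ 2)%:E)%E.

(** Membership in the closure of the polynomials in L^2(mu). *)
Definition poly_approx f := measurable_fun setT f /\
  forall e : R, 0 < e -> exists p, (sqdist f (horner p) < e%:E)%E.

Let msq f g : measurable_fun setT f -> measurable_fun setT g ->
  measurable_fun setT (fun x => ((f x - g x) ^+ 2)%:E).
Proof.
by move=> mf mg; apply/measurable_EFinP; apply: measurable_funX; exact: measurable_funB.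
Qed.

Let sq0 f g x : (0 <= ((f x - g x) ^+ 2)%:E)%E.
Proof. by rewrite lee_fin sqr_ge0. Qed.

Lemma sqdist_triangle f g h :
  measurable_fun setT f -> measurable_fun setT g -> measurable_fun setT h ->
  (sqdist f h <= 2%:E * sqdist f g + 2%:E * sqdist g h)%E.
Proof.
move=> mf mg mh; rewrite /sqdist -!ge0_integralZl//=; [|exact: msq..].
rewrite -ge0_integralD//=; last 4 first.
- by move=> x _; rewrite mule_ge0.
- by apply: measurable_funeM; exact: msq.
- by move=> x _; rewrite mule_ge0.
- by apply: measurable_funeM; exact: msq.
apply: ge0_le_integral => //=; first exact: msq.
- by apply: emeasurable_funD; apply: measurable_funeM; exact: msq.
- move=> x _; rewrite -!EFinM -EFinD lee_fin.
  have := sqr_ge0 ((f x - g x) - (g x - h x)); rewrite !expr2; lra.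
Qed.

Lemma poly_approx_lim f : measurable_fun setT f ->
  (forall e : R, 0 < e -> exists2 g, poly_approx g & (sqdist f g < e%:E)%E) ->
  poly_approx f.
Proof.
move=> mf hf; split => // e e0; have e4 : 0 < e / 4 by rewrite divr_gt0.
have [g [mg hg] fg] := hf _ e4; have [p gp] := hg _ e4; exists p.
apply: (le_lt_trans (sqdist_triangle mf mg (measurable_horner p))).
have -> : e = 2 * (e / 4) + 2 * (e / 4) by field.
by rewrite [X in (_ < X)%E]EFinD; apply: lteD; rewrite [X in (_ < X)%E]EFinM lte_pmul2l.
Qed.

Lemma poly_approx_horner p : poly_approx (horner p).
Proof.
split; first exact: measurable_horner.
move=> e e0; exists p; rewrite /sqdist integral0_eq ?lte_fin// => x _.
by rewrite subrr expr0n.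
Qed.

Lemma poly_approxD f g : poly_approx f -> poly_approx g ->
  poly_approx (fun x => f x + g x).
Proof.
move=> [mf hf] [mg hg]; split; first exact: measurable_funD.
move=> e e0; have e4 : 0 < e / 4 by rewrite divr_gt0.
have [p fp] := hf _ e4; have [q gq] := hg _ e4; exists (p + q).
apply: (@le_lt_trans _ _ (2%:E * sqdist f (horner p) + 2%:E * sqdist g (horner q))%E).
  have mp := measurable_horner p; have mq := measurable_horner q.
  rewrite /sqdist -!ge0_integralZl//=; [|exact: msq..].
  rewrite -ge0_integralD//=; last 4 first.
  - by move=> x _; rewrite mule_ge0.
  - by apply: measurable_funeM; exact: msq.
  - by move=> x _; rewrite mule_ge0.
  - by apply: measurable_funeM; exact: msq.
  apply: ge0_le_integral => //=.
  - by move=> x _; rewrite lee_fin sqr_ge0.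
  - by apply: (@msq (fun x => f x + g x) (horner (p + q)));
      [exact: measurable_funD|exact: measurable_horner].
  - by apply: emeasurable_funD; apply: measurable_funeM; exact: msq.
  - move=> x _; rewrite -!EFinM -EFinD lee_fin hornerD.
    have := sqr_ge0 ((f x - p.[x]) - (g x - q.[x])); rewrite !expr2; lra.
have -> : e = 2 * (e / 4) + 2 * (e / 4) by field.
by rewrite [X in (_ < X)%E]EFinD; apply: lteD; rewrite [X in (_ < X)%E]EFinM lte_pmul2l.
Qed.

(** By dominated convergence F n tends to f in mean square, as |f - F n| is at
   most 2 G. *)
Lemma poly_approx_dominated (F : nat -> R -> R) f (G : R -> R) :
  (forall n, poly_approx (F n)) -> measurable_fun setT f ->
  (forall x, F n x @[n --> \oo] --> f x) -> (forall n x, `|F n x| <= G x) ->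
  mu.-integrable setT (fun x => (G x ^+ 2)%:E) -> poly_approx f.
Proof.
move=> hF mf Ff FG iG; apply: poly_approx_lim => // e e0.
have fG x : `|f x| <= G x.
  by apply: (cvgr_to_le (cvg_norm (Ff x))); exact: nearW.
have mF n : measurable_fun setT (F n) by have [] := hF n.
have hc x : ((f x - F n x) ^+ 2)%:E @[n --> \oo] --> 0%E.
  apply: cvg_EFin; first exact: nearW.
  have fF : (fun n => f x - F n x) @ \oo --> (0 : R).
    by rewrite -(subrr (f x)); apply: cvgB => //; exact: cvg_cst.
  by rewrite -(mulr0 (0 : R)); exact: (cvgM fF fF).
have hb x n : (`|((f x - F n x) ^+ 2)%:E| <= 4%:E * (G x ^+ 2)%:E)%E.
  rewrite -EFinM lee_fin ger0_norm ?sqr_ge0//.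
  have := FG n x; have := fG x; rewrite !ler_norml => /andP[? ?] /andP[? ?].
  by rewrite !expr2; nra.
have [_ _] := @dominated_convergence _ _ _ mu setT measurableT
  (fun n x => ((f x - F n x) ^+ 2)%:E) (fun=> 0%E) (fun x => (4%:E * (G x ^+ 2)%:E)%E)
  (fun n => msq mf (mF n)) ltac:(exact: measurable_cst)
  ltac:(exact: (aeW mu (fun x _ => hc x)))
  ltac:(exact: integrableZl)
  ltac:(exact: (aeW mu (fun x n _ => hb x n))).
rewrite integral0 => /fine_cvgP[ffin /cvgr_lt/(_ e e0) flt].
have [n [n1 n2]] := filter_ex (@filterI _ _ _ _ _ ffin flt).
by exists (F n) => //; move: n2; rewrite -lte_fin fineK.
Qed.

(** Bounded functions whose products with polynomials stay in the closure of the
   polynomials; by multiplier_poly_approx they then preserve the whole closure.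
   Unlike that closure they form an algebra, which is what leads from Gaussians
   to indicators. *)
Definition multiplier phi := [/\ measurable_fun setT phi,
  exists C : R, forall x, `|phi x| <= C &
  forall p, poly_approx (fun x => phi x * p.[x])].

Lemma multiplier_poly_approx phi f : multiplier phi -> poly_approx f ->
  poly_approx (fun x => phi x * f x).
Proof.
move=> [mphi [C hC] hphi] [mf hf].
have mpf : measurable_fun setT (fun x => phi x * f x) by exact: measurable_funM.
have C1 : 0 < C ^+ 2 + 1 by rewrite ltr_wpDl ?sqr_ge0.
apply: poly_approx_lim => // e e0.
have [p hp] := hf (e / (C ^+ 2 + 1)) ltac:(by rewrite divr_gt0).
exists (fun x => phi x * p.[x]) => //.
apply: (@le_lt_trans _ _ ((C ^+ 2 + 1)%:E * sqdist f (horner p))%E); last first.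
  by rewrite -lte_pdivlMl// -EFinM mulrC.
rewrite /sqdist -ge0_integralZl//=; last 2 first.
- exact: (@msq f (horner p) mf (measurable_horner p)).
- by rewrite lee_fin ltW.
apply: ge0_le_integral => //=.
- by move=> x _; rewrite lee_fin sqr_ge0.
- apply: (@msq _ (fun x => phi x * p.[x])) => //; apply: measurable_funM => //.
  exact: measurable_horner.
- by apply: measurable_funeM; exact: (@msq f (horner p) mf (measurable_horner p)).
- move=> x _; rewrite -EFinM lee_fin -mulrBr exprMn ler_wpM2r ?sqr_ge0//.
  rewrite -real_normK ?num_real// (@le_trans _ _ (C ^+ 2)) ?lerDl//.
  by rewrite ler_pXn2r ?nnegrE// (le_trans _ (hC x)).
Qed.

Lemma multiplierM phi psi : multiplier phi -> multiplier psi ->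
  multiplier (fun x => phi x * psi x).
Proof.
move=> hphi [mpsi [D hD] hpsi]; have [mphi [C hC] _] := hphi; split.
- exact: measurable_funM.
- exists (C * D) => x; rewrite normrM ler_pM//.
- move=> p; under eq_fun do rewrite -mulrA.
  exact: multiplier_poly_approx.
Qed.

Lemma multiplier_cst (c : R) : multiplier (fun=> c).
Proof.
split; [exact: measurable_cst|by exists (`|c|)|move=> p].
by under eq_fun do rewrite -hornerZ; exact: poly_approx_horner.
Qed.

Lemma multiplierD phi psi : multiplier phi -> multiplier psi ->
  multiplier (fun x => phi x + psi x).
Proof.
move=> [mphi [C hC] hphi] [mpsi [D hD] hpsi]; split.
- exact: measurable_funD.
- by exists (C + D) => x; rewrite (le_trans (ler_normD _ _))// lerD.
- by move=> p; under eq_fun do rewrite mulrDl; exact: poly_approxD.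
Qed.

Lemma multiplierB phi psi : multiplier phi -> multiplier psi ->
  multiplier (fun x => phi x - psi x).
Proof.
move=> hphi hpsi; under eq_fun do rewrite -mulN1r.
apply: multiplierD => //; apply: multiplierM => //; exact: multiplier_cst.
Qed.

Lemma multiplier_lim (F : nat -> R -> R) phi :
  (forall n, multiplier (F n)) -> (forall n x, `|F n x| <= 1) ->
  (forall x, F n x @[n --> \oo] --> phi x) ->
  multiplier phi.
Proof.
move=> hF F1 Fphi.
have mphi : measurable_fun setT phi.
  apply: (@measurable_fun_cvg _ _ _ _ F) => [n|x _]; last exact: Fphi.
  by have [] := hF n.
split => //.
  by exists 1 => x; apply: (cvgr_to_le (cvg_norm (Fphi x))); exact: nearW.
move=> p; apply: (@poly_approx_dominated (fun n x => F n x * p.[x]) _ (fun x => `|p.[x]|)).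
- by move=> n; have [_ _] := hF n.
- by apply: measurable_funM => //; exact: measurable_horner.
- by move=> x; apply: cvgM => //; exact: cvg_cst.
- by move=> n x; rewrite normrM ler_piMl.
- have := @integrable_hermite_gauss R 0 (p ^+ 2) ltac:(by rewrite oppr_lt0).
  apply: eq_integrable => // x _.
  by rewrite oppr0 mul0r expR0 mulr1 horner_exp real_normK ?num_real.
Qed.

Lemma exp_series_le (y : R) n : `|series (exp_coeff y) n| <= expR `|y|.
Proof.
apply: (@le_trans _ _ (series (exp_coeff `|y|) n)).
  rewrite /series /= (le_trans (ler_norm_sum _ _ _))//; apply: ler_sum => i _.
  by rewrite /exp_coeff /= normrM normrX [X in _ * X]ger0_norm.
rewrite /expR; apply: nondecreasing_cvgn_le; last exact: is_cvg_series_exp_coeff.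
apply/nondecreasing_seqP => k; rewrite /series /= big_nat_recr //= lerDl.
by rewrite /exp_coeff /= mulr_ge0 ?exprn_ge0.
Qed.

(** The partial sums of the exponential series are polynomials, dominated by
   |p| e^(x^2/4). The square of this bound is mu-integrable because 2/4 < 1. *)
Lemma poly_approx_gauss p : poly_approx (fun x => p.[x] * expR (- 4^-1 * x ^+ 2)).
Proof.
pose P n : {poly R} := p * \sum_(0 <= k < n) ((- 4^-1) ^+ k / k`!%:R) *: 'X^(2 * k).
have PE n x : (P n).[x] = p.[x] * series (exp_coeff (- 4^-1 * x ^+ 2)) n.
  rewrite hornerM horner_sum; congr (_ * _); apply: eq_bigr => k _.
  by rewrite hornerZ hornerXn exprM /exp_coeff /= mulrAC -exprMn.
apply: (@poly_approx_dominated (fun n x => (P n).[x])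
  (fun x => p.[x] * expR (- 4^-1 * x ^+ 2))
  (fun x => `|p.[x]| * expR (4^-1 * x ^+ 2))).
- by move=> n; exact: poly_approx_horner.
- exact: measurable_horner_gauss.
- move=> x; under eq_fun do rewrite PE.
  by apply: cvgM; [exact: cvg_cst|exact: is_cvg_series_exp_coeff].
- move=> n x; rewrite PE normrM ler_wpM2l// (le_trans (exp_series_le _ _))//.
  by rewrite ler_expR normrM normrN !ger0_norm ?sqr_ge0.
- have := @integrable_hermite_gauss R (- 2^-1) (p ^+ 2) ltac:(by rewrite ltrN2 invf_lt1// ltr1n).
  apply: eq_integrable => // x _.
  rewrite exprMn real_normK ?num_real// horner_exp -expRM_natl opprK.
  by congr (_ * expR _)%:E; field.
Qed.

Lemma multiplier_gauss q : multiplier (fun x => q.[x] * expR (- 4^-1 * x ^+ 2)).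
Proof.
split; first exact: measurable_horner_gauss.
- have [C C0 hC] := @horner_gauss_bound R q (4^-1) ltac:(by rewrite invr_gt0).
  exists C => x; rewrite (le_trans (hC x))// ler_piMr ?(ltW C0)//.
  by rewrite -expR0 ler_expR mulNr oppr_le0 mulr_ge0 ?sqr_ge0.
- move=> p; have := poly_approx_gauss (q * p).
  by under eq_fun do rewrite hornerM mulrAC.
Qed.

(** The cubic s |-> (3s - s^3)/2 maps [-1, 1] to itself and its iterates converge
   to the sign function there. *)
Definition sign_iter (n : nat) (t : R) : R := iter n (fun s => (3 * s - s ^+ 3) / 2) t.

Lemma sign_iterN n t : sign_iter n (- t) = - sign_iter n t.
Proof. by elim: n => //= n ->; field. Qed.

(** One step multiplies 1 - u by 1 - (u + u^2)/2, which is at most 1 - t/2 as long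
   as t <= u. *)
Lemma sign_iter_ge n t : 0 <= t <= 1 ->
  t <= sign_iter n t <= 1 /\ 1 - sign_iter n t <= (1 - t / 2) ^+ n.
Proof.
move=> /andP[t0 t1]; elim: n => [|n [/andP[ih1 ih2] ih3]] /=.
  by rewrite lexx t1 expr0 lerBlDr lerDl.
rewrite -/(sign_iter n t); set u := sign_iter n t in ih1 ih2 ih3 *.
have -> : (3 * u - u ^+ 3) / 2 = 1 - (1 - u) * (1 - (u + u ^+ 2) / 2) by field.
have u0 : 0 <= u by exact: le_trans ih1.
have b1 : 0 <= 1 - (u + u ^+ 2) / 2 by rewrite expr2; nra.
have b2 : 1 - (u + u ^+ 2) / 2 <= 1 - t / 2 by rewrite expr2; nra.
have b3 : 1 - (u + u ^+ 2) / 2 <= 1 by rewrite expr2; nra.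
split.
  by apply/andP; split; nra.
by rewrite subKr [X in _ <= X]exprSr ler_pM// subr_ge0.
Qed.

Lemma sign_iter_norm n t : `|t| <= 1 -> `|sign_iter n t| <= 1.
Proof.
move=> t1; have [t0|t0] := leP 0 t.
  have [/andP[h1 h2] _] := @sign_iter_ge n t ltac:(by rewrite t0 -(ger0_norm t0)).
  by rewrite ger0_norm// (le_trans t0).
have [/andP[h1 h2] _] := @sign_iter_ge n (- t) ltac:(by rewrite oppr_ge0 (ltW t0) -(ltr0_norm t0)).
by rewrite -normrN -sign_iterN ger0_norm// (le_trans _ h1)// oppr_ge0 ltW.
Qed.

Lemma cvg_sign_iter t : `|t| <= 1 -> sign_iter n t @[n --> \oo] --> Num.sg t.
Proof.
have pos (s : R) : 0 < s -> s <= 1 -> sign_iter n s @[n --> \oo] --> (1 : R).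
  move=> s0 s1; apply/cvgrPdist_le => e e0.
  have h : (fun n => (1 - s / 2) ^+ n) @ \oo --> (0 : R).
    by apply: cvg_expr; rewrite ger0_norm; lra.
  have hn : \forall n \near \oo, (1 - s / 2) ^+ n <= e by move/cvgr_le : h; apply.
  near=> n; have [/andP[h1 h2] h3] := @sign_iter_ge n s ltac:(by rewrite (ltW s0) s1).
  rewrite ger0_norm ?subr_ge0// (le_trans h3)//.
  by near: n.
move=> t1; case: (sgrP t) => [->|t0|t0].
- rewrite (_ : (fun n => _) = fun=> 0); first exact: cvg_cst.
  by apply/funext; elim=> //= n ->; rewrite expr0n /= mulr0 subrr mul0r.
- by apply: pos => //; rewrite -(gtr0_norm t0).
- have := pos (- t) ltac:(by rewrite oppr_gt0) ltac:(by rewrite -(ltr0_norm t0)).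
  move=> /cvgN; rewrite (_ : - _ = fun n => sign_iter n t)//.
  by apply/funext => n; rewrite fctE sign_iterN opprK.
Unshelve. all: by end_near. Qed.

Lemma multiplier_sign_iter phi n : multiplier phi ->
  multiplier (fun x => sign_iter n (phi x)).
Proof.
move=> hphi; elim: n => //= n ih.
rewrite (_ : (fun x => _) = fun x => 2^-1 * (3 * sign_iter n (phi x) -
    sign_iter n (phi x) * (sign_iter n (phi x) * sign_iter n (phi x)))); last first.
  by apply/funext => x; field.
apply: multiplierM; first exact: multiplier_cst.
apply: multiplierB; first by apply: multiplierM => //; exact: multiplier_cst.
by do 2 apply: multiplierM => //.
Qed.

(** The function (x - r) e^(-x^2/4) is a multiplier with the sign of x - r; scaled
   into [-1, 1] it is a starting point for sign_iter. *)
Lemma multiplier_sg (r : R) : multiplier (fun x => Num.sg (x - r)).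
Proof.
pose v x := ('X - r%:P).[x] * expR (- 4^-1 * x ^+ 2).
have [C C0 hC] := @horner_gauss_bound R ('X - r%:P) 4^-1 ltac:(by rewrite invr_gt0).
have C1 x : `|C^-1 * v x| <= 1.
  rewrite normrM gtr0_norm ?invr_gt0// ler_pdivrMl// mulr1 (le_trans (hC x))//.
  by rewrite ler_piMr ?(ltW C0)// -expR0 ler_expR mulNr oppr_le0 mulr_ge0 ?sqr_ge0.
have vs x : Num.sg (C^-1 * v x) = Num.sg (x - r).
  rewrite /v !sgrM (gtr0_sg (expR_gt0 _)) gtr0_sg ?invr_gt0// mul1r mulr1.
  by rewrite !hornerE.
have mv : multiplier (fun x => C^-1 * v x).
  by apply: multiplierM; [exact: multiplier_cst|exact: multiplier_gauss].
apply: (@multiplier_lim (fun n x => sign_iter n (C^-1 * v x))).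
- by move=> n; exact: multiplier_sign_iter.
- by move=> n x; exact: sign_iter_norm.
- by move=> x; rewrite -vs; exact: cvg_sign_iter.
Qed.

Lemma multiplier_indic_itv (r : R) : multiplier \1_(`]r, +oo[%classic : set R).
Proof.
(* (s + s^2)/2 is 1 for s = 1 and 0 for s = 0 and s = -1 *)
rewrite (_ : \1__ = fun x => 2^-1 * (Num.sg (x - r) + Num.sg (x - r) * Num.sg (x - r))).
  apply: multiplierM; first exact: multiplier_cst.
  by apply: multiplierD; [|apply: multiplierM]; exact: multiplier_sg.
apply/funext => x; rewrite indicE.
have -> : (x \in (`]r, +oo[%classic : set R)) = (0 < x - r).
  by rewrite subr_gt0; apply/idP/idP; rewrite inE /= in_itv /= andbT.
case: (sgrP (x - r)) => _; first by rewrite mulr0 add0r mulr0.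
- by rewrite mulr1 mulVf.
- by rewrite mulrNN mulr1 addNr mulr0.
Qed.

(** The sets whose indicators are multipliers form a sigma-algebra, which contains
   the half-lines. *)
Lemma multiplier_indic (A : set (measurableTypeR R)) : measurable A -> multiplier \1_A.
Proof.
pose S : set (set R) := [set B | multiplier (\1_B : R -> R)].
have sS : sigma_algebra setT S.
  split => [|B|B] /=; rewrite /S /=.
  - by rewrite indic0; exact: multiplier_cst.
  - move=> mB; rewrite setTD (_ : \1__ = fun x => 1 - \1_B x).
      by apply: multiplierB => //; exact: multiplier_cst.
    apply/funext => x; rewrite !indicE in_setC; case: (x \in B) => /=.
      by rewrite subrr.
    by rewrite subr0.
  (* the indicator of a finite union is 1 minus the product of the indicators of
     the complements *)
  - move=> mB; pose F n x : R := 1 - \prod_(i < n) (1 - \1_(B i) x).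
    have F01 n x : 0 <= \prod_(i < n) (1 - \1_(B i) x : R) <= 1.
      elim: n => [|n /andP[ih1 ih2]]; first by rewrite big_ord0 lexx ler01.
      rewrite big_ord_recr /= indicE; case: (x \in B n) => /=.
        by rewrite subrr mulr0 lexx ler01.
      by rewrite subr0 mulr1 ih1 ih2.
    apply: (@multiplier_lim F).
    + move=> n; apply: (@multiplierB (fun=> 1)); first exact: multiplier_cst.
      elim: n => [|n ih].
        by under eq_fun do rewrite big_ord0; exact: multiplier_cst.
      under eq_fun do rewrite big_ord_recr /=.
      by apply: multiplierM => //; exact: (multiplierB (multiplier_cst 1) (mB n)).
    + move=> n x; have /andP[h1 h2] := F01 n x.
      by rewrite ger0_norm ?subr_ge0// lerBlDr lerDl.
    + move=> x; rewrite indicE; have [[k _ Bkx]|nB] := pselect ((\bigcup_i B i) x).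
        apply: cvg_near_cst; near=> n.
        have kn : (k < n)%N by near: n; exact: nbhs_infty_gt.
        rewrite /F (bigD1 (Ordinal kn))//= indicE mem_set// subrr mul0r subr0.
        by rewrite /= mem_set//; exists k.
      rewrite memNset//; apply: cvg_near_cst; apply: nearW => n.
      rewrite /F big1 ?subrr// => i _; rewrite indicE memNset ?subr0//.
      by apply: contra_not nB => Bi; exists i.
rewrite [measurable]RGenOInfty.measurableE => mA.
apply: (smallest_sub sS _ mA) => _ [r ->].
exact: multiplier_indic_itv.
Unshelve. all: by end_near. Qed.

Import HBNNSimple.

Lemma poly_approx_nnsfun (g : {nnsfun (measurableTypeR R) >-> R}) : poly_approx g.
Proof.
have [s hs] : exists s : seq R, forall x, g x = \sum_(y <- s) y * \1_(g @^-1` [set y]) x.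
  by eexists => x; rewrite {1}fimfunE fsbig_finite//.
rewrite (_ : (g : R -> R) = fun x => \sum_(y <- s) y * \1_(g @^-1` [set y]) x); last exact/funext.
elim: s {hs} => [|y s ih].
  have := poly_approx_horner 0.
  by congr poly_approx; apply/funext => x; rewrite big_nil horner0.
rewrite (_ : (fun x => _) = fun x => y * \1_(g @^-1` [set y]) x +
    \sum_(z <- s) z * \1_(g @^-1` [set z]) x); last by apply/funext => x; rewrite big_cons.
apply: poly_approxD => //.
have hm : multiplier (fun x => y * \1_(g @^-1` [set y]) x).
  by apply: multiplierM; [exact: multiplier_cst|exact: multiplier_indic].
have [_ _ /(_ 1)] := hm; congr poly_approx.
by apply/funext => x; rewrite hornerE mulr1.
Qed.

(** A nonnegative f is the limit of simple functions bounded by f, and these are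
   combinations of multipliers; in general f is split into its positive and
   negative parts. *)
Lemma poly_dense f : measurable_fun setT f ->
  mu.-integrable setT (fun x => (f x ^+ 2)%:E) -> poly_approx f.
Proof.
have pos g : measurable_fun setT g -> (forall x, 0 <= g x) ->
    mu.-integrable setT (fun x => (g x ^+ 2)%:E) -> poly_approx g.
  move=> mg g0 ig.
  have mgE : measurable_fun setT (EFin \o g : measurableTypeR R -> \bar R).
    exact/measurable_EFinP.
  have g0E x : setT x -> (0 <= (EFin \o g) x)%E by rewrite lee_fin.
  pose h := nnsfun_approx measurableT mgE.
  apply: (@poly_approx_dominated (fun n => h n) g g) => //.
  - by move=> n; exact: poly_approx_nnsfun.
  - by move=> x; have /fine_cvg := cvg_nnsfun_approx measurableT mgE g0E (I : setT x).
  - move=> n x; rewrite ger0_norm// -lee_fin.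
    by rewrite (nnsfun_approxE measurableT mgE) (le_approx n g0E).
move=> mf iF.
have bnd (g : R -> R) : measurable_fun setT g -> (forall x, 0 <= g x <= `|f x|) ->
    mu.-integrable setT (fun x => (g x ^+ 2)%:E).
  move=> mg gf; apply: le_integrable iF => //.
    by apply/measurable_EFinP; exact: measurable_funX.
  move=> x _; have /andP[g0 gfx] := gf x.
  rewrite lee_fin !ger0_norm ?sqr_ge0// -[leRHS]real_normK ?num_real//.
  by rewrite ler_pXn2r ?nnegrE.
have fE : f = fun x => Num.max (f x) 0 + (-1) * Num.max (- f x) 0.
  apply/funext => x; have [f0|/ltW f0] := leP 0 (f x).
    by rewrite max_r ?oppr_le0// mulr0 addr0.
  by rewrite max_l ?oppr_ge0// add0r mulN1r opprK.
have mp : measurable_fun setT (fun x => Num.max (f x) 0).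
  by apply: measurable_maxr.
have mn : measurable_fun setT (fun x => Num.max (- f x) 0).
  by apply: measurable_maxr => //; exact: measurableT_comp.
have ap : poly_approx (fun x => Num.max (f x) 0).
  apply: pos => //; first by move=> x; rewrite le_max lexx orbT.
  by apply: bnd => // x; rewrite le_max lexx orbT /= ge_max normr_ge0 ler_norm.
have an : poly_approx (fun x => Num.max (- f x) 0).
  apply: pos => //; first by move=> x; rewrite le_max lexx orbT.
  apply: bnd => // x; rewrite le_max lexx orbT /= ge_max normr_ge0.
  by rewrite -normrN ler_norm.
rewrite fE; apply: poly_approxD => //.
by apply: multiplier_poly_approx => //; exact: multiplier_cst.
Qed.

End polynomial_density.

(** * The limit of a fast Cauchy sequence of functions *)

Section riesz_fischer.
Context d (T : measurableType d) (R : realType).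
Variable mu : {measure set T -> \bar R}.
Implicit Types (a : nat -> T -> R) (t : T).

Let series_bounded_cvg (u : R^nat) (M : R) : (forall n, 0 <= u n) ->
  (forall n, series u n <= M) -> cvgn (series u).
Proof.
move=> u0 uM; apply: nondecreasing_is_cvgn.
  apply/nondecreasing_seqP => k; rewrite /series /= big_nat_recr //= lerDl//.
by exists M => _ [n _ <-].
Qed.

(** The sum S of the 2^k (a_(k+1) - a_k)^2 is integrable, since that of the
   2^k / 4^k converges, hence finite almost everywhere. Where it is, the increments
   are summable because |d| <= 2^-k + 2^k d^2, and (a_j - a_k)^2 <= 2 S by
   Cauchy-Schwarz against the weights 2^-i, so that 2 S dominates the convergence to
   the pointwise limit. *)
Lemma riesz_fischer a : (forall k, measurable_fun setT (a k)) ->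
  (forall k, \int[mu]_t ((a k.+1 t - a k t) ^+ 2)%:E <= ((4 ^+ k)^-1)%:E)%E ->
  exists2 g : T -> R, measurable_fun setT g &
    (\int[mu]_t ((a k t - g t) ^+ 2)%:E)%E @[k --> \oo] --> 0%E.
Proof.
move=> ma Ha; pose D k t : R := 2 ^+ k * (a k.+1 t - a k t) ^+ 2.
have D0 k t : 0 <= D k t by rewrite mulr_ge0 ?sqr_ge0 ?exprn_ge0.
have mD k : measurable_fun setT (EFin \o D k).
  apply/measurable_EFinP; apply: measurable_funM => //; apply: measurable_funX.
  exact: measurable_funB.
pose S t := (\sum_(0 <= k <oo) (D k t)%:E)%E.
have mS : measurable_fun setT S.
  apply: (@ge0_emeasurable_sum _ _ _ setT (fun k t => (D k t)%:E) xpredT) => [k t _ _|k _].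
    by rewrite lee_fin.
  exact: mD.
have S0 t : (0 <= S t)%E by apply: nneseries_ge0 => k _ _; rewrite lee_fin.
have partS n t : ((series (D ^~ t) n)%:E <= S t)%E.
  rewrite /series /= -sumEFin; apply: nneseries_lim_ge => k _ _.
  by rewrite lee_fin.
have intS : (\int[mu]_t S t < +oo)%E.
  rewrite /S integral_nneseries//; last by move=> k t _; rewrite lee_fin.
  apply: (@le_lt_trans _ _ (2%:E)%E); last by rewrite ltry.
  apply: lime_le.
    by apply: is_cvg_nneseries => k _ _; apply: integral_ge0 => t _; rewrite lee_fin.
  apply: nearW => n.
  apply: (@le_trans _ _ (\sum_(0 <= k < n) ((2 ^+ k)^-1)%:E)%E).
    apply: lee_sum => k _; rewrite /D.
    under eq_integral do rewrite EFinM.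
    rewrite ge0_integralZl//.
    - apply: (@le_trans _ _ ((2 ^+ k)%:E * ((4 ^+ k)^-1)%:E)%E).
        by rewrite lee_pmul2l// lte_fin exprn_gt0.
      rewrite -EFinM lee_fin (_ : 4 = 2 * 2) ?exprMn; last by ring.
      by rewrite invfM mulrA mulfV ?mul1r// expf_neq0.
    - apply/measurable_EFinP; apply: measurable_funX; exact: measurable_funB.
    - by move=> t _; rewrite lee_fin sqr_ge0.
  rewrite sumEFin lee_fin.
  have -> : \sum_(0 <= k < n) (2 ^+ k)^-1 = 2 - 2 * (2 ^+ n)^-1 :> R.
    elim: n => [|n ih]; first by rewrite big_geq// expr0 invr1 mulr1 subrr.
    by rewrite big_nat_recr //= ih exprS; field; rewrite expf_neq0.
  by rewrite lerBlDr lerDl mulr_ge0.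
have iS : mu.-integrable setT S.
  apply/integrableP; split; first exact: mS.
  by under eq_integral do rewrite gee0_abs//.
pose A := [set t | (S t < +oo)%E].
have mA : measurable A by rewrite -[A]setTI; exact: emeasurable_fun_infty_o.
have aeA : {ae mu, forall t, A t}.
  apply: filterS (integrable_ae measurableT iS) => t /(_ I).
  by rewrite /A /= ltey_eq => ->.
(* on the null set where S is infinite the sequence is replaced by 0, so that the
   limit exists everywhere and is measurable *)
pose c k t := \1_A t * a k t.
have mc k : measurable_fun setT (c k) by apply: measurable_funM.
have cvA t : A t -> cvgn (series (D ^~ t)).
  move=> At; apply: (@series_bounded_cvg _ (fine (S t))) => // n.
  by rewrite -lee_fin fineK// ge0_fin_numE.
have cvc t : cvgn (c ^~ t).
  have [At|nAt] := pselect (A t); last first.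
    by apply: (@is_cvg_near_cst _ R^o 0); apply: nearW => n;
      rewrite /c indicE memNset ?mul0r.
  have cab : c ^~ t = a ^~ t.
    by apply/funext => n; rewrite /c indicE mem_set ?mul1r.
  rewrite cab.
  have : cvgn (series (telescope (a ^~ t))).
    apply: normed_cvg; apply: (@series_le_cvg _ _ (fun k => (2 ^+ k)^-1 + D k t)) => //.
    - by move=> k; exact: normr_ge0.
    - by move=> k; apply: addr_ge0 => //; rewrite invr_ge0 exprn_ge0.
    - move=> k; rewrite /telescope /= /D.
      have := sqr_ge0 ((2 ^+ k)^-1 - `|a k.+1 t - a k t|).
      rewrite -[(a k.+1 t - a k t) ^+ 2]real_normK ?num_real//.
      set x := `|_|; have x0 : 0 <= x by exact: normr_ge0.
      have p0 : 0 < 2 ^+ k :> R by rewrite exprn_gt0.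
      move=> h; rewrite -(ler_pM2l p0) mulrDr mulfV ?gt_eqF//.
      have := sqr_ge0 (1 - 2 ^+ k * x); rewrite !expr2; nra.
    - rewrite (_ : series _ = series (fun k => (2 ^+ k)^-1) \+ series (D ^~ t)).
        apply: is_cvgD; last exact: cvA.
        rewrite (_ : (fun k => _) = geometric 1 (2^-1)).
          by apply: is_cvg_geometric_series; rewrite ger0_norm// invf_lt1// ltr1n.
        by apply/funext => k; rewrite /geometric /= mul1r exprVn.
      by apply/funext => n; rewrite /series /= big_split.
  move=> h.
  have -> : a ^~ t = (fun=> a 0%N t) \+ series (telescope (a ^~ t)).
    by apply/funext => n; rewrite [LHS](eq_sum_telescope (a ^~ t)).
  by apply: is_cvgD => //; exact: is_cvg_cst.
pose g t := limn (c ^~ t).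
have cg t : c ^~ t @ \oo --> g t by exact: cvc.
have mg : measurable_fun setT g by apply: (measurable_fun_cvg mc) => t _; exact: cg.
exists g => //.
(* (z - y)^2 <= 2 (z - x)^2 + 2 (x - y)^2 at each step doubles the weight of the
   remaining increments *)
have cbound k m t : (c (k + m)%N t - c k t) ^+ 2 <=
    2 * \sum_(i < m) 2 ^+ i * (c (k + i).+1%N t - c (k + i)%N t) ^+ 2.
  elim: m k => [|m ih] k; first by rewrite addn0 subrr expr0n big_ord0 mulr0.
  have h := ih k.+1; rewrite big_ord_recl /= expr0 mul1r addn0.
  have -> : \sum_(i < m) 2 ^+ bump 0 i * (c (k + bump 0 i).+1%N t - c (k + bump 0 i)%N t) ^+ 2 =
      2 * \sum_(i < m) 2 ^+ i * (c (k.+1 + i).+1%N t - c (k.+1 + i)%N t) ^+ 2.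
    by rewrite mulr_sumr; apply: eq_bigr => i _; rewrite /bump /= add1n exprS -mulrA -addSnnS.
  move: h; rewrite addSnnS; set s := \sum_(i < m) _; set x := c k.+1 t; set y := c k t.
  set z := c (k + _)%N t => h.
  have := sqr_ge0 ((z - x) - (x - y)); rewrite !expr2 in h *; nra.
have cSb k j t : (k <= j)%N -> (((c j t - c k t) ^+ 2)%:E <= 2%:E * S t)%E.
  move=> kj; have [At|nAt] := pselect (A t); last first.
    by rewrite /c indicE memNset// !mul0r subrr expr0n mule_ge0.
  apply: (@le_trans _ _ (2 * series (D ^~ t) j)%:E); last first.
    by rewrite EFinM lee_pmul2l// partS.
  rewrite lee_fin -(subnKC kj) (le_trans (cbound _ _ _))// ler_pM2l//.
  rewrite /series /= big_mkord big_split_ord /= ler_wpDl//.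
    by apply: sumr_ge0 => i _; exact: D0.
  apply: ler_sum => i _; rewrite /c indicE mem_set// !mul1r /D ler_wpM2r ?sqr_ge0//.
  by rewrite ler_weXn2l ?leq_addl// ler1n.
have gSb k t : (((c k t - g t) ^+ 2)%:E <= 2%:E * S t)%E.
  have [At|nAt] := pselect (A t); last first.
    have -> : g t = c k t.
      rewrite /g (_ : c ^~ t = fun=> 0); last first.
        by apply/funext => n; rewrite /c indicE memNset ?mul0r.
      by rewrite lim_cst// /c indicE memNset ?mul0r.
    by rewrite subrr expr0n mule_ge0.
  have fS : S t \is a fin_num by rewrite ge0_fin_numE.
  rewrite -(fineK fS) -EFinM lee_fin -sqrrN opprB.
  have h : (c j t - c k t) ^+ 2 @[j --> \oo] --> (g t - c k t) ^+ 2.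
    have h1 : (fun j => c j t - c k t) @ \oo --> g t - c k t by apply: cvgB => //; exact: cvg_cst.
    exact: (cvgM h1 h1).
  apply: (cvgr_to_le h); exists k => // j /= kj.
  by rewrite -lee_fin [X in (_ <= X)%E]EFinM fineK// cSb.
have [_ _] := @dominated_convergence _ _ _ mu setT measurableT
  (fun k t => ((c k t - g t) ^+ 2)%:E) (fun=> 0%E) (fun t => (2%:E * S t)%E)
  ltac:(by move=> k; apply/measurable_EFinP; apply: measurable_funX; exact: measurable_funB)
  ltac:(exact: measurable_cst)
  ltac:(apply: aeW => t _; apply: cvg_EFin; [exact: nearW|
    rewrite -(mulr0 (0 : R)) -(subrr (g t));
    have h1 : (fun k => c k t - g t) @ \oo --> g t - g t by [apply: cvgB => //; exact: cvg_cst];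
    exact: (cvgM h1 h1)])
  ltac:(exact: integrableZl)
  ltac:(apply: aeW => t k _; rewrite gee0_abs ?lee_fin ?sqr_ge0//; exact: gSb).
rewrite integral0.
suff -> : (fun k => \int[mu]_t ((a k t - g t) ^+ 2)%:E)%E =
    (fun k => \int[mu]_t ((c k t - g t) ^+ 2)%:E)%E by [].
apply/funext => k; apply: ge0_ae_eq_integral => //.
- by apply/measurable_EFinP; apply: measurable_funX; exact: measurable_funB.
- by apply/measurable_EFinP; apply: measurable_funX; exact: measurable_funB.
- by move=> t _; rewrite lee_fin sqr_ge0.
- by move=> t _; rewrite lee_fin sqr_ge0.
- by apply: filterS aeA => t At _; rewrite /c indicE mem_set// mul1r.
Qed.

End riesz_fischer.

(** * Pre-Hilbert spaces *)

Section pre_hilbert.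
Context {R : realType} {V : preHilbertType R}.
Implicit Types (x y z : V) (a : R[i]).

Lemma innerDl x y z : inner (x + y) z = inner x z + inner y z.
Proof. by rewrite -[x]scale1r inner_linearl mul1r scale1r. Qed.

Lemma inner0l z : inner 0 z = 0.
Proof. by apply: (addIr (inner 0 z)); rewrite -innerDl !add0r. Qed.

Lemma innerZl a x z : inner (a *: x) z = a * inner x z.
Proof. by rewrite -[a *: x]addr0 inner_linearl inner0l addr0. Qed.

Lemma innerNl x z : inner (- x) z = - inner x z.
Proof. by rewrite -scaleN1r innerZl mulN1r. Qed.

Lemma innerBl x y z : inner (x - y) z = inner x z - inner y z.
Proof. by rewrite innerDl innerNl. Qed.

Lemma inner_suml (I : Type) (s : seq I) (F : I -> V) z :
  inner (\sum_(i <- s) F i) z = \sum_(i <- s) inner (F i) z.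
Proof.
by elim: s => [|i s ih]; rewrite ?big_nil ?inner0l// !big_cons innerDl ih.
Qed.

Lemma innerDr x y z : inner z (x + y) = inner z x + inner z y.
Proof. by rewrite inner_conj innerDl rmorphD /= -!inner_conj. Qed.

Lemma innerZr a x z : inner z (a *: x) = a^* * inner z x.
Proof. by rewrite inner_conj innerZl rmorphM /= -inner_conj. Qed.

Lemma innerNr x z : inner z (- x) = - inner z x.
Proof. by rewrite inner_conj innerNl rmorphN /= -inner_conj. Qed.

Lemma innerBr x y z : inner z (x - y) = inner z x - inner z y.
Proof. by rewrite innerDr innerNr. Qed.

Definition sqn x : R := complex.Re (inner x x).

Lemma inner_sqn x : inner x x = (sqn x)%:C.
Proof.
have : inner x x \is Num.real by rewrite -sqr_norm_inner ger0_real// exprn_ge0.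
by rewrite /sqn; case: (inner x x) => u v /=; rewrite complex_real => /eqP /= ->.
Qed.

Lemma normE x : `|x| = (Num.sqrt (sqn x))%:C.
Proof.
apply/eqP; rewrite -(@eqrXn2 _ 2)// ?ler0c ?sqrtr_ge0//.
rewrite sqr_norm_inner inner_sqn -rmorphXn /= sqr_sqrtr//.
by rewrite -ler0c -inner_sqn -sqr_norm_inner exprn_ge0.
Qed.

Lemma sqn_ge0 x : 0 <= sqn x.
Proof. by rewrite -ler0c -inner_sqn -sqr_norm_inner exprn_ge0. Qed.

Lemma sqn_eq0 x : sqn x = 0 -> x = 0.
Proof. by move=> h; apply/eqP; rewrite -normr_eq0 normE h sqrtr0. Qed.

Lemma sqn0 : sqn 0 = 0.
Proof. by rewrite /sqn inner0l. Qed.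

Lemma sqnN x : sqn (- x) = sqn x.
Proof. by rewrite /sqn innerNl innerNr opprK. Qed.

Lemma sqnB x y : sqn (x - y) = sqn (y - x).
Proof. by rewrite -sqnN opprB. Qed.

Lemma sqnZ a x : sqn (a *: x) = abs2 a * sqn x.
Proof.
have : inner (a *: x) (a *: x) = (abs2 a * sqn x)%:C.
  by rewrite innerZl innerZr mulrA -abs2E inner_sqn -rmorphM.
by rewrite /sqn => ->.
Qed.

Lemma ReD (u v : R[i]) : complex.Re (u + v) = complex.Re u + complex.Re v.
Proof. by case: u v => a b []. Qed.

Lemma Re_conj (u : R[i]) : complex.Re (u^*) = complex.Re u.
Proof. by case: u. Qed.

Lemma sqnD x y : sqn (x + y) = sqn x + sqn y + 2 * complex.Re (inner x y).
Proof.
rewrite /sqn innerDl !innerDr !ReD [inner y x]inner_conj Re_conj; ring.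
Qed.

Lemma sqnD_le x y : sqn (x + y) <= 2 * sqn x + 2 * sqn y.
Proof.
have := sqn_ge0 (x - y); rewrite !sqnD sqnN innerNr => h.
have : complex.Re (- inner x y) = - complex.Re (inner x y) by case: (inner x y).
move=> e; rewrite e in h; lra.
Qed.

Lemma cauchy_schwarz x y : abs2 (inner x y) <= sqn x * sqn y.
Proof.
have [y0|y0] := eqVneq (sqn y) 0.
  rewrite (sqn_eq0 y0) inner_conj inner0l.
  by rewrite /abs2 rmorph0 /= !expr0n addr0 mulr_ge0 ?sqn_ge0.
have yp : 0 < sqn y by rewrite lt_def y0 sqn_ge0.
have := sqn_ge0 (x - (inner x y / (sqn y)%:C) *: y).
rewrite sqnD sqnN sqnZ innerNr innerZr.
have -> : complex.Re (- ((inner x y / (sqn y)%:C)^* * inner x y)) =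
    - (abs2 (inner x y) / sqn y).
  rewrite rmorphM /= mulrAC [_^* * _]mulrC -abs2E -fmorphV /= .
  case: (inner x y) => u v; rewrite /abs2 /=; ring.
have -> : abs2 (inner x y / (sqn y)%:C) = abs2 (inner x y) / sqn y ^+ 2.
  rewrite -fmorphV /=; case: (inner x y) => u v; rewrite /abs2 /=.
  by field.
move=> h; rewrite -subr_ge0.
have -> : sqn x * sqn y - abs2 (inner x y) =
  sqn y * (sqn x + abs2 (inner x y) / sqn y ^+ 2 * sqn y +
     2 * - (abs2 (inner x y) / sqn y)) by field.
by rewrite mulr_ge0// sqn_ge0.
Qed.

Lemma norm_ltC x (e : R) : 0 < e -> (`|x| < e%:C) = (sqn x < e ^+ 2).
Proof.
move=> e0; rewrite normE ltcR -{1}(ger0_norm (ltW e0)) -sqrtr_sqr ltr_sqrt//.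
by rewrite exprn_gt0.
Qed.

(** Balls have radii in R[i]; a positive radius is real, and real squared norms
   describe the same neighbourhoods. *)
Lemma closureP (A : set V) x :
  closure A x <-> forall e : R, 0 < e -> exists2 y, A y & sqn (x - y) < e.
Proof.
split=> [clA e e0|h].
  have := clA (ball x (Num.sqrt e)%:C).
  case.
    by apply: nbhsx_ballx; rewrite -[0]/(0%:C) ltcR sqrtr_gt0.
  move=> y [Ay]; rewrite -ball_normE /= norm_ltC ?sqrtr_gt0// sqr_sqrtr ?ltW// => xy.
  by exists y.
move=> B /nbhs_ballP[[e e'] /=]; rewrite ltcE /= => /andP[/eqP -> e0] hB.
have [y Ay xy] := h (e ^+ 2) ltac:(by rewrite exprn_gt0).
by exists y; split => //; apply: hB; rewrite -ball_normE /= norm_ltC.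
Qed.

Lemma closure_pairP (S : set (V * V)) (p : V * V) :
  closure S p <-> forall e, 0 < e ->
    exists2 q, S q & sqn (p.1 - q.1) < e /\ sqn (p.2 - q.2) < e.
Proof.
have nb x e : 0 < e -> nbhs x [set y | sqn (x - y) < e].
  move=> e0; apply/nbhs_ballP; exists (Num.sqrt e)%:C.
    by rewrite /= -[0]/(0%:C) ltcR sqrtr_gt0.
  by move=> y; rewrite -ball_normE /= norm_ltC ?sqrtr_gt0// sqr_sqrtr ?ltW.
split=> [clS e e0|h B].
  have [q [Sq [q1 q2]]] := clS ([set y | sqn (p.1 - y) < e] `*` [set y | sqn (p.2 - y) < e])
    ltac:(exists ([set y | sqn (p.1 - y) < e], [set y | sqn (p.2 - y) < e]) => //;
      split; exact: nb).
  by exists q.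
move=> [[B1 B2] /= [/nbhs_ballP[[e1 e1'] /=]]].
rewrite ltcE /= => /andP[/eqP -> e10] hB1 /nbhs_ballP[[e2 e2'] /=].
rewrite ltcE /= => /andP[/eqP -> e20] hB2 hB.
have m0 : 0 < Num.min (e1 ^+ 2) (e2 ^+ 2) by rewrite lt_min !exprn_gt0.
have [q Sq []] := h _ m0; rewrite !lt_min => /andP[q1 _] /andP[_ q2].
exists q; split => //; apply: hB; split.
  by apply: hB1; rewrite -ball_normE /= norm_ltC.
by apply: hB2; rewrite -ball_normE /= norm_ltC.
Qed.

Lemma norm_le_sqn x y (M : R) : 0 <= M ->
  (`|x| <= M%:C * `|y|) = (sqn x <= M ^+ 2 * sqn y).
Proof.
move=> M0; rewrite !normE -rmorphM lecR -{1}(ger0_norm M0) -sqrtr_sqr.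
by rewrite -sqrtrM ?sqr_ge0// ler_sqrt// mulr_ge0 ?sqr_ge0 ?sqn_ge0.
Qed.

Lemma cvg_sqn (u : nat -> V) (l : V) :
  sqn (l - u n) @[n --> \oo] --> (0 : R) -> u @ \oo --> l.
Proof.
move=> h; apply/cvgrPdist_lt => -[e e'].
rewrite ltcE /= => /andP[/eqP -> e0].
have h' : \forall n \near \oo, sqn (l - u n) < e ^+ 2.
  by move/cvgr_lt : h; apply; rewrite exprn_gt0.
by apply: filterS h' => n; rewrite norm_ltC.
Qed.

End pre_hilbert.

(** Polarization: the real part of the inner product is determined by squared
   norms, the imaginary part is a real part after multiplication by i. *)
Lemma isometry_inner (R : realType) (V W : preHilbertType R) (f : V -> W) :
  linear f -> (forall x, sqn (f x) = sqn x) ->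
  forall x y, inner (f x) (f y) = inner x y.
Proof.
move=> lf sf.
have fD x y : f (x + y) = f x + f y by have := lf 1 x y; rewrite !scale1r.
have f0 : f 0 = 0 by apply: (addIr (f 0)); rewrite -fD !add0r.
have fZ a x : f (a *: x) = a *: f x by rewrite -[a *: x]addr0 lf f0 addr0.
have re x y : complex.Re (inner (f x) (f y)) = complex.Re (inner x y).
  have := sf (x + y); rewrite fD !sqnD !sf => h; lra.
move=> x y; apply/eqP; rewrite eq_complex re eqxx /=; apply/eqP.
have := re x ('i%C *: y); rewrite fZ !innerZr.
by case: (inner x y) => u v; case: (inner (f x) (f y)) => s t /=; lra.
Qed.

Lemma lin_span_linear (R : realType) (V : preHilbertType R) (e : nat -> V)
    (a : R[i]) (x y : V) : lin_span e x -> lin_span e y -> lin_span e (a *: x + y).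
Proof.
have pad (N M : nat) (c : nat -> R[i]) : (N <= M)%N ->
    \sum_(n < N) c n *: e n = \sum_(n < M) (if (n < N)%N then c n else 0) *: e n.
  move=> NM; rewrite (big_ord_widen M (fun n => c n *: e n))// big_mkcond.
  by apply: eq_bigr => i _; case: ifP; rewrite ?scale0r.
move=> [N [c ->]] [M [b ->]].
rewrite (pad _ _ _ (leq_maxl N M)) (pad _ _ _ (leq_maxr N M)).
rewrite scaler_sumr -big_split /=; exists (maxn N M).
eexists (fun n => a * (if (n < N)%N then c n else 0) + (if (n < M)%N then b n else 0)).
by apply: eq_bigr => i _; rewrite scalerA -scalerDl.
Qed.

(** * Orthonormal bases and unitary maps *)

(** Completeness: every Cauchy sequence has a subsequence that satisfies this bound,
   and the bound makes the increments summable. *)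
Definition fast_complete (R : realType) (V : preHilbertType R) :=
  forall u : nat -> V, (forall k, sqn (u k.+1 - u k) <= (4 ^+ k)^-1) ->
  exists v, sqn (u k - v) @[k --> \oo] --> (0 : R).

Section orthonormal_bases.
Context {R : realType} {V : preHilbertType R}.
Variable P : nat -> V.
Hypothesis bP : orthonormal_basis P.
Implicit Types (v w : V) (c : nat -> R[i]).

Let oP m n : inner (P m) (P n) = (m == n)%:R. Proof. by have [+ _] := bP; apply. Qed.

Definition coef v n : R[i] := inner v (P n).
Definition partial c N : V := \sum_(n < N) c n *: P n.

Lemma coef_partial c N n : coef (partial c N) n = if (n < N)%N then c n else 0.
Proof.
rewrite /coef /partial inner_suml; case: ltnP => nN.
  rewrite (bigD1 (Ordinal nN))//= innerZl oP eqxx mulr1 big1 ?addr0// => i.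
  by rewrite -val_eqE /= innerZl oP => /negPf ->; rewrite mulr0.
apply: big1 => i _; rewrite innerZl oP ltn_eqF ?mulr0//.
exact: leq_trans (ltn_ord i) nN.
Qed.

(** Pythagoras: the Fourier sum is the best approximation of v by combinations of
   the first N basis vectors. *)
Lemma sqn_subr_partial v c N : sqn (v - partial c N) =
  sqn v - \sum_(n < N) abs2 (coef v n) + \sum_(n < N) abs2 (coef v n - c n).
Proof.
elim: N => [|N ih]; first by rewrite /partial !big_ord0 !subr0 addr0.
have -> : v - partial c N.+1 = (v - partial c N) - c N *: P N.
  by rewrite /partial big_ord_recr /= opprD addrA.
have sP : sqn (P N) = 1 by rewrite /sqn oP eqxx.
rewrite sqnD sqnN sqnZ sP ih !big_ord_recr /= innerNr innerZr.
have -> : inner (v - partial c N) (P N) = coef v N.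
  by rewrite innerBl -/(coef (partial c N) N) coef_partial ltnn subr0.
have -> : abs2 (coef v N - c N) = abs2 (coef v N) + abs2 (c N) +
    2 * complex.Re (- ((c N)^* * coef v N)).
  by rewrite /abs2; case: (coef v N) (c N) => ? ? [] /= ? ?; ring.
ring.
Qed.

Lemma sqn_partial c N : sqn (partial c N) = \sum_(n < N) abs2 (c n).
Proof.
rewrite -sqnN -sub0r sqn_subr_partial sqn0.
have -> : \sum_(n < N) abs2 (coef 0 n) = 0.
  by apply: big1 => i _; rewrite /coef inner0l /abs2 /= expr0n addr0.
rewrite subrr add0r; apply: eq_bigr => i _; rewrite /coef inner0l sub0r.
by rewrite /abs2; case: (c i) => a b /=; rewrite !sqrrN.
Qed.

Lemma sqn_partialB c a b : (a <= b)%N -> sqn (partial c b - partial c a) =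
  series (fun n => abs2 (c n)) b - series (fun n => abs2 (c n)) a.
Proof.
move=> ab; have -> : partial c b - partial c a =
    partial (fun n => if (a <= n)%N then c n else 0) b.
  rewrite /partial -(subnKC ab) !big_split_ord /=.
  rewrite [LHS]addrC addKr [X in _ = X + _]big1 ?add0r.
    by apply: eq_bigr => i _; rewrite leq_addr.
  by move=> i _; rewrite leqNgt ltn_ord /= scale0r.
rewrite sqn_partial /series /= -(subnKC ab) !big_mkord !big_split_ord /=.
rewrite [RHS]addrC addKr big1 ?add0r.
  by apply: eq_bigr => i _; rewrite leq_addr.
by move=> i _; rewrite leqNgt ltn_ord /= /abs2 /= expr0n addr0.
Qed.

Lemma sqn_subr_partial_coef v N :
  sqn (v - partial (coef v) N) = sqn v - \sum_(n < N) abs2 (coef v n).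
Proof.
rewrite sqn_subr_partial [X in _ + X = _]big1 ?addr0// => i _.
by rewrite subrr /abs2 /= expr0n addr0.
Qed.

(** Some combination of the basis vectors is close to v, and the Fourier sums of at
   least that length are closer. *)
Lemma cvg_partial_coef v : sqn (v - partial (coef v) N) @[N --> \oo] --> (0 : R).
Proof.
apply/cvgrPdist_lt => e e0.
have : closure (lin_span P) v by have [_ ->] := bP.
move=> /closureP/(_ _ e0)[_ [N [c ->]]] hN.
exists N => // n /= Nn; rewrite sub0r normrN ger0_norm ?sqn_ge0//.
apply: le_lt_trans hN; rewrite sqn_subr_partial_coef [leRHS]sqn_subr_partial.
rewrite -(subnKC Nn) big_split_ord /= opprD addrA lerD2l.
rewrite (@le_trans _ _ 0)//.
  by rewrite oppr_le0; apply: sumr_ge0 => i _; exact: abs2_ge0.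
by apply: sumr_ge0 => i _; exact: abs2_ge0.
Qed.

Lemma cvg_series_coef v : series (fun n => abs2 (coef v n)) @ \oo --> sqn v.
Proof.
have h := cvgB (cvg_cst (sqn v)) (cvg_partial_coef v); rewrite subr0 in h.
have -> : series (fun n => abs2 (coef v n)) = fun N => sqn v - sqn (v - partial (coef v) N).
  by apply/funext => N; rewrite sqn_subr_partial_coef subKr /series /= big_mkord.
exact: h.
Qed.

Lemma coef_in_l2 v : coef v \in @l2seq R.
Proof. by apply/asboolP/cvg_ex; exists (sqn v); exact: cvg_series_coef. Qed.

Definition coef_l2 v : l2 R := MkL2 (coef_in_l2 v).

Lemma coef_l2_linear : linear coef_l2.
Proof.
by move=> a v w; apply/val_inj/funext => n /=; rewrite /coef innerDl innerZl.
Qed.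

Lemma sqn_coef_l2 v : sqn (coef_l2 v) = sqn v.
Proof.
rewrite {1}/sqn [inner _ _](l2_inner_self (coef_l2 v)) /=.
by apply/cvg_lim => //; exact: cvg_series_coef.
Qed.

Lemma coef_l2_inner v w : inner (coef_l2 v) (coef_l2 w) = inner v w.
Proof. exact: (isometry_inner coef_l2_linear sqn_coef_l2). Qed.

Lemma coef_l2_inj : injective coef_l2.
Proof.
move=> v w vw; apply/eqP; rewrite -subr_eq0; apply/eqP/sqn_eq0.
rewrite -sqn_coef_l2 (_ : coef_l2 (v - w) = 0) ?sqn0//.
by rewrite addrC -scaleN1r coef_l2_linear scaleN1r vw addNr.
Qed.

Lemma coef_l2_basis n : coef_l2 (P n) = l2_basis n.
Proof. by apply/val_inj/funext => m /=; rewrite /coef oP eq_sym. Qed.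

Hypothesis cV : fast_complete V.

(** The tails of the sum of the |x_n|^2 tend to 0, so a subsequence of the partial
   sums of the x_n P_n has increments as small as fast_complete asks. Inner products
   are continuous, hence the limit has coefficients x. *)
Lemma coef_l2_surj (x : l2 R) : exists v, coef_l2 v = x.
Proof.
pose s := series (fun n => abs2 (x n)).
have cs : cvgn s by exact: l2P.
have nds : nondecreasing_seq s.
  apply/nondecreasing_seqP => n; rewrite /s /series /= big_nat_recr //=.
  by rewrite lerDl abs2_ge0.
have tail k : exists N, forall n, (N <= n)%N -> s n - s N <= (4 ^+ k)^-1.
  have [N _ /(_ _ (leqnn N)) /= hN] : \forall N \near \oo, `|limn s - s N| < (4 ^+ k)^-1.
    by move/cvgrPdist_lt : cs; apply; rewrite invr_gt0 exprn_gt0.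
  exists N => n Nn; rewrite (le_trans _ (ltW hN))// (le_trans _ (ler_norm _))//.
  by rewrite lerD2r nondecreasing_cvgn_le.
pose N k := sval (cid (tail k)).
(* a nondecreasing sequence of indices beyond both N k and k *)
pose M k := (\sum_(i < k.+1) N i + k)%N.
have NM k : (N k <= M k)%N by rewrite /M big_ord_recr /= addnAC leq_addl.
have MS k : (M k <= M k.+1)%N.
  by rewrite /M [in leqRHS]big_ord_recr /= addnS ltnW// ltnS leq_add2r leq_addr.
have kM k : (k <= M k)%N by rewrite /M leq_addl.
pose u k := partial x (M k).
have du k : sqn (u k.+1 - u k) <= (4 ^+ k)^-1.
  rewrite sqn_partialB//.
  apply: le_trans (svalP (cid (tail k)) (M k.+1) (leq_trans (NM k) (MS k))).
  by rewrite lerD2l lerN2; apply: nds; exact: NM.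
have [v uv] := cV du; exists v; apply/val_inj/funext => n /=.
apply/eqP; rewrite -subr_eq0; apply/eqP/abs2_eq0/eqP.
rewrite eq_le abs2_ge0 andbT; apply: (cvgr_to_ge uv).
exists n.+1 => // k /= nk.
have -> : coef v n - x n = inner (v - u k) (P n).
  rewrite innerBl -/(coef v n) -/(coef (u k) n) coef_partial.
  by rewrite (leq_trans nk (kM k)).
rewrite sqnB; apply: le_trans (cauchy_schwarz _ _) _.
by rewrite {2}/sqn oP eqxx mulr1.
Qed.

(** The inverse of the coefficient map. It is unique because the coefficients of
   U' x are the inner products of U' x with the U' e_n, that is, those of x with
   the e_n. *)
Lemma exists_unitary : exists U : l2 R -> V,
  [/\ unitary U, forall n, U (l2_basis n) = P n,
      forall U', unitary U' -> (forall n, U' (l2_basis n) = P n) -> U' = U &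
      cancel U coef_l2 /\ cancel coef_l2 U].
Proof.
pose U x := sval (cid (coef_l2_surj x)).
have UK x : coef_l2 (U x) = x by exact: svalP (cid (coef_l2_surj x)).
have KU v : U (coef_l2 v) = v by apply: coef_l2_inj; rewrite UK.
exists U; split => //.
- split.
  + by move=> a x y; apply: coef_l2_inj; rewrite coef_l2_linear !UK.
  + by move=> x y; rewrite -coef_l2_inner !UK.
  + by move=> z; exists (coef_l2 z).
- by move=> n; rewrite -coef_l2_basis KU.
- move=> U' [_ U'i _] U'e; apply/funext => x; apply: coef_l2_inj; rewrite UK.
  apply/val_inj/funext => n /=; rewrite /coef -U'e U'i.
  by rewrite -{1}(UK x) -coef_l2_basis coef_l2_inner -{2}(UK x).
Qed.

End orthonormal_bases.

(** * The space L2 *)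

Section L2_facts.
Context d (T : measurableType d) (R : realType).
Variable mu : {measure set T -> \bar R}.
Implicit Types (f g : T -> R[i]) (u v : L2 mu).

Lemma abs2M (z w : R[i]) : abs2 (z * w) = abs2 z * abs2 w.
Proof. by rewrite /abs2; case: z w => a b [c e] /=; ring. Qed.

Lemma abs2J (z : R[i]) : abs2 z^* = abs2 z.
Proof. by rewrite /abs2; case: z => a b /=; rewrite sqrrN. Qed.

Lemma abs2_real (r : R) : abs2 r%:C = r ^+ 2.
Proof. by rewrite /abs2 /= expr0n addr0. Qed.

Lemma measurable_complex_real (f : T -> R) :
  measurable_fun setT f -> measurable_complex (fun t => (f t)%:C).
Proof. by move=> mf; split => //; exact: measurable_cst. Qed.

Lemma ae_eqW f g : f =1 g -> f = g %[ae mu].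
Proof. by move=> fg; apply: aeW => t _. Qed.

Lemma ae_and (P Q : T -> Prop) : (\forall t \ae mu, P t) ->
  (\forall t \ae mu, Q t) -> \forall t \ae mu, P t /\ Q t.
Proof. by move=> hP hQ; apply: filterS2 hP hQ => t. Qed.

Lemma L2_square_integrable u : square_integrable mu u.
Proof. exact: (L2preP (repr u)). Qed.

Lemma square_integrable_in f : square_integrable mu f -> f \in L2fun mu.
Proof. by move=> sf; apply/asboolP. Qed.

Definition L2_class f (sf : square_integrable mu f) : L2 mu :=
  \pi_(L2 mu)%qT (MkL2pre (square_integrable_in sf)).

Lemma L2_classE f (sf : square_integrable mu f) :
  L2_to_fun (L2_class sf) = f %[ae mu].
Proof. exact: L2_repr. Qed.

Lemma L2_ext u v : (u : T -> R[i]) = v %[ae mu] -> u = v.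
Proof. by move=> uv; rewrite -[u]reprK -[v]reprK; apply/L2_eqP. Qed.

Lemma L2_subE u v : L2_to_fun (u - v) = (fun t => u t - v t) %[ae mu].
Proof.
have := L2_linearE (-1) v u; rewrite scaleN1r addrC.
by apply: filterS => t /= h I; rewrite h// mulN1r addrC.
Qed.

Lemma ae_eq_Rintegral (f g : T -> R) : measurable_fun setT f ->
  measurable_fun setT g -> f = g %[ae mu] -> \int[mu]_t f t = \int[mu]_t g t.
Proof.
move=> mf mg fg; rewrite /Rintegral; congr fine; apply: ae_eq_integral => //.
- exact/measurable_EFinP.
- exact/measurable_EFinP.
- by apply: filterS fg => t /= h _; rewrite h.
Qed.

Lemma sqn_L2 u : sqn u = \int[mu]_t abs2 (u t).
Proof. by rewrite /sqn [inner u u]L2_inner_self. Qed.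

Lemma sqn_L2_ae u f : measurable_complex f -> L2_to_fun u = f %[ae mu] ->
  sqn u = \int[mu]_t abs2 (f t).
Proof.
move=> mf uf; rewrite sqn_L2; apply: ae_eq_Rintegral.
- exact: measurable_abs2 (L2_square_integrable u).1.
- exact: measurable_abs2.
- by apply: filterS uf => t /= h I; rewrite h.
Qed.

Lemma integral_abs2_L2 u : (\int[mu]_t (abs2 (u t))%:E = (sqn u)%:E)%E.
Proof.
rewrite sqn_L2 /Rintegral fineK//; apply: integrable_fin_num => //.
exact: integrable_abs2 (L2_square_integrable u).
Qed.

Lemma L2_inner_ae u v f g : measurable_complex f -> measurable_complex g ->
  L2_to_fun u = f %[ae mu] -> L2_to_fun v = g %[ae mu] ->
  inner u v = (\int[mu]_t complex.Re (f t * (g t)^*)) +i*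
              (\int[mu]_t complex.Im (f t * (g t)^*)).
Proof.
move=> mf mg uf vg.
have mfg := measurable_complexM mf (measurable_complexJ mg).
have muv := measurable_complexM (L2_square_integrable u).1
  (measurable_complexJ (L2_square_integrable v).1).
have uvE : (fun t => u t * (v t)^*) = (fun t => f t * (g t)^*) %[ae mu].
  by apply: filterS2 uf vg => t /= h1 h2 I; rewrite h1 ?h2.
rewrite [inner u v]/(L2_inner u v); congr (_ +i* _); apply: ae_eq_Rintegral.
- exact: muv.1.
- exact: mfg.1.
- by apply: filterS uvE => t /= h I; rewrite h.
- exact: muv.2.
- exact: mfg.2.
- by apply: filterS uvE => t /= h I; rewrite h.
Qed.

Lemma measurable_complexB f g : measurable_complex f -> measurable_complex g ->
  measurable_complex (fun t => f t - g t).
Proof.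
move=> mf mg; have := measurable_complexM (measurable_complex_cst (-1)) mg.
move=> /(measurable_complexD mf).
by congr measurable_complex; apply/funext => t; rewrite mulN1r.
Qed.

Lemma square_integrable_le f (g : T -> R) : measurable_complex f ->
  (forall t, abs2 (f t) <= g t) -> (\int[mu]_t (g t)%:E < +oo)%E ->
  measurable_fun setT g -> square_integrable mu f.
Proof.
move=> mf fg ig mg; split => //; apply: le_lt_trans ig.
apply: ge0_le_integral => //.
- by move=> t _; rewrite lee_fin abs2_ge0.
- exact/measurable_EFinP/measurable_abs2.
- exact/measurable_EFinP.
- by move=> t _; rewrite lee_fin.
Qed.

(** Real and imaginary parts converge separately, by riesz_fischer. *)
Lemma L2_fast_complete : fast_complete (L2 mu).
Proof.
change (forall u : nat -> L2 mu, (forall k, sqn (u k.+1 - u k) <= (4 ^+ k)^-1) ->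
  exists v : L2 mu, sqn (u k - v) @[k --> \oo] --> (0 : R)) => u hu.
pose a k t := complex.Re (u k t); pose b k t := complex.Im (u k t).
have mu_ k : measurable_complex (u k) by exact: (L2_square_integrable (u k)).1.
have abE k t : abs2 (u k.+1 t - u k t) = (a k.+1 t - a k t) ^+ 2 + (b k.+1 t - b k t) ^+ 2.
  by rewrite /abs2 /a /b; case: (u k.+1 t) (u k t) => ? ? [].
have iD k : (\int[mu]_t (abs2 (u k.+1 t - u k t))%:E <= ((4 ^+ k)^-1)%:E)%E.
  apply: le_trans (_ : (sqn (u k.+1 - u k))%:E <= _)%E; last by rewrite lee_fin.
  rewrite -integral_abs2_L2 le_eqVlt; apply/orP; left; apply/eqP.
  apply: ae_eq_integral => //.
  - by apply/measurable_EFinP/measurable_abs2; exact: measurable_complexB.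
  - by apply/measurable_EFinP/measurable_abs2; exact: (L2_square_integrable _).1.
  - by apply: filterS (L2_subE (u k.+1) (u k)) => t /= h I; rewrite h.
have le2 (x : nat -> T -> R) : (forall k, measurable_fun setT (x k)) ->
    (forall k t, (x k.+1 t - x k t) ^+ 2 <= abs2 (u k.+1 t - u k t)) -> forall k,
    (\int[mu]_t ((x k.+1 t - x k t) ^+ 2)%:E <= ((4 ^+ k)^-1)%:E)%E.
  move=> mx xu k; apply: le_trans (iD k); apply: ge0_le_integral => //.
  - by move=> t _; rewrite lee_fin sqr_ge0.
  - by apply/measurable_EFinP; apply: measurable_funX; exact: measurable_funB.
  - by apply/measurable_EFinP/measurable_abs2; exact: measurable_complexB.
  - by move=> t _; rewrite lee_fin.
have ma k : measurable_fun setT (a k) by exact: (mu_ k).1.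
have mb k : measurable_fun setT (b k) by exact: (mu_ k).2.
have [g mg cg] := riesz_fischer ma (le2 a ma (fun k t => ltac:(by rewrite abE lerDl sqr_ge0))).
have [h mh ch] := riesz_fischer mb (le2 b mb (fun k t => ltac:(by rewrite abE lerDr sqr_ge0))).
pose w t : R[i] := g t +i* h t.
have mw : measurable_complex w by [].
have abw k t : abs2 (u k t - w t) = (a k t - g t) ^+ 2 + (b k t - h t) ^+ 2.
  by rewrite /abs2 /a /b /w; case: (u k t).
have cw : (\int[mu]_t (abs2 (u k t - w t))%:E)%E @[k --> \oo] --> 0%E.
  have cgh := @cvgeD _ _ _ _ _ _ _ _ (isT : 0 +? 0)%E cg ch; rewrite adde0 in cgh.
  suff -> : (fun k => \int[mu]_t (abs2 (u k t - w t))%:E)%E =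
      (fun k => \int[mu]_t ((a k t - g t) ^+ 2)%:E + \int[mu]_t ((b k t - h t) ^+ 2)%:E)%E.
    exact: cgh.
  apply/funext => k; rewrite -ge0_integralD//.
  - by apply: eq_integral => t _; rewrite abw EFinD.
  - by move=> t _; rewrite lee_fin sqr_ge0.
  - by apply/measurable_EFinP; apply: measurable_funX; exact: measurable_funB.
  - by move=> t _; rewrite lee_fin sqr_ge0.
  - by apply/measurable_EFinP; apply: measurable_funX; exact: measurable_funB.
(* w differs from some u K by a square-integrable function *)
have sw : square_integrable mu w.
  have /fine_cvgP[[K _ fK] _] := cw.
  have sK : square_integrable mu (fun t => u K t - w t).
    split; first exact: measurable_complexB.
    have := fK K (leqnn K); rewrite /= ge0_fin_numE//.
    by apply: integral_ge0 => t _; rewrite lee_fin abs2_ge0.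
  have /asboolP h1 : L2fun mu (fun t => u K t) by apply/asboolP; exact: L2_square_integrable.
  have := (L2fun_submod mu).2 (-1) _ _ (square_integrable_in sK) (square_integrable_in h1).
  move=> /asboolP; congr square_integrable; apply/funext => t.
  by rewrite !fctE /= scaleN1r opprB subrK.
exists (L2_class sw); have /fine_cvgP[_ cw'] := cw.
suff -> : (fun k => sqn (u k - L2_class sw)) = fine \o
    (fun k => \int[mu]_t (abs2 (u k t - w t))%:E)%E.
  exact: cw'.
apply/funext => k; apply: sqn_L2_ae; first exact: measurable_complexB.
apply: filterS2 (L2_subE (u k) (L2_class sw)) (L2_classE sw) => t /= h1 h2 I.
by rewrite h1// h2.
Qed.

End L2_facts.

(** * The Hermite basis *)

Section hermite_basis.
Context {R : realType}.
Implicit Types (p q : {poly R}) (x : R).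
Local Notation HP := hermite_poly.
Local Notation mu := (hermite_measure R).
Local Notation V := (L2 mu).

Lemma integrable_horner p : mu.-integrable setT (fun x => (p.[x])%:E).
Proof.
have := @integrable_hermite_gauss R 0 p ltac:(by rewrite oppr_lt0).
by apply: eq_integrable => // x _; rewrite oppr0 mul0r expR0 mulr1.
Qed.

Lemma square_integrable_horner p : square_integrable mu (fun x => (p.[x])%:C).
Proof.
split; first by apply: measurable_complex_real; exact: measurable_horner.
have /integrableP[_] := integrable_horner (p ^+ 2); apply: le_lt_trans.
rewrite le_eqVlt; apply/orP; left; apply/eqP; apply: eq_integral => x _.
by rewrite abs2_real /= horner_exp ger0_norm ?sqr_ge0.
Qed.

Definition poly_class p : V := L2_class (square_integrable_horner p).

Lemma poly_classE p : L2_to_fun (poly_class p) = (fun x => (p.[x])%:C) %[ae mu].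
Proof. exact: L2_classE. Qed.

Lemma poly_class_linear (a : R) p q :
  poly_class (a *: p + q) = a%:C *: poly_class p + poly_class q.
Proof.
apply: L2_ext.
have := (ae_and (ae_and (poly_classE (a *: p + q)) (poly_classE p))
  (ae_and (poly_classE q) (L2_linearE a%:C (poly_class p) (poly_class q)))).
move=> H; apply: filterS H => x /= [[h1 h2] [h3 h4]] I.
by rewrite h1// h4// h2// h3// hornerD hornerZ rmorphD rmorphM.
Qed.

Definition hermite_vec n : V := poly_class (hermite_norm n *: HP n).

Lemma hermite_vecE n :
  L2_to_fun (hermite_vec n) = (fun x => (hermite_hat n x)%:C) %[ae mu].
Proof.
have := poly_classE (hermite_norm n *: HP n).
by apply: filterS => x /= h I; rewrite h// hermite_hatE.
Qed.

Lemma measurable_hermite_hat n : measurable_fun setT (@hermite_hat R n).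
Proof.
rewrite (_ : hermite_hat n = horner (hermite_norm n *: HP n)); first exact: measurable_horner.
by apply/funext => x; exact: hermite_hatE.
Qed.

Lemma hermite_vec_orthonormal m n : inner (hermite_vec m) (hermite_vec n) = (m == n)%:R.
Proof.
have mc k : measurable_complex (fun t : measurableTypeR R => (hermite_hat k t)%:C).
  by apply: measurable_complex_real; exact: measurable_hermite_hat.
rewrite (L2_inner_ae (mc m) (mc n) (hermite_vecE m) (hermite_vecE n)).
have E x : (hermite_hat m x)%:C * ((hermite_hat n x)%:C)^* =
    (hermite_hat m x * hermite_hat n x)%:C :> R[i].
  by rewrite -[_^*]/((hermite_hat n x) +i* - 0) oppr0 -rmorphM.
under eq_Rintegral do rewrite E /=.
rewrite hermite_hat_orthonormal.
under eq_Rintegral do rewrite E /=.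
by rewrite /Rintegral /= integral0; case: eqP.
Qed.

(** Since x H_n = H_(n+1)/2 + n H_(n-1), the span of the Hermite polynomials is
   stable under multiplication by X; it contains H_0 = 1. *)
Lemma hermite_span p : lin_span hermite_vec (poly_class p).
Proof.
have S0 : lin_span hermite_vec 0 by exists 0%N, (fun=> 0); rewrite big_ord0.
have SE n : lin_span hermite_vec (hermite_vec n).
  exists n.+1, (fun k => (k == n)%:R); rewrite big_ord_recr /= eqxx scale1r.
  by rewrite big1 ?add0r// => i _; rewrite ltn_eqF// scale0r.
have SD a q r : lin_span hermite_vec (poly_class q) ->
    lin_span hermite_vec (poly_class r) -> lin_span hermite_vec (poly_class (a *: q + r)).
  by rewrite poly_class_linear; exact: lin_span_linear.
have P0 : poly_class 0 = 0.
  have := poly_class_linear (-1) 0 0; rewrite scaler0 add0r rmorphN rmorph1.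
  by rewrite scaleN1r addNr.
have SZ a q : lin_span hermite_vec (poly_class q) -> lin_span hermite_vec (poly_class (a *: q)).
  by rewrite -[a *: q]addr0 => hq; apply: SD => //; rewrite P0.
have SHP n : lin_span hermite_vec (poly_class (HP n)).
  have h0 : hermite_norm n != 0 :> R.
    rewrite /hermite_norm invr_eq0 sqrtr_eq0 -ltNge ltr0n.
    by rewrite muln_gt0 expn_gt0 fact_gt0.
  by have := SZ (hermite_norm n)^-1 _ (SE n); rewrite scalerA mulVf// scale1r.
have XH n : 'X * HP n = 2^-1 *: HP n.+1 + n%:R *: HP n.-1 :> {poly R}.
  rewrite hermite_polyS deriv_hermite_poly scalerBr !scalerA mulVf// scale1r mulKf//.
  by rewrite subrK.
have SX k n : lin_span hermite_vec (poly_class ('X^k * HP n)).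
  elim: k n => [|k ih] n; first by rewrite expr0 mul1r.
  rewrite exprSr -mulrA XH mulrDr -!scalerAr; apply: SD => //; exact: SZ.
rewrite -[p]coefK poly_def; elim/big_ind : _ => [|q r hq hr|i _].
- by rewrite P0.
- by rewrite -[q]scale1r; exact: SD.
- by apply: SZ; have := SX i 0%N; rewrite hermite_poly0 mulr1.
Qed.

(** Completeness: the real and imaginary parts of v are approximated by
   polynomials, and polynomials are combinations of Hermite polynomials. *)
Lemma hermite_vec_basis : orthonormal_basis hermite_vec.
Proof.
split; first exact: hermite_vec_orthonormal.
apply/seteqP; split => // v _; apply/closureP => e e0.
have [[mre mim] _] := L2_square_integrable (v : V).
have iv : mu.-integrable setT (fun x => (abs2 (L2_to_fun v x))%:E).
  exact: integrable_abs2 (L2_square_integrable v).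
have sq (f : R -> R) : measurable_fun setT f -> (forall x, f x ^+ 2 <= abs2 (L2_to_fun v x)) ->
    mu.-integrable setT (fun x => (f x ^+ 2)%:E).
  move=> mf fv; apply: le_integrable iv => //.
    by apply/measurable_EFinP; exact: measurable_funX.
  by move=> x _; rewrite lee_fin !ger0_norm ?sqr_ge0 ?abs2_ge0.
have e2 : 0 < e / 2 by rewrite divr_gt0.
have [_ /(_ _ e2)[p hp]] := poly_dense mre (sq _ mre (fun x => ltac:(by rewrite lerDl sqr_ge0))).
have [_ /(_ _ e2)[q hq]] := poly_dense mim (sq _ mim (fun x => ltac:(by rewrite lerDr sqr_ge0))).
exists ('i%C *: poly_class q + poly_class p).
  by apply: lin_span_linear; exact: hermite_span.
have mp : measurable_complex (fun x => (p.[x] +i* q.[x] : R[i])).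
  by split; exact: measurable_horner.
have E : L2_to_fun (v - ('i%C *: poly_class q + poly_class p)) =
    (fun x => L2_to_fun v x - (p.[x] +i* q.[x])) %[ae mu].
  have := ae_and (ae_and (poly_classE p) (poly_classE q))
    (ae_and (L2_subE v ('i%C *: poly_class q + poly_class p))
      (L2_linearE 'i%C (poly_class q) (poly_class p))).
  move=> H; apply: filterS H => x /= [[h1 h2] [h3 h4]] I.
  rewrite h3// h4// h1// h2//; congr (_ - _).
  by rewrite [RHS]complexE /= addrC.
rewrite -lte_fin -integral_abs2_L2.
have -> : (\int[mu]_x (abs2 (L2_to_fun (v - ('i%C *: poly_class q + poly_class p)) x))%:E =
   sqdist (fun x => complex.Re (L2_to_fun v x)) (horner p) +
   sqdist (fun x => complex.Im (L2_to_fun v x)) (horner q))%E.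
  rewrite /sqdist -ge0_integralD//=.
  - apply: ae_eq_integral => //.
    + by apply/measurable_EFinP/measurable_abs2; exact: (L2_square_integrable _).1.
    + apply/measurable_EFinP; apply: measurable_funD; apply: measurable_funX;
      apply: measurable_funB => //; exact: measurable_horner.
    + apply: filterS E => x /= h I; rewrite h// -EFinD; congr EFin.
      by rewrite /abs2; case: (L2_to_fun v x).
  - by move=> x _; rewrite lee_fin sqr_ge0.
  - by apply/measurable_EFinP; apply: measurable_funX; apply: measurable_funB => //;
      exact: measurable_horner.
  - by move=> x _; rewrite lee_fin sqr_ge0.
  - by apply/measurable_EFinP; apply: measurable_funX; apply: measurable_funB => //;
      exact: measurable_horner.
by rewrite (splitr e) EFinD; apply: lteD.
Qed.

End hermite_basis.

(** * Multiplication operators *)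

Section multiplication_operators.
Context d (T : measurableType d) (R : realType).
Variable mu : {measure set T -> \bar R}.
Implicit Types (f g phi psi : T -> R[i]) (u v w : L2 mu).

Definition bounded_symbol phi :=
  measurable_complex phi /\ exists M : R, forall t, abs2 (phi t) <= M.

Lemma bounded_symbol_integrable phi : bounded_symbol phi -> forall v,
  square_integrable mu (fun t => phi t * v t).
Proof.
move=> [mphi [M hM]] v; have [mv iv] := L2_square_integrable v.
have M0 : 0 <= `|M| by [].
apply: (@square_integrable_le _ _ _ mu _ (fun t => `|M| * abs2 (v t))).
- exact: measurable_complexM.
- move=> t; rewrite abs2M ler_wpM2r ?abs2_ge0//.
  by rewrite (le_trans (hM t))// ler_norm.
- under eq_integral do rewrite EFinM.
  rewrite ge0_integralZl//.
  + by rewrite lte_mul_pinfty.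
  + exact/measurable_EFinP/measurable_abs2.
  + by move=> t _; rewrite lee_fin abs2_ge0.
- by apply: measurable_funM => //; exact: measurable_abs2.
Qed.

(** For a bounded symbol the product with any class is square-integrable, so that
   multiplication is a total function on classes. *)
Definition mulop phi (b : bounded_symbol phi) v : L2 mu :=
  L2_class (bounded_symbol_integrable b v).

Lemma mulopE phi (b : bounded_symbol phi) v :
  L2_to_fun (mulop b v) = (fun t => phi t * v t) %[ae mu].
Proof. exact: L2_classE. Qed.

Lemma mulop_linear phi (b : bounded_symbol phi) : linear (mulop b).
Proof.
move=> a u v; apply: L2_ext.
have H := ae_and (ae_and (mulopE b (a *: u + v)) (L2_linearE a u v))
  (ae_and (L2_linearE a (mulop b u) (mulop b v)) (ae_and (mulopE b u) (mulopE b v))).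
apply: filterS H => t /= [[h1 h2] [h3 [h4 h5]]] I.
by rewrite h1// h2// h3// h4// h5// mulrDr mulrCA.
Qed.

Lemma sqn_mulop phi (b : bounded_symbol phi) v :
  sqn (mulop b v) = \int[mu]_t (abs2 (phi t) * abs2 (v t)).
Proof.
rewrite (sqn_L2_ae _ (mulopE b v)); last first.
  by apply: measurable_complexM; [exact: b.1|exact: (L2_square_integrable v).1].
by apply: eq_Rintegral => t _; rewrite abs2M.
Qed.

Lemma integrable_symbol_abs2 (f : T -> R) (M : R) v : measurable_fun setT f ->
  (forall t, `|f t| <= M) -> mu.-integrable setT (fun t => (f t * abs2 (v t))%:E).
Proof.
move=> mf fM.
have iv := integrableZl measurableT M (integrable_abs2 (L2_square_integrable v)).
apply: le_integrable iv => //.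
  apply/measurable_EFinP/measurable_funM => //.
  exact: measurable_abs2 (L2_square_integrable v).1.
move=> t _ /=; rewrite lee_fin !normrM [`|abs2 _|]ger0_norm ?abs2_ge0//.
by rewrite ler_wpM2r ?abs2_ge0// (le_trans (fM t))// ler_norm.
Qed.

Lemma sqn_mulop_le phi (b : bounded_symbol phi) (M : R) v :
  (forall t, abs2 (phi t) <= M) -> sqn (mulop b v) <= M * sqn v.
Proof.
move=> hM; rewrite sqn_mulop sqn_L2 -RintegralZl//; last first.
  exact: integrable_abs2 (L2_square_integrable v).
apply: le_Rintegral => //.
- apply: (@integrable_symbol_abs2 _ M) => [|t].
    exact: measurable_abs2 b.1.
  by rewrite ger0_norm ?abs2_ge0.
- apply: (@integrable_symbol_abs2 _ `|M|) => //.
- by move=> t _; rewrite ler_wpM2r ?abs2_ge0.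
Qed.

Lemma mulop_comp phi psi chi (b : bounded_symbol phi) (c : bounded_symbol psi)
    (e : bounded_symbol chi) v : (forall t, phi t * psi t = chi t) ->
  mulop b (mulop c v) = mulop e v.
Proof.
move=> E; apply: L2_ext.
have H := ae_and (mulopE b (mulop c v)) (ae_and (mulopE c v) (mulopE e v)).
apply: filterS H => t /= [h1 [h2 h3]] I.
by rewrite h1// h2// h3// mulrA E.
Qed.

Lemma mulop_id phi (b : bounded_symbol phi) v : (forall t, phi t = 1) -> mulop b v = v.
Proof.
by move=> E; apply: L2_ext; apply: filterS (mulopE b v) => t /= h I; rewrite h// E mul1r.
Qed.

Lemma mulop_eq phi psi (b : bounded_symbol phi) (c : bounded_symbol psi) v :
  phi =1 psi -> mulop b v = mulop c v.
Proof.
move=> E; apply: L2_ext; apply: filterS2 (mulopE b v) (mulopE c v) => t /= h h' I.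
by rewrite h// h'// E.
Qed.

Lemma mulopD phi psi chi (b : bounded_symbol phi) (c : bounded_symbol psi)
    (e : bounded_symbol chi) (a : R[i]) v : (forall t, phi t + a * psi t = chi t) ->
  mulop b v + a *: mulop c v = mulop e v.
Proof.
move=> E; apply: L2_ext; rewrite addrC.
have H := ae_and (L2_linearE a (mulop c v) (mulop b v))
  (ae_and (mulopE b v) (ae_and (mulopE c v) (mulopE e v))).
apply: filterS H => t /= [h0 [h1 [h2 h3]]] I.
by rewrite h0// h1// h2// h3// -E mulrDl mulrA addrC.
Qed.

Lemma mulop_sym phi (b : bounded_symbol phi) v w : (forall t, (phi t)^* = phi t) ->
  inner (mulop b v) w = inner v (mulop b w).
Proof.
move=> E; have mv := (L2_square_integrable v).1; have mw := (L2_square_integrable w).1.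
have aev : L2_to_fun v = (fun t => v t) %[ae mu] by exact: ae_eqW.
have aew : L2_to_fun w = (fun t => w t) %[ae mu] by exact: ae_eqW.
rewrite (L2_inner_ae (measurable_complexM b.1 mv) mw (mulopE b v) aew).
rewrite (L2_inner_ae mv (measurable_complexM b.1 mw) aev (mulopE b w)).
by congr (_ +i* _); apply: eq_Rintegral => t _; rewrite rmorphM /= E mulrCA mulrA.
Qed.

(** Quadratic forms of multiplication operators: the density of the spectral
   measures comes from here. *)
Lemma mulop_real_inner (f : T -> R) (b : bounded_symbol (fun t => (f t)%:C)) v :
  inner (mulop b v) v = (\int[mu]_t (f t * abs2 (v t)))%:C.
Proof.
have mv := (L2_square_integrable v).1.
have aev : L2_to_fun v = (fun t => v t) %[ae mu] by exact: ae_eqW.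
rewrite (L2_inner_ae (measurable_complexM b.1 mv) mv (mulopE b v) aev).
congr (_ +i* _).
  by apply: eq_Rintegral => t _; rewrite -mulrA -abs2E -rmorphM.
under eq_Rintegral do rewrite -mulrA -abs2E -rmorphM /=.
by rewrite /Rintegral /= integral0.
Qed.

Lemma bounded_symbol_real (f : T -> R) (M : R) : measurable_fun setT f ->
  (forall t, `|f t| <= M) -> bounded_symbol (fun t => (f t)%:C).
Proof.
move=> mf fM; split; first exact: measurable_complex_real.
exists (M ^+ 2) => t; rewrite abs2_real -real_normK ?num_real//.
by rewrite ler_pXn2r ?nnegrE// (le_trans _ (fM t)).
Qed.

Lemma mult_opP (f : T -> R) (b : bounded_symbol (fun t => (f t)%:C)) (p : L2 mu * L2 mu) :
  mult_op mu f p <-> p.2 = mulop b p.1.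
Proof.
case: p => p1 p2 /=; split=> [h|->]; last exact: mulopE.
by apply: L2_ext; apply: filterS2 h (mulopE b p1) => t /= h1 h2 I; rewrite h1// h2.
Qed.

End multiplication_operators.

(** * Bounded symmetric operators and their graphs *)

Section bounded_symmetric_operators.
Context {R : realType} {V : preHilbertType R}.
Implicit Types (x y z : V) (l : R[i]) (t e : R).

Variables (A : V -> V) (c : R).
Hypotheses (linA : linear A) (symA : forall x y, inner (A x) y = inner x (A y)).
Hypotheses (c0 : 0 < c) (bndA : forall x, sqn (A x) <= c ^+ 2 * sqn x).

Definition graph_of : set (V * V) := [set p | p.2 = A p.1].

Lemma graph_ofE x y : graph_of (x, y) = (y = A x). Proof. by []. Qed.

Let AB x y : A (x - y) = A x - A y.
Proof. by rewrite addrC -scaleN1r linA scaleN1r addrC. Qed.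

Lemma graph_domain : op_domain graph_of = setT.
Proof. by apply/seteqP; split => // x _; exists (A x). Qed.

Lemma graph_self_adjoint : self_adjoint graph_of.
Proof.
split; first by rewrite graph_domain closureT.
apply/seteqP; split => -[x y] /=.
  (* the adjoint relation tested on y - A x says that its squared norm is 0 *)
  move=> h; apply/eqP; rewrite -subr_eq0; apply/eqP/sqn_eq0.
  have := h (y - A x, A (y - A x)) erefl; rewrite /= symA => e.
  by rewrite {1}/sqn innerBr e subrr.
by rewrite graph_ofE => yE [u v]; rewrite graph_ofE /= => ->; rewrite yE symA.
Qed.

Lemma graph_bounded : bounded_operator graph_of.
Proof.
split; first exact: graph_domain.
by exists c => -[x y]; rewrite graph_ofE /= => ->; rewrite norm_le_sqn ?(ltW c0).
Qed.

(** The graph of a bounded operator is closed; conversely a point (x, A x) of it is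
   approached by (u, A u) when u in D approaches x. *)
Lemma closure_graph_dense (D : set V) : closure D = setT ->
  closure [set p | D p.1 /\ graph_of p] = graph_of.
Proof.
move=> dD; apply/seteqP; split => -[x y].
  move=> /closure_pairP h; rewrite graph_ofE.
  apply/eqP; rewrite -subr_eq0; apply/eqP/sqn_eq0/eqP.
  rewrite eq_le sqn_ge0 andbT; apply/ler_addgt0Pl => e e0; rewrite addr0.
  pose M := 2 + 2 * c ^+ 2; have M0 : 0 < M by rewrite /M; have := sqr_ge0 c; lra.
  have [[u v] [_]] := h (e / M) ltac:(by rewrite divr_gt0).
  rewrite graph_ofE /= => -> [h1 h2].
  have -> : y - A x = (y - A u) + A (u - x) by rewrite AB addrA subrK.
  apply: (le_trans (sqnD_le _ _)); have := bndA (u - x); rewrite sqnB => h3.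
  have -> : e = 2 * (e / M) + 2 * (c ^+ 2 * (e / M)).
    by rewrite /M; field; rewrite gt_eqF.
  apply: lerD; rewrite ler_pM2l// ?(ltW h2)//.
  by apply: (le_trans h3); rewrite ler_wpM2l ?sqr_ge0// ltW.
rewrite graph_ofE => yE; apply/closure_pairP => e e0 /=; rewrite yE.
pose M := 1 + c ^+ 2; have M0 : 0 < M by rewrite /M; have := sqr_ge0 c; lra.
have /closureP/(_ (e / M) ltac:(by rewrite divr_gt0))[u Du xu] : closure D x by rewrite dD.
have Me : e / M <= e by rewrite ler_pdivrMr// ler_peMr ?(ltW e0)// lerDl sqr_ge0.
exists (u, A u); first by [].
split; first exact: lt_le_trans Me.
rewrite /= -AB (le_lt_trans (bndA _))//.
apply: (@lt_le_trans _ _ (M * (e / M))); last by rewrite mulrCA mulfV ?mulr1// gt_eqF.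
apply: (@le_lt_trans _ _ (M * sqn (x - u))); last by rewrite ltr_pM2l.
by rewrite ler_wpM2r ?sqn_ge0// lerDr.
Qed.

Definition approx_eigenvalue t := forall e, 0 < e ->
  exists2 x, 0 < sqn x & sqn (A x - t%:C *: x) <= e * sqn x.

(** A bounded inverse of A - t would bound |x| by a multiple of |(A - t) x|. *)
Lemma approx_eigenvalue_spectrum t : approx_eigenvalue t -> spectrum graph_of t%:C.
Proof.
move=> ht [S [h1 h2 [M hM]]].
pose K := `|M| + 1; have K0 : 0 < K by rewrite ltr_wpDl.
have K20 : 0 < K ^+ 2 by rewrite exprn_gt0.
have [x x0 hx] := ht (2 * K ^+ 2)^-1 ltac:(by rewrite invr_gt0 mulr_gt0).
have := hM (A x - t%:C *: x) I; rewrite (h2 (x, A x) erefl I I) /= => hle.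
have : `|x| <= K%:C * `|A x - t%:C *: x|.
  apply: (le_trans hle); rewrite ler_wpM2r// lecR (le_trans (ler_norm _))//.
  by rewrite lerDl.
rewrite norm_le_sqn ?(ltW K0)// => hK.
have : sqn x <= K ^+ 2 * ((2 * K ^+ 2)^-1 * sqn x).
  by apply: (le_trans hK); rewrite ler_pM2l.
have -> : K ^+ 2 * ((2 * K ^+ 2)^-1 * sqn x) = sqn x / 2 by field; rewrite gt_eqF.
lra.
Qed.

Lemma resolvent_not_spectrum l (S : V -> V) (M : R) : 0 <= M ->
  (forall y, A (S y) - l *: S y = y) -> (forall x, S (A x - l *: x) = x) ->
  (forall y, sqn (S y) <= M ^+ 2 * sqn y) -> ~ spectrum graph_of l.
Proof.
move=> M0 h1 h2 h3; apply; exists S; split.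
- move=> y _; split => //; rewrite graph_ofE.
  by rewrite -{1}(h1 y) subrK.
- by move=> [x y]; rewrite graph_ofE /= => -> _ _.
- by exists M => y _; rewrite norm_le_sqn.
Qed.

(** Normalized approximate eigenvectors for c are mapped to vectors of norm close
   to c. *)
Lemma op_norm_graph : approx_eigenvalue c -> op_norm graph_of = c%:E.
Proof.
move=> hc; apply/eqP; rewrite eq_le; apply/andP; split.
  apply: ge_ereal_sup => _ [[x y] [+ x1] <-]; rewrite graph_ofE /= in x1 * => ->.
  rewrite lee_fin normE /=.
  have sx : sqn x <= 1.
    by move: x1; rewrite normE -[1]/(1%:C) lecR -[leRHS]sqrtr1 ler_sqrt.
  rewrite -[leRHS](ger0_norm (ltW c0)) -[leRHS]sqrtr_sqr ler_sqrt ?sqr_ge0//.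
  by apply: (le_trans (bndA _)); rewrite ler_piMr ?sqr_ge0.
apply/lee_addgt0Pr => e e0.
have [x x0 hx] := hc (e ^+ 2) ltac:(by rewrite exprn_gt0).
pose y := ((Num.sqrt (sqn x))^-1)%:C *: x.
have sx : Num.sqrt (sqn x) != 0 by rewrite gt_eqF// sqrtr_gt0.
have ny : `|y| = 1.
  rewrite normrZ normE normc_def /= expr0n addr0 sqrtr_sqr ger0_norm ?invr_ge0 ?sqrtr_ge0//.
  by rewrite -rmorphM mulVf.
have Ay : A y - c%:C *: y = ((Num.sqrt (sqn x))^-1)%:C *: (A x - c%:C *: x).
  rewrite scalerBr /y; congr (_ - _); last by rewrite !scalerA mulrC.
  have A0 : A 0 = 0.
    by apply: (addIr (A 0)); rewrite -{1}(scale1r (A 0)) -linA scale1r addr0 add0r.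
  by rewrite -[_ *: x]addr0 linA A0 addr0.
have nAy : `|A y - c%:C *: y| <= e%:C.
  rewrite Ay normrZ normc_def /= expr0n addr0 sqrtr_sqr ger0_norm ?invr_ge0 ?sqrtr_ge0//.
  rewrite -(ler_pM2l (_ : 0 < (Num.sqrt (sqn x))%:C)); last first.
    by rewrite -[0]/(0%:C) ltcR sqrtr_gt0.
  rewrite mulrA -rmorphM mulfV// mul1r mulrC -normE norm_le_sqn ?(ltW e0)//.
have cy : (c%:C : R[i]) <= `|A y| + e%:C.
  have -> : (c%:C : R[i]) = `|c%:C *: y|.
    by rewrite normrZ ny mulr1 normc_def /= expr0n addr0 sqrtr_sqr ger0_norm ?ltW.
  have -> : c%:C *: y = A y - (A y - c%:C *: y) by rewrite subKr.
  by rewrite (le_trans (ler_normB _ _))// lerD2l.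
apply: (@le_trans _ _ ((complex.Re `|A y|)%:E + e%:E)%E).
  by rewrite -EFinD lee_fin; move: cy; rewrite normE -rmorphD lecR.
rewrite leeD2r//; apply: ereal_sup_ubound; exists (y, A y) => //.
by split => //=; rewrite ny.
Qed.

End bounded_symmetric_operators.

(** * Multiplication by the Gaussian *)

Section hermite_operator.
Context {R : realType}.
Implicit Types (x t : R) (l : R[i]).
Local Notation mu := (hermite_measure R).
Local Notation leb := (@lebesgue_measure R).
Local Notation V := (L2 mu).
Local Notation top := (Num.sqrt (2 * pi) : R).

Lemma sqrt2pi_gt0 : 0 < top.
Proof. by rewrite sqrtr_gt0 mulr_gt0 ?pi_gt0. Qed.

Lemma mult_fun_gt0 x : 0 < mult_fun x.
Proof. by rewrite mulr_gt0 ?expR_gt0 ?sqrt2pi_gt0. Qed.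

Lemma mult_fun_le x : mult_fun x <= top.
Proof.
by rewrite /mult_fun ler_piMr ?(ltW sqrt2pi_gt0)// -expR0 ler_expR oppr_le0 sqr_ge0.
Qed.

Lemma continuous_mult_fun : continuous (@mult_fun R).
Proof.
move=> x; have := @continuous_horner_gauss R (top%:P) 1 x.
rewrite (_ : (fun x => _) = mult_fun)//.
by apply/funext => y; rewrite hornerC mulN1r.
Qed.

Lemma measurable_mult_fun : measurable_fun setT (@mult_fun R).
Proof. exact: continuous_measurable_fun continuous_mult_fun. Qed.

Lemma mult_fun_bounded : bounded_symbol (fun t : measurableTypeR R => (mult_fun t)%:C).
Proof.
apply: (bounded_symbol_real measurable_mult_fun) => t.
rewrite ger0_norm ?(ltW (mult_fun_gt0 t))//; exact: mult_fun_le.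
Qed.

Definition mult_vec (v : V) : V := mulop mult_fun_bounded v.

Lemma mult_vec_sym v w : inner (mult_vec v) w = inner v (mult_vec w).
Proof.
apply: mulop_sym => t.
by rewrite -[_^*]/((mult_fun t) +i* - 0) oppr0.
Qed.

Lemma mult_vec_bound v : sqn (mult_vec v) <= top ^+ 2 * sqn v.
Proof.
apply: sqn_mulop_le => t.
rewrite abs2_real ler_pXn2r ?nnegrE ?(ltW sqrt2pi_gt0) ?(ltW (mult_fun_gt0 t))//.
exact: mult_fun_le.
Qed.

(** The values of mult_fun are the points of ]0, top], as solving for x by a
   logarithm shows, and these accumulate at 0. *)
Lemma mult_fun_dense t e : 0 <= t <= top -> 0 < e -> exists x, `|mult_fun x - t| < e.
Proof.
move=> /andP[t0 tc] e0.
have surj s : 0 < s <= top -> exists x, mult_fun x = s.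
  move=> /andP[s0 sc]; exists (Num.sqrt (- ln (s / top))).
  rewrite /mult_fun sqr_sqrtr ?opprK ?lnK ?posrE ?divr_gt0 ?sqrt2pi_gt0//.
    by rewrite mulrCA mulfV ?mulr1// gt_eqF ?sqrt2pi_gt0.
  by rewrite oppr_ge0 ln_le0// ler_pdivrMr ?sqrt2pi_gt0// mul1r.
have [->|tn0] := eqVneq t 0.
  have [x hx] := surj (Num.min (e / 2) top)
    ltac:(by rewrite lt_min divr_gt0 ?sqrt2pi_gt0// ge_min lexx orbT).
  exists x; rewrite hx subr0 ger0_norm; last first.
    by rewrite le_min (ltW sqrt2pi_gt0) divr_ge0// ltW.
  by rewrite gt_min ltr_pdivrMr// ltr_pMr// ltr1n.
have [x hx] := surj t ltac:(by rewrite lt_def tn0 t0 tc).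
by exists x; rewrite hx subrr normr0.
Qed.

(** The distance from l to [0, top] bounds |mult_fun - l|: it is at least |Im l|, and
   for real l it is - l or l - top. *)
Lemma mult_fun_away l : ~ (exists2 t, 0 <= t <= top & l = t%:C) ->
  exists2 d, 0 < d & forall s : R, d <= abs2 ((mult_fun s)%:C - l).
Proof.
case: l => a b h.
have E s : abs2 ((mult_fun s)%:C - (a +i* b)) = (mult_fun s - a) ^+ 2 + b ^+ 2.
  by rewrite /abs2 /= sub0r sqrrN.
have [b0|b0] := eqVneq b 0; last first.
  by exists (b ^+ 2); rewrite ?exprn_even_gt0// => s; rewrite E lerDr sqr_ge0.
have [a0|a0] := ltP a 0.
  exists (a ^+ 2); first by rewrite exprn_even_gt0//= lt_eqF.
  move=> s; rewrite E b0 expr0n addr0 -[leLHS]sqrrN.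
  have := mult_fun_gt0 s; set u := mult_fun s => u0.
  by rewrite ler_pXn2r ?nnegrE //; lra.
have [ac|ac] := ltP top a; last by exfalso; apply: h; exists a; rewrite ?a0// b0.
exists ((a - top) ^+ 2); first by rewrite exprn_even_gt0//= gt_eqF// subr_gt0.
move=> s; rewrite E b0 expr0n addr0 -[leRHS]sqrrN opprB.
have := mult_fun_le s; set u := mult_fun s; set c := top in ac * => uc.
by rewrite ler_pXn2r ?nnegrE //; lra.
Qed.

(** The density is positive, so that a mu-null set is Lebesgue-null. *)
Lemma hermite_measure_gt0 (B : set (measurableTypeR R)) : measurable B ->
  (0 < leb B)%E -> (0 < mu B)%E.
Proof.
move=> mB; rewrite !lt0e => /andP[B0 _]; apply/andP; split; last exact: measure_ge0.
apply: contra_neq B0 => /= muB.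
have md : measurable_fun B (fun x : measurableTypeR R => (hermite_density x)%:E).
  by apply/measurable_EFinP/measurable_funTS; exact: measurable_hermite_density.
have /(ae_eq_integral_abs leb mB md)[N [mN N0 BN]] :
    (\int[leb]_(x in B) `|(hermite_density x)%:E| = 0)%E.
  rewrite -[RHS]muB; apply: eq_integral => x _.
  by rewrite gee0_abs// lee_fin hermite_density_ge0.
apply/eqP; rewrite -measure_le0 -N0; apply: le_measure; rewrite ?inE//.
move=> x Bx; apply: BN => /= /(_ Bx)[] /eqP; rewrite gt_eqF//.
by rewrite mulr_gt0 ?expR_gt0// invr_gt0 sqrtr_gt0 pi_gt0.
Qed.

Lemma hermite_measure_open (B : set R) x : open B -> B x ->
  (0 < mu (B : set (measurableTypeR R)))%E.
Proof.
move=> oB Bx; apply: hermite_measure_gt0; first exact: open_measurable.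
have /nbhs_ballP[e /= e0 he] := open_nbhs_nbhs (conj oB Bx).
apply: (@lt_le_trans _ _ (leb (ball x e))).
  by rewrite lebesgue_measure_ball ?(ltW e0)// lte_fin mulrn_wgt0.
apply: le_measure => //; rewrite ?inE; first exact: measurable_ball.
exact: open_measurable.
Qed.

Lemma square_integrable_indic (B : set (measurableTypeR R)) : measurable B ->
  square_integrable mu (fun x => (\1_B x)%:C).
Proof.
move=> mB; apply: (@square_integrable_le _ (measurableTypeR R) R mu _
  (fun x : measurableTypeR R => (1 : {poly R}).[x])).
- by apply: measurable_complex_real.
- by move=> x; rewrite abs2_real hornerE indicE; case: (x \in B); rewrite ?expr1n ?expr0n.
- have /integrableP[_] := integrable_horner (1 : {poly R}).
  apply: le_lt_trans; rewrite le_eqVlt; apply/orP; left; apply/eqP.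
  by apply: eq_integral => x _; rewrite /= hornerE normr1.
- exact: measurable_horner.
Qed.

(** The indicator of B = (|mult_fun - t| < sqrt e) satisfies
   |(mult_fun - t) 1_B|^2 <= e |1_B|^2 pointwise. It is not zero in L^2, since B is
   open and nonempty. *)
Lemma mult_vec_approx t : 0 <= t <= top -> approx_eigenvalue mult_vec t.
Proof.
move=> tc e e0; pose s := Num.sqrt e; have s0 : 0 < s by rewrite sqrtr_gt0.
have [x0 hx0] := mult_fun_dense tc s0.
pose B : set R := [set x | `|mult_fun x - t| < s].
have oB : open B.
  apply: (@open_comp _ _ (fun x => `|mult_fun x - t|) [set y | y < s]) => [x _|];
    last exact: open_lt.
  by apply: cvg_norm; apply: cvgB; [exact: continuous_mult_fun|exact: cvg_cst].
have mB : measurable (B : set (measurableTypeR R)) by exact: open_measurable.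
have B0 := hermite_measure_open oB hx0.
pose v := L2_class (square_integrable_indic mB).
have vE := L2_classE (square_integrable_indic mB).
have mi : measurable_complex (fun x : measurableTypeR R => (\1_B x)%:C : R[i]).
  by apply: measurable_complex_real.
have sv : (sqn v)%:E = mu B.
  rewrite -integral_abs2_L2.
  transitivity (\int[mu]_x (\1_B x)%:E)%E; last by rewrite integral_indic// setIT.
  apply: ae_eq_integral => //.
  - by apply/measurable_EFinP/measurable_abs2; exact: (L2_square_integrable _).1.
  - exact/measurable_EFinP.
  - apply: filterS vE => x /= h I; rewrite h// abs2_real indicE.
    by case: (x \in B); rewrite ?expr1n ?expr0n.
exists v; first by rewrite -lte_fin sv.
have Tv : L2_to_fun (mult_vec v - t%:C *: v) =
    (fun x => (mult_fun x - t)%:C * (\1_B x)%:C) %[ae mu].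
  have H := ae_and (ae_and (L2_linearE (- t%:C) v (mult_vec v)) vE) (mulopE mult_fun_bounded v).
  apply: filterS H => x /= [[h1 h2] h3] I.
  rewrite -scaleNr addrC h1// h3// h2// rmorphB mulrBl mulNr addrC //.
rewrite (sqn_L2_ae _ Tv); last first.
  apply: measurable_complexM => //; apply: measurable_complex_real.
  by apply: measurable_funB => //; exact: measurable_mult_fun.
have -> : e * sqn v = \int[mu]_x (e * abs2 ((\1_B x)%:C : R[i])).
  rewrite (sqn_L2_ae mi vE) RintegralZl//.
  exact: integrable_abs2 (square_integrable_indic mB).
have ib := integrable_abs2 (square_integrable_indic mB).
have pt x : abs2 ((mult_fun x - t)%:C * (\1_B x)%:C : R[i]) <= e * abs2 ((\1_B x)%:C : R[i]).
  rewrite abs2M !abs2_real indicE; case: (boolP (x \in B)) => [|_]; last first.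
    by rewrite expr0n !mulr0.
  rewrite inE /B /= => xB; rewrite expr1n !mulr1 -real_normK ?num_real//.
  by rewrite -(sqr_sqrtr (ltW e0)) ler_pXn2r ?nnegrE ?(ltW s0)// ltW.
have ie : mu.-integrable setT (EFin \o (fun x => e * abs2 ((\1_B x)%:C : R[i]))).
  exact: (integrableZl measurableT e ib).
apply: le_Rintegral => //.
apply: le_integrable ie => //.
  apply/measurable_EFinP/measurable_abs2; apply: measurable_complexM => //.
  apply: measurable_complex_real.
  by apply: measurable_funB => //; exact: measurable_mult_fun.
move=> x _ /=; rewrite lee_fin !ger0_norm ?abs2_ge0//.
by rewrite mulr_ge0 ?abs2_ge0// ltW.
Qed.

End hermite_operator.

(** * The operator of the matrix *)

Section hermite_matrix_operator.
Context {R : realType}.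
Implicit Types (t : R) (l : R[i]).
Local Notation mu := (hermite_measure R).
Local Notation V := (L2 mu).
Local Notation top := (Num.sqrt (2 * pi) : R).
Local Notation P := (@hermite_vec R).
Local Notation C := (coef_l2 (@hermite_vec_basis R)).
Variable U : l2 R -> V.
Hypotheses (unitU : unitary U) (UK : cancel U C) (CK : cancel C U).
Implicit Types x y : l2 R.

(** C is the inverse of U, so this is the conjugate by U of multiplication by
   mult_fun. *)
Definition hermite_op x : l2 R := C (mult_vec (U x)).
Local Notation A := hermite_op.
Local Notation H := (graph_of A).

Let C_lin : linear C. Proof. exact: coef_l2_linear. Qed.

Let CB v w : C (v - w) = C v - C w.
Proof. by rewrite addrC -scaleN1r C_lin scaleN1r addrC. Qed.

Let C0 : C 0 = 0. Proof. by rewrite -[0](subrr 0) CB subrr. Qed.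

Let CZ (a : R[i]) v : C (a *: v) = a *: C v.
Proof. by rewrite -[a *: v]addr0 C_lin C0 addr0. Qed.

Let inner_CU v x : inner (C v) x = inner v (U x).
Proof. by rewrite -{1}(UK x) coef_l2_inner. Qed.

Let sqnU x : sqn (U x) = sqn x.
Proof. by rewrite -[in RHS](UK x) sqn_coef_l2. Qed.

Lemma hermite_op_linear : linear A.
Proof.
have [linU _ _] := unitU.
by move=> a x y; rewrite /A linU /mult_vec mulop_linear C_lin.
Qed.

Lemma hermite_op_sym x y : inner (A x) y = inner x (A y).
Proof.
by rewrite inner_CU mult_vec_sym [RHS]inner_conj inner_CU -inner_conj.
Qed.

Lemma hermite_op_bound x : sqn (A x) <= top ^+ 2 * sqn x.
Proof. by rewrite sqn_coef_l2 -[in leRHS]sqnU mult_vec_bound. Qed.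

Lemma hermite_op_approx t : 0 <= t <= top -> approx_eigenvalue A t.
Proof.
move=> /mult_vec_approx ht e e0; have [v v0 hv] := ht e e0.
by exists (C v); rewrite sqn_coef_l2// /A CK -CZ -CB sqn_coef_l2.
Qed.

Lemma coef_mult_vec m n : coef P (mult_vec (P m)) n = (H3 m n)%:C.
Proof.
have mh k : measurable_complex (fun x : measurableTypeR R => (hermite_hat k x)%:C).
  by apply: measurable_complex_real; exact: measurable_hermite_hat.
have mE : L2_to_fun (mult_vec (P m)) =
    (fun s => (mult_fun s * hermite_hat m s)%:C) %[ae mu].
  apply: filterS2 (mulopE (@mult_fun_bounded R) (P m)) (hermite_vecE m) => x /= h1 h2 I.
  by rewrite [LHS]h1// h2// -rmorphM.
have mm : measurable_complex (fun x : measurableTypeR R => (mult_fun x * hermite_hat m x)%:C).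
  apply: measurable_complex_real; apply: measurable_funM; first exact: measurable_mult_fun.
  exact: measurable_hermite_hat.
rewrite /coef (L2_inner_ae mm (mh n) mE (hermite_vecE n)) H3E.
have E (x : R) : (mult_fun x * hermite_hat m x)%:C * ((hermite_hat n x)%:C)^* =
    (mult_fun x * hermite_hat m x * hermite_hat n x)%:C :> R[i].
  by rewrite -[_^*]/((hermite_hat n x) +i* - 0) oppr0 -rmorphM.
under eq_Rintegral do rewrite E /=.
congr (_ +i* _).
under eq_Rintegral do rewrite E /=.
by rewrite /Rintegral /= integral0.
Qed.

Lemma H3_sym m n : H3 m n = H3 n m :> R.
Proof. by rewrite !H3E; apply: eq_Rintegral => s _; rewrite mulrAC. Qed.

(** The m-th coordinate of A x is the inner product of A x with e_m, by symmetry
   that of x with A e_m, whose coordinates are the m-th row of the matrix; an inner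
   product of sequences is the sum of a convergent series. *)
Lemma hermite_op_cvg x m :
  series (fun n => (H3 m n)%:C * x n) @ \oo --> (A x m : R[i]).
Proof.
have -> : (A x m : R[i]) = inner x (C (mult_vec (P m))).
  rewrite -[LHS]/(inner (mult_vec (U x)) (P m)) mult_vec_sym.
  by rewrite -{2}(UK x) coef_l2_inner.
rewrite [inner _ _]/(l2_inner x _) /l2_inner.
have -> : (fun n => (H3 m n)%:C * x n) = (fun n => x n * (C (mult_vec (P m)) n)^*).
  apply/funext => n; rewrite mulrC; congr (_ * _).
  by rewrite [C _ n]coef_mult_vec -[_^*]/((H3 m n) +i* - 0) oppr0.
exact: is_cvg_l2_inner.
Qed.

Lemma matrix_op_maxE : matrix_op_max H3 = H.
Proof.
apply/seteqP; split => -[x y]; last first.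
  by rewrite graph_ofE => -> m; exact: hermite_op_cvg.
move=> h; rewrite graph_ofE; apply/val_inj/funext => m /=.
exact: (cvg_unique (@norm_hausdorff _ R[i]) (h m) (@hermite_op_cvg x m)).
Qed.

Lemma l2_basis_dense : closure (lin_span (@l2_basis R)) = setT.
Proof.
apply/seteqP; split => // x _; apply/closureP => e e0.
have [N [c hc]] : exists N (c : nat -> R[i]), sqn (U x - \sum_(n < N) c n *: P n) < e.
  have [_ clP] := @hermite_vec_basis R.
  have : closure (lin_span P) (U x) by rewrite clP.
  by move=> /closureP/(_ _ e0)[_ [N [c ->]]] h; exists N, c.
exists (\sum_(n < N) c n *: l2_basis n); first by exists N, c.
rewrite -{1}(UK x) (_ : \sum_(n < N) _ = C (\sum_(n < N) c n *: P n)).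
  by rewrite -CB sqn_coef_l2.
elim: N {hc} => [|N ih]; first by rewrite !big_ord0 C0.
by rewrite !big_ord_recr /= ih addrC [in RHS]addrC C_lin coef_l2_basis.
Qed.

(** The formal matrix product is A on all of l^2, so the maximal operator is A; the
   minimal one is the closure of the restriction of A to a dense subspace. *)
Lemma hermite_op_determined : determines_operator H3 H.
Proof.
split.
- exact: H3_sym.
- move=> n; have /asboolP := coef_in_l2 (@hermite_vec_basis R) (mult_vec (P n)).
  congr square_summable; apply/funext => m.
  by rewrite coef_mult_vec H3_sym.
- rewrite /matrix_op_min matrix_op_maxE.
  exact: (closure_graph_dense hermite_op_linear hermite_op_bound l2_basis_dense).
- exact: matrix_op_maxE.
Qed.

Lemma hermite_op_conj : op_conj U H = mult_op mu mult_fun.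
Proof.
apply/seteqP; split => [_ [[x y] yE <-]|[v w] /(mult_opP mult_fun_bounded) /= ->].
  apply/(mult_opP mult_fun_bounded); move: yE; rewrite graph_ofE /= => ->.
  by rewrite CK.
exists (C v, C (mult_vec v)); first by rewrite graph_ofE /A CK.
by rewrite /= !CK.
Qed.

(** Off the interval, multiplication by the bounded function 1/(mult_fun - l) is a
   two-sided inverse; on it there are approximate eigenvectors. *)
Lemma hermite_op_spectrum : spectrum H = [set t%:C | t in `[0, top]].
Proof.
apply/seteqP; split => [l lH|_ [t tc <-]]; last first.
  apply: (approx_eigenvalue_spectrum); apply: hermite_op_approx.
  by move: tc => /=; rewrite ?in_itv.
apply: contrapT => nl.
have [d d0 hd] : exists2 d, 0 < d & forall s : R, d <= abs2 ((mult_fun s)%:C - l).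
  by apply: mult_fun_away => -[t tc lE]; apply: nl; exists t.
pose z (s : measurableTypeR R) := (mult_fun s)%:C - l.
have z0 s : 0 < abs2 (z s) by exact: lt_le_trans (hd s).
(* 1/z, as the conjugate of z over its squared modulus *)
pose r (s : measurableTypeR R) : R[i] := ((abs2 (z s)) `^ (-1))%:C * (z s)^*.
have abs2r s : abs2 (r s) = (abs2 (z s))^-1.
  rewrite /r abs2M abs2_real abs2J powR_inv1 ?(ltW (z0 s))//.
  by field; rewrite gt_eqF.
have mz : measurable_complex z.
  apply: measurable_complexB; last exact: measurable_complex_cst.
  by apply: measurable_complex_real; exact: measurable_mult_fun.
have br : bounded_symbol r.
  split.
    apply: measurable_complexM; last exact: measurable_complexJ.
    apply: measurable_complex_real.
    apply: (measurableT_comp (measurable_powR _)); exact: measurable_abs2.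
  by exists d^-1 => s; rewrite abs2r lef_pV2 ?posrE//; exact: hd.
have rz s : r s * z s = 1.
  rewrite /r -mulrA [_^* * _]mulrC -abs2E -rmorphM powR_inv1 ?(ltW (z0 s))//.
  by rewrite mulVf// gt_eqF.
have b1 : bounded_symbol (fun _ : measurableTypeR R => (1 : R[i])).
  by split; [exact: measurable_complex_cst|exists (abs2 (1 : R[i]))].
have bz : bounded_symbol z.
  split=> //; exists (2 * abs2 (1 : R[i]) * top ^+ 2 + 2 * abs2 (- l)) => s.
  rewrite /z -[(mult_fun s)%:C]mul1r (le_trans (abs2D _ _ _))// lerD2r ler_wpM2l//.
    by rewrite mulr_ge0 ?abs2_ge0.
  rewrite abs2_real ler_pXn2r ?nnegrE ?(ltW sqrt2pi_gt0) ?(ltW (mult_fun_gt0 s))//.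
  exact: mult_fun_le.
have zE v : mult_vec v - l *: v = mulop bz v.
  rewrite -scaleNr -[v in _ *: v](@mulop_id _ _ _ mu _ b1)//.
  by apply: mulopD => s; rewrite mulr1.
pose S y := C (mulop br (U y)).
apply: (@resolvent_not_spectrum _ _ A l S (Num.sqrt d^-1)) lH => //.
- move=> y; rewrite /A /S CK -CZ -CB zE (mulop_comp bz br b1) ?mulop_id// => s.
  by rewrite mulrC rz.
- move=> x; have [v ->] : exists v, x = C v by exists (U x); rewrite UK.
  by rewrite /S /A CK -CZ -CB CK zE (mulop_comp br bz b1) ?mulop_id.
- move=> y; rewrite sqn_coef_l2 -[in leRHS]sqnU sqr_sqrtr ?invr_ge0 ?(ltW d0)//.
  by apply: sqn_mulop_le => s; rewrite abs2r lef_pV2 ?posrE//; exact: hd.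
Qed.

End hermite_matrix_operator.

(** * Preimages of null sets *)

Section null_preimages.
Context {R : realType}.
Local Notation leb := (@lebesgue_measure R).
Local Notation mR := (measurableTypeR R).

Lemma interval_length_le (I : set R) (p q : R) : measurable (I : set mR) ->
  is_interval I -> I p -> I q -> (`|p - q|%:E <= leb I)%E.
Proof.
move=> mI itvI; wlog pq : p q / p <= q => [hw|] Ip Iq.
  by have [pq|/ltW qp] := leP p q; [exact: hw|rewrite distrC; exact: hw].
have -> : `|p - q|%:E = leb `[p, q]%classic.
  rewrite lebesgue_measure_itv /= lte_fin; case: ltP => [pq'|qp].
    by rewrite ler0_norm ?subr_le0// opprB EFinB.
  by rewrite (le_anti (introT andP (conj pq qp))) subrr normr0.
apply: le_measure; rewrite ?inE// => x /=; rewrite in_itv /= => /andP[px xq].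
by apply: (itvI p q) => //; rewrite px xq.
Qed.

(** S lies in an interval of radius L around any of its points, hence the factor 2. *)
Lemma measure_le_diam (S : set R) (L : \bar R) : measurable (S : set mR) ->
  (forall x y, S x -> S y -> (`|x - y|%:E <= L)%E) -> (0 <= L)%E ->
  (leb S <= 2%:E * L)%E.
Proof.
move=> mS hS L0.
have [->|/set0P[x0 Sx0]] := eqVneq S set0; first by rewrite measure0 mule_ge0.
case: L hS L0 => [r| |]//= hS L0; last first.
  by rewrite gt0_muley ?lte_fin// leey.
have r0 : 0 <= r by rewrite -lee_fin.
apply: (@le_trans _ _ (leb `[x0 - r, x0 + r]%classic)).
  apply: le_measure; rewrite ?inE// => x Sx; rewrite /= in_itv /= -ler_distl.
  by rewrite -lee_fin hS.
rewrite lebesgue_measure_itv /=; case: ifP => _; last by rewrite mule_ge0.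
by rewrite -EFinB -EFinM lee_fin; lra.
Qed.

(** The null set N is covered by disjoint intervals of small total length. In E the
   preimage of an interval has diameter at most 1/k times its length. *)
Lemma expanding_preimage_null (f : R -> R) (E N : set R) (k : R) : 0 < k ->
  measurable_fun setT f -> measurable (E : set mR) ->
  (forall x y, E x -> E y -> k * `|x - y| <= `|f x - f y|) ->
  measurable (N : set mR) -> leb N = 0%E -> leb (E `&` f @^-1` N) = 0%E.
Proof.
move=> k0 mf mE hE mN N0.
have mpre (B : set R) : measurable (B : set mR) -> measurable ((E `&` f @^-1` B) : set mR).
  by move=> mB; apply: measurableI => //; rewrite -[_ @^-1` _]setTI; exact: mf.
apply/eqP; rewrite -measure_le0; apply/lee_addgt0Pr => e e0; rewrite add0e.
have e1 : 0 < k / 2 * e by rewrite mulr_gt0// divr_gt0.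
have fN : (leb N < +oo)%E by rewrite N0.
have [W [oW NW Wlt]] := @lebesgue_regularity_outer R N (k / 2 * e) mN fN e1.
have leW : (leb W <= (k / 2 * e)%:E)%E.
  have -> : W = N `|` (W `\` N).
    apply/seteqP; split => [x Wx|x [/NW//|[]//]].
    by have [Nx|nNx] := pselect (N x); [left|right].
  apply: (@le_trans _ _ (leb N + leb (W `\` N))%E).
    by apply: measureU2 => //; apply: measurableD => //; exact: open_measurable.
  by rewrite N0 add0e ltW.
pose I := open_disjoint_itv oW.
have mI i : measurable (I i : set mR) by apply: open_measurable; exact: open_disjoint_itv_open.
have WE : W = \bigcup_i I i by exact: open_disjoint_itv_bigcup.
have sumI : (\sum_(i <oo) leb (I i) = leb W)%E.
  rewrite [in RHS]WE measure_bigcup//; first by apply: eq_eseriesl => i; rewrite in_setT.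
  exact: open_disjoint_itv_trivIset.
have Ibound i : (leb (E `&` f @^-1` (I i)) <= (2 / k)%:E * leb (I i))%E.
  have k20 : 0 < k^-1 by rewrite invr_gt0.
  rewrite EFinM -muleA; apply: measure_le_diam; first exact: mpre.
    move=> x y [Ex Ix] [Ey Iy].
    have h := interval_length_le (mI i) (@open_disjoint_itv_is_interval _ _ oW i) Ix Iy.
    rewrite -(@lee_pmul2l _ k%:E) ?lte_fin// [X in (_ <= X)%E]muleA.
    rewrite -[X in (_ <= X * _)%E]EFinM mulfV ?gt_eqF// mul1e.
    by apply: le_trans h; rewrite -EFinM lee_fin hE.
  by rewrite mule_ge0// lee_fin ltW.
apply: (@le_trans _ _ (leb (\bigcup_i (E `&` f @^-1` (I i))))).
  apply: le_measure; rewrite ?inE; first exact: mpre.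
    by apply: bigcupT_measurable => i; exact: mpre.
  by move=> x [Ex /NW]; rewrite WE => -[i _ Iix]; exists i.
apply: (@le_trans _ _ (\sum_(i <oo) leb (E `&` f @^-1` (I i)))%E).
  apply: measure_sigma_subadditive => //; first by move=> i; exact: mpre.
  by apply: bigcupT_measurable => i; exact: mpre.
apply: (@le_trans _ _ (\sum_(i <oo) ((2 / k)%:E * leb (I i)))%E).
  by apply: lee_nneseries => // i _; exact: measure_ge0.
rewrite nneseriesZl; last by move=> i _; exact: measure_ge0.
rewrite sumI (_ : e = 2 / k * (k / 2 * e)); last by field; rewrite gt_eqF.
by rewrite [X in (_ <= X)%E]EFinM lee_pmul2l// lte_fin divr_gt0.
Qed.

(** For x <= y, e^(-x^2) - e^(-y^2) = e^(-y^2) (e^(y^2 - x^2) - 1), and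
   e^(y^2 - x^2) - 1 >= y^2 - x^2 >= 2a (y - x). *)
Lemma mult_fun_expanding (a b x y : R) : 0 < a -> a <= x <= b -> a <= y <= b ->
  Num.sqrt (2 * pi) * expR (- b ^+ 2) * (2 * a) * `|x - y| <=
  `|mult_fun x - mult_fun y|.
Proof.
move=> a0; wlog xy : x y / x <= y => [hw hx hy|].
  have [xy|/ltW yx] := leP x y; first exact: hw.
  by rewrite distrC [leRHS]distrC; exact: hw.
move=> /andP[ax xb] /andP[ay yb]; rewrite /mult_fun -mulrBr normrM.
rewrite [`|Num.sqrt _|]ger0_norm ?sqrtr_ge0// -!mulrA ler_wpM2l ?sqrtr_ge0//.
have x0 : 0 < x by exact: lt_le_trans ax.
have y0 : 0 < y by exact: lt_le_trans ay.
have -> : expR (- x ^+ 2) - expR (- y ^+ 2) =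
    expR (- y ^+ 2) * (expR (y ^+ 2 - x ^+ 2) - 1).
  by rewrite mulrBr mulr1 -expRD addrA addNr add0r.
rewrite normrM [`|expR _|]ger0_norm ?expR_ge0//.
apply: ler_pM; rewrite ?expR_ge0//.
- by rewrite !mulr_ge0// ltW.
- by rewrite ler_expR lerN2 ler_pXn2r// nnegrE ltW// (lt_le_trans y0).
apply: le_trans (ler_norm _); rewrite lerBrDl.
apply: le_trans (expR_ge1Dx _); rewrite lerD2l ler0_norm ?subr_le0// opprB.
rewrite subr_sqr (_ : 2 * (a * (y - x)) = (y - x) * (2 * a)); last by ring.
by rewrite ler_wpM2l ?subr_ge0//; lra.
Qed.

(** The line without 0 is the union of the intervals [1/n, n], where mult_fun is
   expanding, and of their reflections. *)
Lemma mult_fun_preimage_null (N : set mR) : measurable N -> leb N = 0%E ->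
  leb (mult_fun @^-1` N) = 0%E.
Proof.
move=> mN N0; pose f : R -> R := mult_fun.
have mf : measurable_fun setT f by exact: measurable_mult_fun.
have mpre : measurable (f @^-1` N : set mR) by rewrite -[_ @^-1` _]setTI; exact: mf.
pose Ep (n : nat) : set R := `[n.+1%:R^-1, n.+1%:R]%classic.
pose En (n : nat) : set R := `[- n.+1%:R, - n.+1%:R^-1]%classic.
have k0 n : 0 < Num.sqrt (2 * pi) * expR (- n.+1%:R ^+ 2) * (2 * n.+1%:R^-1) :> R.
  by rewrite !mulr_gt0 ?sqrtr_gt0 ?expR_gt0 ?invr_gt0 ?mulr_gt0 ?pi_gt0.
have mEp n : measurable (Ep n : set mR) by exact: measurable_itv.
have mEn n : measurable (En n : set mR) by exact: measurable_itv.
have hp n : leb (Ep n `&` f @^-1` N) = 0%E.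
  apply: (expanding_preimage_null (k0 n) mf (mEp n) _ mN N0) => x y.
  by rewrite /Ep /= !in_itv /= => hx hy; apply: mult_fun_expanding.
have hn n : leb (En n `&` f @^-1` N) = 0%E.
  apply: (expanding_preimage_null (k0 n) mf (mEn n) _ mN N0) => x y.
  rewrite /En /= !in_itv /= => /andP[x1 x2] /andP[y1 y2].
  have fN z : f (- z) = f z by rewrite /f /mult_fun sqrrN.
  have -> : `|x - y| = `|- x - - y| by rewrite -[RHS]normrN opprB opprK addrC.
  rewrite -(fN x) -(fN y).
  apply: (@mult_fun_expanding n.+1%:R^-1 n.+1%:R (- x) (- y)).
  - by rewrite invr_gt0.
  - by apply/andP; split; [rewrite lerNr|rewrite lerNl].
  - by apply/andP; split; [rewrite lerNr|rewrite lerNl].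
have cover : f @^-1` N `<=` [set (0 : R)] `|`
    \bigcup_n ((Ep n `&` f @^-1` N) `|` (En n `&` f @^-1` N)).
  move=> x Nx; have [->|x0] := eqVneq x 0; first by left.
  right; have xp : 0 < `|x| by rewrite normr_gt0.
  have [n hn1] : exists n : nat, `|x| <= n.+1%:R /\ n.+1%:R^-1 <= `|x|.
    have [n /ltW hn1] : exists n : nat, `|x| + `|x|^-1 < n.+1%:R.
      by exists (Num.truncn (`|x| + `|x|^-1)); exact: truncnS_gt.
    exists n; split; first by rewrite (le_trans _ hn1)// lerDl invr_ge0.
    rewrite -[leRHS]invrK lef_pV2 ?posrE ?invr_gt0//.
    by rewrite (le_trans _ hn1)// lerDr.
  exists n => //; have [xpos|xneg] := leP 0 x.
    by left; split => //; rewrite /Ep /= in_itv /=; rewrite ger0_norm// in hn1; case: hn1 => -> ->.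
  right; split => //; rewrite /En /= in_itv /=; rewrite ltr0_norm// in hn1.
  by case: hn1 => h1 h2; rewrite lerNl h1 lerNr h2.
have mp n : measurable ((Ep n `&` f @^-1` N) : set mR) by apply: measurableI.
have mn n : measurable ((En n `&` f @^-1` N) : set mR) by apply: measurableI.
apply: (measure_negligible mpre); apply: (@negligibleS _ mR R leb _ _ cover).
apply: negligibleU; first by apply/negligibleP => //; exact: lebesgue_measure_set1.
apply: negligible_bigcup => n; apply: negligibleU; apply/negligibleP => //.
- exact: hp.
- exact: hn.
Qed.

End null_preimages.

(** * The spectral family *)

Section spectral_family.
Context {R : realType}.
Local Notation mu := (hermite_measure R).
Local Notation leb := (@lebesgue_measure R).
Local Notation mR := (measurableTypeR R).
Local Notation V := (L2 mu).
Local Notation C := (coef_l2 (@hermite_vec_basis R)).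
Variable U : l2 R -> V.
Hypotheses (unitU : unitary U) (UK : cancel U C) (CK : cancel C U).
Implicit Types (x y : l2 R) (v w : V) (B : set R).
Local Notation A := (hermite_op U).
Local Notation h := (@mult_fun R : mR -> mR).

Lemma measurable_mult_preimage B : measurable (B : set mR) ->
  measurable (h @^-1` B : set mR).
Proof. by move=> mB; rewrite -[_ @^-1` _]setTI; exact: measurable_mult_fun. Qed.

Lemma spectral_symbol B : measurable (B : set mR) ->
  bounded_symbol (fun s : mR => (\1_(h @^-1` B) s : R)%:C).
Proof.
move=> mB; apply: (@bounded_symbol_real _ _ _ _ 1) => [|s].
  exact: measurable_indic (measurable_mult_preimage mB).
by rewrite indicE; case: (_ \in _); rewrite ?normr1 ?normr0.
Qed.

(** Spectral projections of a multiplication operator are multiplications by the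
   indicators of preimages. These are measurable for Borel B; elsewhere the value is
   set to 0. *)
Definition spectral_family B x : l2 R :=
  if pselect (measurable (B : set mR)) is left mB
  then C (mulop (spectral_symbol mB) (U x)) else 0.
Local Notation E := spectral_family.

Lemma spectral_familyE B (mB : measurable (B : set mR)) x :
  E B x = C (mulop (spectral_symbol mB) (U x)).
Proof.
rewrite /E; case: pselect => // mB'.
by congr (C _); apply: mulop_eq.
Qed.

Let inner_CU v x : inner (C v) x = inner v (U x).
Proof. by rewrite -{1}(UK x) coef_l2_inner. Qed.

Let indicM (S : set mR) (s : mR) : (\1_S s : R)%:C * (\1_S s : R)%:C = (\1_S s : R)%:C :> R[i].
Proof. by rewrite indicE; case: (_ \in _); rewrite ?mulr1 ?mulr0. Qed.

Lemma spectral_projection B : measurable (B : set mR) -> orthogonal_projection (E B).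
Proof.
move=> mB; have [linU _ _] := unitU; split.
- by move=> a x y; rewrite !(spectral_familyE mB) linU mulop_linear coef_l2_linear.
- move=> x; rewrite !(spectral_familyE mB) CK.
  by congr (C _); apply: mulop_comp => s; exact: indicM.
- move=> x y; rewrite !(spectral_familyE mB) inner_CU mulop_sym; last first.
    by move=> s; rewrite -[_^*]/((\1_(h @^-1` B) s : R) +i* - 0) oppr0.
  by rewrite [LHS]inner_conj [RHS]inner_conj inner_CU.
Qed.

Lemma inner_spectral_family B (mB : measurable (B : set mR)) x :
  inner (E B x) x = (\int[mu]_s ((\1_(h @^-1` B) s : R) * abs2 (U x s)))%:C.
Proof. by rewrite (spectral_familyE mB) inner_CU mulop_real_inner. Qed.

Lemma sqn_spectral_family B (mB : measurable (B : set mR)) x :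
  sqn (E B x) = \int[mu]_s ((\1_(h @^-1` B) s : R) * abs2 (U x s)).
Proof.
rewrite (spectral_familyE mB) sqn_coef_l2 sqn_mulop; apply: eq_Rintegral => s _.
by rewrite abs2_real indicE; case: (_ \in _); rewrite ?expr1n ?expr0n.
Qed.

Lemma spectral_familyB B1 B2 x : measurable (B1 : set mR) -> measurable (B2 : set mR) ->
  B2 `<=` B1 -> E B1 x - E B2 x = E (B1 `\` B2) x.
Proof.
move=> m1 m2 B21; have m3 : measurable (B1 `\` B2 : set mR) by exact: measurableD.
rewrite (spectral_familyE m1) (spectral_familyE m2) (spectral_familyE m3).
rewrite addrC -scaleN1r -coef_l2_linear; congr (C _); rewrite addrC.
apply: mulopD => s; rewrite mulN1r -rmorphB; congr (_%:C).
rewrite !indicE; have [sB2|sB2] := pselect (B2 (h s)).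
  have -> : (s \in h @^-1` (B1 `\` B2)) = false by apply/negbTE/negP; rewrite inE => -[].
  have -> : (s \in h @^-1` B1) by rewrite inE; exact: B21.
  have -> : (s \in h @^-1` B2) by rewrite inE.
  by rewrite subrr.
have -> : (s \in h @^-1` B2) = false by apply/negbTE/negP; rewrite inE.
have -> : (s \in h @^-1` (B1 `\` B2)) = (s \in h @^-1` B1).
  by apply/idP/idP; rewrite !inE //= => -[].
by rewrite subr0.
Qed.

Let iv x : mu.-integrable setT (fun s => (abs2 (U x s))%:E).
Proof. exact: integrable_abs2 (L2_square_integrable (U x)). Qed.

(** The remainder after n terms is the projection of x for the union T n of the F k
   with k >= n. These unions decrease to the empty set, so the squared norm of the
   remainder tends to 0 by dominated convergence. *)
Lemma spectral_family_cvg (F : nat -> set R) x :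
  (forall k, measurable (F k : set mR)) -> trivIset [set: nat] F ->
  series (fun k => E (F k) x) @ \oo --> E (\bigcup_k F k) x.
Proof.
move=> mF tF; pose T n := \bigcup_(k in [set k | (n <= k)%N]) F k.
have mT n : measurable (T n : set mR) by apply: bigcup_measurable => k _; exact: mF.
have TS n : T n.+1 = T n `\` F n.
  apply/seteqP; split => s.
    move=> [k /= nk Fk]; split; first by exists k => //=; exact: ltnW.
    move=> Fn; have := tF k n I I (ex_intro _ s (conj Fk Fn)) => kn.
    by rewrite kn ltnn in nk.
  move=> [[k /= nk Fk] nFn]; exists k => //=; rewrite ltn_neqAle nk andbT.
  by apply/eqP => kn; apply: nFn; rewrite kn.
have ser n : E (\bigcup_k F k) x - series (fun k => E (F k) x) n = E (T n) x.
  elim: n => [|n ih].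
    rewrite /series /= big_geq// subr0; congr (E _ x).
    by apply/seteqP; split => s [k _ Fk]; exists k.
  rewrite /series /= big_nat_recr //= opprD addrA -/(series (fun k => E (F k) x) n).
  rewrite [_ - series _ _]ih spectral_familyB// ?TS//.
  by move=> s Fs; exists n => //=.
apply: cvg_sqn; under eq_fun do rewrite ser (sqn_spectral_family (mT _)).
have mi n : measurable_fun setT (fun s : mR => ((\1_(h @^-1` (T n)) s : R) * abs2 (U x s))%:E).
  apply/measurable_EFinP; apply: measurable_funM.
    exact: measurable_indic (measurable_mult_preimage (mT n)).
  exact: measurable_abs2 (L2_square_integrable (U x)).1.
have ptw s : (fun n => ((\1_(h @^-1` (T n)) s : R) * abs2 (U x s))%:E) @ \oo --> 0%E.
  apply: cvg_near_cst; have [[k _ Fk]|nF] := pselect ((\bigcup_k F k) (h s)); last first.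
    apply: nearW => n; rewrite indicE memNset ?mul0r// => -[k _ Fk].
    by apply: nF; exists k.
  exists k.+1 => // n /= kn; rewrite indicE memNset ?mul0r// => -[j /= nj Fj].
  have := tF k j I I (ex_intro _ (h s) (conj Fk Fj)) => kj.
  by rewrite kj ltnNge nj in kn.
have bnd s n : (`|((\1_(h @^-1` (T n)) s : R) * abs2 (U x s))%:E| <= (abs2 (U x s))%:E)%E.
  rewrite gee0_abs ?lee_fin ?mulr_ge0 ?abs2_ge0// indicE.
  by case: (s \in _); rewrite ?mul1r ?mul0r ?abs2_ge0.
have [_ _] := @dominated_convergence _ _ _ mu setT measurableT _ (fun=> 0%E) _
  mi ltac:(exact: measurable_cst) ltac:(exact: (aeW mu (fun s _ => ptw s))) (iv x)
  ltac:(exact: (aeW mu (fun s n _ => bnd s n))).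
by rewrite integral0 => /fine_cvg.
Qed.

Lemma spectral_family_pvm : projection_valued_measure E.
Proof.
split.
- by move=> B mB; exact: spectral_projection.
- move=> x; have mT : measurable ([set: R] : set mR) by exact: measurableT.
  rewrite (spectral_familyE mT) mulop_id ?UK// => s.
  by rewrite indicE mem_set.
- by move=> F x mF tF; exact: spectral_family_cvg.
Qed.

Lemma spectral_measureE B x : measurable (B : set mR) ->
  spectral_measure E x B = (\int[mu]_(s in h @^-1` B) (abs2 (U x s))%:E)%E.
Proof.
move=> mB; rewrite /spectral_measure (inner_spectral_family mB) /=.
rewrite [RHS]integral_mkcond /Rintegral fineK.
  apply: eq_integral => s _; rewrite patchE indicE.
  by case: ifP => _; rewrite ?mul1r ?mul0r.
apply: integrable_fin_num => //.
apply: (@integrable_symbol_abs2 _ _ _ _ _ 1).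
  exact: measurable_indic (measurable_mult_preimage mB).
by move=> s; rewrite indicE; case: (_ \in _); rewrite ?normr1 ?normr0.
Qed.

(** The spectral measure of x is the image under h of the measure |U x|^2 mu. *)
Lemma integral_spectral_measure x (f : R -> \bar R) :
  measurable_fun setT (f : mR -> \bar R) ->
  (\int[spectral_measure E x]_t f t = \int[mu]_s (f (h s) * (abs2 (U x s))%:E))%E.
Proof.
move=> mf; apply: (@integral_pushforward_density _ _ mR mR R mu (fun s => abs2 (U x s)) h) => //.
- exact: measurable_abs2 (L2_square_integrable (U x)).1.
- by move=> s; exact: abs2_ge0.
- exact: measurable_mult_fun.
- by move=> B mB; exact: spectral_measureE.
Qed.

(** By the change of variables t = h(s) the second moment of the spectral measure of
   x is the integral of h^2 |U x|^2, finite for every x as h is bounded, and its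
   first moment is the integral of h |U x|^2, the quadratic form of A. *)
Lemma hermite_spectral_resolution : spectral_resolution (graph_of A) E.
Proof.
split; first exact: spectral_family_pvm.
- rewrite graph_domain; apply/esym/seteqP; split => // x _ /=.
  rewrite integral_spectral_measure; last first.
    by apply/measurable_EFinP; exact: measurable_funX.
  under eq_integral do rewrite -EFinM.
  have := @integrable_symbol_abs2 _ _ _ mu (fun s => mult_fun s ^+ 2)
    (Num.sqrt (2 * pi) ^+ 2) (U x) (measurable_funX 2 measurable_mult_fun).
  have bnd (s : mR) : `|mult_fun s ^+ 2| <= Num.sqrt (2 * pi) ^+ 2 :> R.
    rewrite ger0_norm ?sqr_ge0// ler_pXn2r ?nnegrE ?(ltW sqrt2pi_gt0) ?(ltW (mult_fun_gt0 s))//.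
    exact: mult_fun_le.
  move=> /(_ bnd) /integrableP[_]; apply: le_lt_trans; rewrite le_eqVlt; apply/orP; left.
  apply/eqP; apply: eq_integral => s _; rewrite gee0_abs// lee_fin mulr_ge0 ?sqr_ge0//.
  exact: abs2_ge0.
- move=> [x y]; rewrite graph_ofE /= => ->.
  rewrite integral_spectral_measure; last exact/measurable_EFinP.
  rewrite inner_CU mulop_real_inner; congr (_%:C).
Qed.

(** The preimage under h of a Lebesgue-null set is Lebesgue-null, hence mu-null,
   hence null for |U x|^2 mu. *)
Lemma spectral_measure_dominated x :
  spectral_measure E x `<< leb.
Proof.
apply/null_content_dominatesP => N mN N0; rewrite spectral_measureE//.
have m0 : mu (h @^-1` N) = 0%E.
  have l0 := mult_fun_preimage_null mN N0.
  apply: null_set_integral => //; first exact: measurable_mult_preimage.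
  apply/measurable_EFinP; apply: (@measurable_funTS _ _ mR mR).
  exact: measurable_hermite_density.
apply: null_set_integral => //; first exact: measurable_mult_preimage.
apply/measurable_EFinP; apply: (@measurable_funTS _ _ mR mR).
exact: measurable_abs2 (L2_square_integrable (U x)).1.
Qed.

Lemma hermite_ac_subspace : ac_subspace (graph_of A) = setT.
Proof.
apply/seteqP; split => // x _; exists E; split; first exact: hermite_spectral_resolution.
exact: spectral_measure_dominated.
Qed.

End spectral_family.

(** * Self-adjointness, diagonalization and spectrum *)

Theorem theorem5 (R : realType) :
  exists H : set (l2 R * l2 R),
    [/\ determines_operator H3 H,
        self_adjoint H,
        exists P : nat -> L2 (hermite_measure R),
          [/\ forall n, L2_to_fun (P n) =
                (fun x => (hermite_hat n x)%:C) %[ae (hermite_measure R)],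
              orthonormal_basis P &
              exists U : l2 R -> L2 (hermite_measure R),
                [/\ unitary U,
                    forall n, U (l2_basis n) = P n,
                    forall U', unitary U' ->
                      (forall n, U' (l2_basis n) = P n) -> U' = U &
                    op_conj U H = mult_op (hermite_measure R) mult_fun]] &
        [/\ bounded_operator H,
            spectrum H = [set t%:C | t in `[0, Num.sqrt (2 * pi)]],
            spectrum_ac H = [set t%:C | t in `[0, Num.sqrt (2 * pi)]] &
            op_norm H = (Num.sqrt (2 * pi))%:E]].
Proof.
have cV := @L2_fast_complete _ (measurableTypeR R) R (hermite_measure R).
have [U [unitU Ue Uuniq [UK CK]]] := exists_unitary (@hermite_vec_basis R) cV.
have linA := hermite_op_linear unitU.
have symA := hermite_op_sym UK.
have bndA := hermite_op_bound UK.
have specH := hermite_op_spectrum UK CK.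
exists (graph_of (hermite_op U)); split.
- exact: hermite_op_determined.
- exact: graph_self_adjoint.
- exists (@hermite_vec R); split.
  + exact: hermite_vecE.
  + exact: hermite_vec_basis.
  + by exists U; split => //; exact: hermite_op_conj.
- split.
  + exact: (graph_bounded sqrt2pi_gt0 bndA).
  + exact: specH.
  + by rewrite /spectrum_ac hermite_ac_subspace.
  + apply: op_norm_graph linA sqrt2pi_gt0 bndA _.
    by apply: hermite_op_approx; rewrite ?lexx ?(ltW sqrt2pi_gt0).
Qed.
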